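(* A compact set $K\subseteq\mathbb R$ has the smooth extension property if and only if $C^\infty(K)$ satisfies $(\mathrm{DN})$.
   Context: For compact $K\subseteq\mathbb R$ let $C^\infty(K)=\{F|_K: F\in C^\infty(\mathbb R)\}$, endowed with the quotient topology of the Fréchet space $C^\infty(\mathbb R)$ (scalar-valued smooth functions with uniform convergence of all derivatives on compact sets) under the restriction map $R:F\mapsto F|_K$. Equivalently, the topology is given by the norms $|||f|||_n=\inf\{\|F\|_n: F\in C^\infty(\mathbb R),\ F|_K=f\}$, where $\|F\|_n=\sup\{|F^{(j)}(x)|:x\in\mathbb R,\ 0\le j\le n\}\in[0,\infty]$. $K$ has the smooth extension property if there is a continuous linear operator $E:C^\infty(K)\to C^\infty(\mathbb R)$ with $E(f)|_K=f$ for all $f\in C^\infty(K)$. A Fréchet space $X$ with an increasing fundamental sequence of seminorms $(\|\cdot\|_n)_n$ satisfies $(\mathrm{DN})$ (has a dominating norm) if there is $n$ such that for every $m\ge n$ there are $k\ge m$ and $c>0$ with $\|x\|_m^2\le c\,\|x\|_k\,\|x\|_n$ for all $x\in X$. *)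

(* Defs.v *)
From Stdlib Require Import Reals.
From Coquelicot Require Import Coquelicot.

Open Scope R_scope.

Set Implicit Arguments.

Section SmoothFunctions.

(* The scalar field V is R or C: as a normed space over R it carries the
   derivatives and the absolute value, and [mul] is its multiplication. *)
Variables (V : NormedModule R_AbsRing) (mul : V -> V -> V).

(* C^oo(R). A smooth function F is stored as the sequence of its successive
   derivatives, [jet F j] being F^(j); derivatives being unique, this sequence
   is determined by F = [jet F 0]. *)
Record Cinf := MkCinf {
  jet : nat -> R -> V;
  jet_derive : forall j x, is_derive (jet j) x (jet (S j) x) }.

Definition eval (F : Cinf) (x : R) : V := jet F 0 x.

(* Topology of uniform convergence of all derivatives on compact sets. *)
Definition Cinf_open (U : Cinf -> Prop) : Prop :=
  forall F, U F ->
  exists (L : R -> Prop) (n : nat) (eps : R), compact L /\ 0 < eps /\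
    forall G, (forall j x, (j <= n)%nat -> L x ->
                 norm (minus (jet G j x) (jet F j x)) < eps) -> U G.

(* ||F||_n, with values in [0, +oo]. *)
Definition Cinf_norm (n : nat) (F : Cinf) : Rbar :=
  Lub_Rbar (fun r => exists j x, (j <= n)%nat /\ r = norm (jet F j x)).

Variable K : R -> Prop.

(* C^oo(K), as a set of functions defined on K only. *)
Definition CinfK : Type :=
  {f : {x : R | K x} -> V | exists F : Cinf, f = fun x => eval F (proj1_sig x)}.

Definition evalK (f : CinfK) : {x : R | K x} -> V := proj1_sig f.

Definition restr (F : Cinf) : CinfK :=
  exist _ (fun x => eval F (proj1_sig x)) (ex_intro _ F eq_refl).

(* Quotient topology under the restriction map. *)
Definition CinfK_open (U : CinfK -> Prop) : Prop :=
  Cinf_open (fun F => U (restr F)).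

(* |||f|||_n; for compact K the infimum is finite, as extensions may be cut
   off outside a neighbourhood of K. *)
Definition CinfK_norm (n : nat) (f : CinfK) : Rbar :=
  Rbar_glb (fun r => exists F : Cinf, restr F = f /\ r = Cinf_norm n F).

Definition linear_operator (E : CinfK -> Cinf) : Prop :=
  forall (a b : V) (f g h : CinfK),
    (forall x, evalK h x = plus (mul a (evalK f x)) (mul b (evalK g x))) ->
    forall t, eval (E h) t = plus (mul a (eval (E f) t)) (mul b (eval (E g) t)).

Definition continuous_operator (E : CinfK -> Cinf) : Prop :=
  forall U, Cinf_open U -> CinfK_open (fun f => U (E f)).

Definition smooth_extension_property : Prop :=
  exists E : CinfK -> Cinf,
    linear_operator E /\ continuous_operator E /\ forall f, restr (E f) = f.

End SmoothFunctions.

Arguments CinfK_norm V K n f : clear implicits.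

(* Condition (DN) for a sequence of seminorms [p], allowed a priori to take
   values in [0, +oo]. *)
Definition DN (X : Type) (p : nat -> X -> Rbar) : Prop :=
  exists n : nat, forall m : nat, (n <= m)%nat ->
  exists (k : nat) (c : R), (m <= k)%nat /\ 0 < c /\
    forall x : X,
      Rbar_le (Rbar_mult (p m x) (p m x))
              (Rbar_mult (Finite c) (Rbar_mult (p k x) (p n x))).

(* Main.v *)
(** Necessity.  If E is an extension operator and chi a cut-off function, chi E f
    has compact support, so its norms obey the Landau-Kolmogorov inequalities;
    continuity of E turns them into (DN).

    Sufficiency.  For fixed m, cover a neighbourhood of K by cells of length e and
    replace F on each cell by its Newton interpolation polynomial at up to m
    points.  If a cell carries m nodes, Rolle's theorem bounds the j-th derivative
    of the error by e^(m-j) sup |F^(m)|; if it carries fewer, they exhaust K there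
    and the error vanishes on K.  Iterating over the scales e = L^-v, with L large
    enough to absorb the constant lost at each step, expands F on K into smooth
    atoms whose coefficients are divided differences.  With nodes in K this gives,
    for each m, an extension operator into C^m.  With m nodes in every cell, those
    in K coming first, it expands any C^m function vanishing on K into smooth
    atoms vanishing on K.

    The operators of different orders are glued by a Mittag-Leffler argument.  The
    difference T of two of them takes values in functions vanishing on K, hence
    expands into atoms with coefficients continuous in |||.|||_k.  By (DN) and
    Hahn-Banach each coefficient at scale e is psi + rho with psi of order e^-4 in
    the dual of the dominating norm |||.|||_n and rho of order e^4 in the dual of a
    stronger norm.  The rho-part of T gains derivatives and is absorbed in the
    operator of higher order; the psi-part loses derivatives but is small with
    respect to one fixed norm, so that these parts are summable.  The case of
    complex scalars reduces to real and imaginary parts. *)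

Require Import Defs.
From Stdlib Require Import Reals Lra Lia ZArith Arith Factorial List Classical ClassicalEpsilon
  FunctionalExtensionality ProofIrrelevance.
From mathcomp Require Import ssreflect.
From mathcomp Require boolp classical_sets.
From Coquelicot Require Import Coquelicot.
Import List.
Open Scope R_scope.



(** The values on K do not determine derivatives at isolated points of K, so coefficients must be
    computed from values alone; divided differences do this and still obey derivative bounds.
    Extension into C^p for a fixed finite p is then possible for every compact K, and (DN) enters
    only when operators of different orders are glued. Exponents: the top derivative of the
    interpolation residual grows like 1/e, so a coefficient carries e^(m-1-l) instead of e^(m-l). As
    atoms have size e^l, coefficients of size e^(r-l) give a series converging in C^(r-2): one power
    pays for the 1/e cells of a scale, one for the sum over the scales. Splitting by e^-4 and e^4
    thus turns an operator of order m into parts of orders m-1-4-2 = m-7 and m-1+4-2 = m+1. The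
    exponent 4 is the least for which the second part gains an order, and the loss 7 is the reserve
    of derivatives kept at every stage of the gluing. C^oo(K) is handled as smooth functions on R
    modulo those vanishing on K: norms and functionals live on representatives. *)

(** * Finite sums *)

Fixpoint rsum (n : nat) (f : nat -> R) : R :=
  match n with O => 0 | S k => rsum k f + f k end.

Lemma rsum_ext n f g : (forall i, (i < n)%nat -> f i = g i) -> rsum n f = rsum n g.
Proof.
elim: n => [//|n IH] H /=.
rewrite IH; last by move=> i Hi; apply H; lia.
by rewrite H //; lia.
Qed.

Lemma rsum_plus n f g : rsum n (fun i => f i + g i) = rsum n f + rsum n g.
Proof. elim: n => [|n IH] /=; rewrite ?IH; ring. Qed.

Lemma rsum_scal n a f : rsum n (fun i => a * f i) = a * rsum n f.
Proof. elim: n => [|n IH] /=; rewrite ?IH; ring. Qed.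

Lemma rsum_lin n a b f g :
  rsum n (fun i => a * f i + b * g i) = a * rsum n f + b * rsum n g.
Proof. by rewrite rsum_plus !rsum_scal. Qed.

Lemma rsum_zero n f : (forall i, (i < n)%nat -> f i = 0) -> rsum n f = 0.
Proof.
move=> H. rewrite (rsum_ext n f (fun _ => 0 * 0)).
  by rewrite rsum_scal Rmult_0_l.
by move=> i Hi; rewrite H //; ring.
Qed.

Lemma rsum_abs_le n f B :
  (forall i, (i < n)%nat -> Rabs (f i) <= B) -> Rabs (rsum n f) <= INR n * B.
Proof.
elim: n => [|n IH] H.
  by rewrite /= Rabs_R0; lra.
rewrite S_INR /=; eapply Rle_trans; first exact: Rabs_triang.
have := IH (fun i Hi => H i ltac:(lia)).
have := H n ltac:(lia). lra.
Qed.

Lemma is_derive_rsum n (f : nat -> R -> R) (g : nat -> R) (x : R) :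
  (forall i, (i < n)%nat -> is_derive (f i) x (g i)) ->
  is_derive (fun y => rsum n (fun i => f i y)) x (rsum n g).
Proof.
elim: n => [|n IH] H /=.
  exact: is_derive_const.
apply: (is_derive_plus (V := R_NormedModule)); last by apply H; lia.
apply: IH => i Hi; apply H; lia.
Qed.

(* At most three integers lie at distance less than 1 from y. *)
Lemma rsum_overlap n (f : nat -> R) (y B : R) :
  0 <= B -> (forall i, (i < n)%nat -> Rabs (f i) <= B) ->
  (forall i, (i < n)%nat -> 1 <= Rabs (y - INR i) -> f i = 0) ->
  Rabs (rsum n f) <= 3 * B.
Proof.
move=> HB Hf H0.
(* Only indices above y - 1 can contribute, and fewer than n - y + 1 of them lie below n; this
   running count, capped at 3, carries the induction. *)
suff : Rabs (rsum n f) <= B * Rmin 3 (Rmax 0 (INR n - y + 1)).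
  have := Rmin_l 3 (Rmax 0 (INR n - y + 1)) => H1 H2.
  apply: (Rle_trans _ _ _ H2). rewrite (Rmult_comm 3); exact: Rmult_le_compat_l.
elim: n Hf H0 => [|n IH] Hf H0.
  rewrite /= Rabs_R0. apply: Rmult_le_pos => //. apply: Rmin_glb; [lra|exact: Rmax_l].
have {}IH := IH (fun i Hi => Hf i ltac:(lia)) (fun i Hi => H0 i ltac:(lia)).
rewrite [rsum _ _]/=.
apply: Rle_trans (Rabs_triang _ _) _.
have Hn := Hf n ltac:(lia). have H0n := H0 n ltac:(lia).
rewrite S_INR.
case: (Rle_dec 1 (Rabs (y - INR n))) => Hy.
  rewrite (H0n Hy) Rabs_R0 Rplus_0_r. apply: Rle_trans IH _.
  apply: Rmult_le_compat_l => //. apply: Rle_min_compat_l. apply: Rle_max_compat_l. lra.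
have : Rmin 3 (Rmax 0 (INR n - y + 1)) + 1 <= Rmin 3 (Rmax 0 (INR n + 1 - y + 1)).
  move/Rnot_le_lt: Hy => /Rabs_def2 [Hy1 Hy2].
  rewrite (Rmax_right 0 (INR n - y + 1)); last lra.
  rewrite (Rmax_right 0 (INR n + 1 - y + 1)); last lra.
  rewrite (Rmin_right 3 (INR n - y + 1)); last lra.
  rewrite (Rmin_right 3 (INR n + 1 - y + 1)); lra.
nra.
Qed.

(** * Jets *)

(* A function together with candidates for its successive derivatives. *)
Definition Jet := nat -> R -> R.

Definition isjet (m : nat) (d : Jet) : Prop :=
  forall j x, (j < m)%nat -> is_derive (d j) x (d (S j) x).

Definition smooth (d : Jet) : Prop := forall j x, is_derive (d j) x (d (S j) x).

Lemma smooth_isjet m d : smooth d -> isjet m d.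
Proof. by move=> H j x _. Qed.

Lemma isjet_le m p d : (p <= m)%nat -> isjet m d -> isjet p d.
Proof. move=> H Hd j x Hj; apply Hd; lia. Qed.

Definition shift (d : Jet) : Jet := fun j => d (S j).

(* The Leibniz rule (d e)^(j+1) = (d' e)^(j) + (d e')^(j), without binomials. *)
Fixpoint jmul (d e : Jet) (j : nat) (x : R) {struct j} : R :=
  match j with
  | O => d 0%nat x * e 0%nat x
  | S k => jmul (shift d) e k x + jmul d (shift e) k x
  end.

Lemma jmul_derive j d e x :
  (forall i, (i <= j)%nat -> is_derive (d i) x (d (S i) x)) ->
  (forall i, (i <= j)%nat -> is_derive (e i) x (e (S i) x)) ->
  is_derive (jmul d e j) x (jmul d e (S j) x).
Proof.
elim: j d e => [|j IH] d e Hd He.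
  rewrite /= /shift.
  apply: (is_derive_mult (d 0%nat) (e 0%nat)); [exact: Hd|exact: He|].
  exact: Rmult_comm.
change (jmul d e (S (S j)) x) with
  (plus (jmul (shift d) e (S j) x) (jmul d (shift e) (S j) x)).
apply: (is_derive_plus (V := R_NormedModule)).
- by apply: IH => i Hi; [apply (Hd (S i))|apply He]; lia.
- by apply: IH => i Hi; [apply Hd|apply (He (S i))]; lia.
Qed.

Lemma isjet_jmul m d e : isjet m d -> isjet m e -> isjet m (jmul d e).
Proof.
move=> Hd He j x Hj; apply: jmul_derive => i Hi; [apply Hd|apply He]; lia.
Qed.

Lemma smooth_jmul d e : smooth d -> smooth e -> smooth (jmul d e).
Proof. by move=> Hd He j x; apply: jmul_derive. Qed.

(** Each unfolding of the Leibniz recursion doubles the number of terms and puts one derivative on a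
    factor; the weights [eps ^ i] absorb it, so the constant does not depend on the scale [eps]. *)
Lemma jmul_bound (eps : R) j d e x B1 B2 : 0 < eps ->
  (forall i, (i <= j)%nat -> eps ^ i * Rabs (d i x) <= B1) ->
  (forall i, (i <= j)%nat -> eps ^ i * Rabs (e i x) <= B2) ->
  eps ^ j * Rabs (jmul d e j x) <= 2 ^ j * B1 * B2.
Proof.
move=> He.
elim: j d e B1 B2 => [|j IH] d e B1 B2 Hd Hee.
  have := Hd 0%nat ltac:(lia). have := Hee 0%nat ltac:(lia).
  rewrite /= Rabs_mult !Rmult_1_l => H1 H2.
  apply: Rmult_le_compat => //; exact: Rabs_pos.
have Hs (f : Jet) B : (forall i, (i <= S j)%nat -> eps ^ i * Rabs (f i x) <= B) ->
    forall i, (i <= j)%nat -> eps ^ i * Rabs (shift f i x) <= B / eps.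
  move=> Hf i Hi. have := Hf (S i) ltac:(lia). rewrite /= /shift => H.
  apply: (Rmult_le_reg_l eps) => //.
  have -> : eps * (B / eps) = B by field; lra. lra.
have H1 := IH (shift d) e _ _ (Hs _ _ Hd) (fun i Hi => Hee i ltac:(lia)).
have H2 := IH d (shift e) _ _ (fun i Hi => Hd i ltac:(lia)) (Hs _ _ Hee).
rewrite [jmul _ _ _ _]/=.
have HT := Rabs_triang (jmul (shift d) e j x) (jmul d (shift e) j x).
have Hp : 0 <= eps ^ j by apply: pow_le; lra.
have H3 : eps ^ S j * Rabs (jmul (shift d) e j x + jmul d (shift e) j x) <=
   eps * (eps ^ j * Rabs (jmul (shift d) e j x) + eps ^ j * Rabs (jmul d (shift e) j x)).
  rewrite /=. 
  have := Rmult_le_compat_l (eps * eps ^ j) _ _ ltac:(nra) HT. lra.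
apply: Rle_trans H3 _.
have -> : 2 ^ S j * B1 * B2 = eps * (2 ^ j * (B1 / eps) * B2 + 2 ^ j * B1 * (B2 / eps)).
  rewrite /=; field; lra.
apply: Rmult_le_compat_l; lra.
Qed.

Lemma jmul_zero_l j d e x : (forall i, (i <= j)%nat -> d i x = 0) -> jmul d e j x = 0.
Proof.
elim: j d e => [|j IH] d e H /=; first by rewrite H //; ring.
rewrite !IH; [ring| |] => i Hi; [apply H; lia|apply (H (S i)); lia].
Qed.

(** Lets identities between values on an open interval, such as linearity, pass to all
    derivatives. *)
Lemma jet_unique (a b : R) (d e : Jet) m : isjet m d -> isjet m e ->
  (forall x, a < x < b -> d 0%nat x = e 0%nat x) ->
  forall j x, (j <= m)%nat -> a < x < b -> d j x = e j x.
Proof.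
move=> Hd He H0; elim=> [|j IH] x Hj Hx; first exact: H0.
have H1 := Hd j x ltac:(lia). have H2 := He j x ltac:(lia).
rewrite -(is_derive_unique _ _ _ H1) -(is_derive_unique _ _ _ H2).
apply: Derive_ext_loc.
have Hpos : 0 < Rmin (x - a) (b - x) by apply: Rmin_pos; lra.
exists (mkposreal _ Hpos) => y Hy. apply: IH; first lia.
move: Hy; rewrite /ball /= /AbsRing_ball /= /abs /minus /plus /opp /= => Hy.
have := Rmin_l (x - a) (b - x); have := Rmin_r (x - a) (b - x).
move/Rabs_def2: Hy; lra.
Qed.

Lemma mvt_bound (f g : R -> R) (a b B : R) :
  (forall x, Rmin a b <= x <= Rmax a b -> is_derive f x (g x)) ->
  (forall x, Rmin a b <= x <= Rmax a b -> Rabs (g x) <= B) ->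
  Rabs (f b - f a) <= B * Rabs (b - a).
Proof.
move=> Hf Hg.
have [c [Hc ->]] := MVT_gen f a b g (fun x Hx => Hf x ltac:(lra))
  (fun x Hx => proj2 (continuity_pt_filterlim f x)
     (ex_derive_continuous f x (ex_intro _ _ (Hf x Hx)))).
rewrite Rabs_mult; apply: Rmult_le_compat_r; [exact: Rabs_pos|exact: Hg].
Qed.


Lemma jmul_zero_r j d e x : (forall i, (i <= j)%nat -> e i x = 0) -> jmul d e j x = 0.
Proof.
elim: j d e => [|j IH] d e H /=; first by rewrite H //; ring.
rewrite !IH; [ring| |] => i Hi; [apply (H (S i)); lia|apply H; lia].
Qed.

Definition jaff (s a : R) (d : Jet) : Jet := fun j x => s ^ j * d j (s * (x - a)).

Lemma smooth_jaff s a d : smooth d -> smooth (jaff s a d).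
Proof.
move=> H j x; rewrite /jaff.
have -> : s ^ S j * d (S j) (s * (x - a)) = s ^ j * (s * d (S j) (s * (x - a))) by rewrite /=; ring.
apply: is_derive_scal.
apply: (is_derive_comp (d j) (fun y => s * (y - a))); first exact: H.
by auto_derive => //; ring.
Qed.

(** * A smooth step function *)

(** The power of [/ x] makes the family closed under differentiation up to linear combinations, so
    all derivatives of exp(-1/x) are explicit. *)
Definition flat (k : nat) (x : R) : R :=
  match Rle_dec x 0 with left _ => 0 | right _ => (/ x) ^ k * exp (- / x) end.

Lemma exp_mult_INR n u : exp (INR n * u) = exp u ^ n.
Proof.
elim: n => [|n IH]; first by rewrite Rmult_0_l exp_0.
by rewrite S_INR Rmult_plus_distr_r Rmult_1_l exp_plus IH /= Rmult_comm.
Qed.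

(** The n-th power of 1 + u/n <= exp(u/n). For n = 0 the constant is 0^0 = 1. *)
Lemma exp_ge_pow (n : nat) (u : R) : 0 <= u -> u ^ n <= INR n ^ n * exp u.
Proof.
move=> Hu; case: n => [|n].
  rewrite /=; have := exp_ineq1_le u; lra.
set N := INR (S n).
have HN : 0 < N by apply: lt_0_INR; lia.
have -> : exp u = exp (u / N) ^ S n.
  by rewrite -exp_mult_INR -/N; congr exp; field; lra.
rewrite -Rpow_mult_distr; apply: pow_incr; split=> //.
have := exp_ineq1_le (u / N) => H.
have := Rmult_le_compat_l N _ _ ltac:(lra) H.
have -> : N * (1 + u / N) = N + u by field; lra.
lra.
Qed.

(** A quadratic bound forces the derivative 0 at the junction point 0. *)
Lemma flat_le_sqr k x : Rabs (flat k x) <= INR (k + 2) ^ (k + 2) * x ^ 2.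
Proof.
rewrite /flat; case: Rle_dec => Hx.
  rewrite Rabs_R0; apply: Rmult_le_pos; [apply: pow_le; exact: pos_INR|exact: pow2_ge_0].
have {}Hx : 0 < x by lra.
have Hi : 0 < / x by exact: Rinv_0_lt_compat.
rewrite Rabs_pos_eq; last by apply: Rmult_le_pos; [apply: pow_le; lra|left; exact: exp_pos].
have H := exp_ge_pow (k + 2) (/ x) ltac:(lra).
rewrite exp_Ropp.
apply: (Rmult_le_reg_r (exp (/ x))); first exact: exp_pos.
have -> : (/ x) ^ k * / exp (/ x) * exp (/ x) = (/ x) ^ (k + 2) * x ^ 2.
  rewrite pow_add; field; split; [lra|have := exp_pos (/ x); lra].
have := pow2_ge_0 x => H2.
have := Rmult_le_compat_r _ _ _ H2 H. lra.
Qed.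

Lemma is_derive_flat k x :
  is_derive (flat k) x (flat (k + 2) x - INR k * flat (k + 1) x).
Proof.
case: (Rtotal_order x 0) => [Hx|[->|Hx]].
- have -> : flat (k + 2) x - INR k * flat (k + 1) x = 0.
    rewrite /flat; case: Rle_dec => H; [ring|lra].
  apply: (is_derive_ext_loc (fun _ => 0)); last exact: is_derive_const.
  have Hp : 0 < - x by lra.
  exists (mkposreal _ Hp) => y /Rabs_def2; rewrite /minus /plus /opp /= => Hy.
  rewrite /flat; case: Rle_dec => //; lra.
- have F0 i : flat i 0 = 0 by rewrite /flat; case: Rle_dec => // H; lra.
  rewrite !F0 Rmult_0_r Rminus_0_r.
  apply/is_derive_Reals => eps He.
  set C := INR (k + 2) ^ (k + 2).
  have HC : 0 < C by apply: pow_lt; apply: lt_0_INR; lia.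
  have Hd : 0 < eps / C by apply: Rdiv_lt_0_compat.
  exists (mkposreal _ Hd) => y Hy0 Hy /=.
  rewrite Rplus_0_l F0 !Rminus_0_r Rabs_div //.
  have HyP : 0 < Rabs y by exact: Rabs_pos_lt.
  apply: (Rmult_lt_reg_r (Rabs y)) => //.
  have -> : Rabs (flat k y) / Rabs y * Rabs y = Rabs (flat k y) by field; lra.
  apply: Rle_lt_trans (flat_le_sqr k y) _.
  rewrite -/C -Rsqr_pow2 Rsqr_abs /Rsqr -Rmult_assoc.
  apply: Rmult_lt_compat_r => //. move: Hy => /= Hy.
  have := Rmult_lt_compat_l C _ _ HC Hy. 
  have -> : C * (eps / C) = eps by field; lra. done.
- have Hnl i y : 0 < y -> flat i y = (/ y) ^ i * exp (- / y).
    by move=> Hy; rewrite /flat; case: Rle_dec => // H; lra.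
  apply: (is_derive_ext_loc (fun y => (/ y) ^ k * exp (- / y))).
    exists (mkposreal _ Hx) => y /Rabs_def2; rewrite /minus /plus /opp /= => Hy.
    rewrite Hnl //; lra.
  rewrite !Hnl // !pow_add.
  auto_derive; first by repeat split; lra.
  case: k => [|k]; first by rewrite /=; field; lra.
  rewrite [pred _]/= -tech_pow_Rmult Rinv_mult; ring.
Qed.

Fixpoint flat_jet (k j : nat) (x : R) : R :=
  match j with
  | O => flat k x
  | S i => flat_jet (k + 2) i x - INR k * flat_jet (k + 1) i x
  end.

Lemma smooth_flat_jet k : smooth (flat_jet k).
Proof.
move=> j; elim: j k => [|j IH] k x; first exact: is_derive_flat.
apply: (is_derive_minus (V := R_NormedModule)); first exact: IH.
apply: is_derive_scal; exact: IH.
Qed.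

Lemma flat_jet_nonpos k j x : x <= 0 -> flat_jet k j x = 0.
Proof.
move=> Hx; elim: j k => [|j IH] k /=; last by rewrite !IH; ring.
rewrite /flat; case: Rle_dec => // H; lra.
Qed.

(** The product of exp(-1/x) and exp(-1/(1-x)) on (0, 1): [jaff (-1) 1] substitutes 1 - x. *)
Definition bump_jet : Jet := jmul (flat_jet 0%nat) (jaff (-1) 1 (flat_jet 0%nat)).

Lemma smooth_bump_jet : smooth bump_jet.
Proof.
apply: smooth_jmul; first exact: smooth_flat_jet.
apply: smooth_jaff; exact: smooth_flat_jet.
Qed.

Lemma bump_jet_out j x : x <= 0 \/ 1 <= x -> bump_jet j x = 0.
Proof.
case=> Hx; [apply: jmul_zero_l|apply: jmul_zero_r] => i _.
  exact: flat_jet_nonpos.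
by rewrite /jaff flat_jet_nonpos; [ring|lra].
Qed.

Lemma bump_jet_cont x : continuous (bump_jet 0%nat) x.
Proof. apply: ex_derive_continuous; eexists; exact: smooth_bump_jet. Qed.

Lemma bump_jet_ex a b : ex_RInt (bump_jet 0%nat) a b.
Proof. apply: ex_RInt_continuous => x _; exact: bump_jet_cont. Qed.

Definition bump_mass : R := RInt (bump_jet 0%nat) 0 1.

Lemma bump_mass_pos : 0 < bump_mass.
Proof.
apply: RInt_gt_0; first lra.
- move=> x Hx; rewrite /bump_jet /= /jaff /= /flat.
  case: Rle_dec => H1; first lra. case: Rle_dec => H2; first lra.
  rewrite !Rmult_1_l. apply: Rmult_lt_0_compat; exact: exp_pos.
- move=> x _; exact: bump_jet_cont.
Qed.

Definition step_jet : Jet := fun j x =>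
  match j with O => RInt (bump_jet 0%nat) 0 x / bump_mass | S i => bump_jet i x / bump_mass end.

Lemma smooth_step_jet : smooth step_jet.
Proof.
have E f : (fun x => f x / bump_mass) = (fun x => / bump_mass * f x).
  by apply: functional_extensionality => x; rewrite /Rdiv Rmult_comm.
case=> [|j] x; rewrite /step_jet E /Rdiv [_ * / bump_mass]Rmult_comm; apply: is_derive_scal.
  apply: (is_derive_RInt (bump_jet 0%nat) _ 0); last exact: bump_jet_cont.
  by apply: filter_forall => y; apply: RInt_correct; exact: bump_jet_ex.
exact: smooth_bump_jet.
Qed.

Lemma step_jet_neg j x : x <= 0 -> step_jet j x = 0.
Proof.
case: j => [|j] Hx /=; last by rewrite bump_jet_out; [field; have := bump_mass_pos; lra|left].
rewrite (RInt_ext _ (fun _ => 0)).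
  by rewrite RInt_const /scal /= /mult /=; field; have := bump_mass_pos; lra.
move=> y; rewrite Rmin_right // Rmax_left // => Hy. apply: bump_jet_out; lra.
Qed.

Lemma step_jet_one x : 1 <= x -> step_jet 0%nat x = 1.
Proof.
move=> Hx; rewrite /step_jet -(RInt_Chasles _ 0 1 x); try exact: bump_jet_ex.
rewrite (RInt_ext _ (fun _ => 0) 1 x).
  rewrite RInt_const /scal /= /mult /= /plus /= -/bump_mass; field; have := bump_mass_pos; lra.
move=> y; rewrite Rmin_left // Rmax_right // => Hy. apply: bump_jet_out; lra.
Qed.

Lemma step_jet_flat j x : x <= 0 \/ 1 <= x -> step_jet (S j) x = 0.
Proof. move=> Hx; rewrite /= bump_jet_out //; field; have := bump_mass_pos; lra. Qed.

(** For a + 1 <= b it rises on [a, a+1] and falls on [b, b+1]. Both ramps are translates of the same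
    step, which later makes sums of translates telescope. *)
Definition plateau (a b : R) : Jet := fun j x => step_jet j (x - a) - step_jet j (x - b).

Lemma smooth_plateau a b : smooth (plateau a b).
Proof.
have H c j x : is_derive (fun y => step_jet j (y - c)) x (step_jet (S j) (x - c)).
  rewrite -[step_jet (S j) _]Rmult_1_l.
  apply: (is_derive_comp (step_jet j) (fun y => y - c)); first exact: smooth_step_jet.
  by auto_derive => //; ring.
move=> j x; apply: (is_derive_minus (V := R_NormedModule)); exact: H.
Qed.

Lemma plateau_in a b x : a + 1 <= x <= b -> plateau a b 0%nat x = 1.
Proof.
move=> Hx; rewrite /plateau step_jet_one; last lra.
rewrite step_jet_neg; lra.
Qed.

Lemma plateau_out a b j x : a <= b -> x <= a \/ b + 1 <= x -> plateau a b j x = 0.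
Proof.
move=> Hab [Hx|Hx]; rewrite /plateau; first by rewrite !step_jet_neg; lra.
case: j => [|j]; first by rewrite !step_jet_one; lra.
rewrite !step_jet_flat; lra.
Qed.

Lemma continuous_bounded_on (f : R -> R) (a b : R) :
  (forall x, a <= x <= b -> continuity_pt f x) ->
  exists B, 0 <= B /\ forall x, a <= x <= b -> Rabs (f x) <= B.
Proof.
move=> Hf; case: (Rle_dec a b) => Hab; last by exists 0; split; [lra|move=> x Hx; lra].
have [u [Hu _]] := continuity_ab_maj (fun x => Rabs (f x)) a b Hab
  (fun x Hx => continuity_pt_comp f Rabs x (Hf x Hx) (Rcontinuity_abs (f x))).
exists (Rabs (f u)); split=> //; exact: Rabs_pos.
Qed.

Lemma smooth_bounded_on d (a b : R) : smooth d -> forall p, exists B, 0 <= B /\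
  forall j x, (j <= p)%nat -> a <= x <= b -> Rabs (d j x) <= B.
Proof.
move=> Hd; elim=> [|p [B [HB IH]]].
- have [B [HB H]] := continuous_bounded_on (d 0%nat) a b (fun x _ =>
    proj2 (continuity_pt_filterlim (d 0%nat) x) (ex_derive_continuous _ x (ex_intro _ _ (Hd _ x)))).
  exists B; split=> // j x Hj; have -> : j = 0%nat by lia. exact: H.
- have [B' [HB' H]] := continuous_bounded_on (d (S p)) a b (fun x _ =>
    proj2 (continuity_pt_filterlim (d (S p)) x) (ex_derive_continuous _ x (ex_intro _ _ (Hd _ x)))).
  exists (Rmax B B'); split; first by apply: Rle_trans (Rmax_l _ _).
  move=> j x Hj Hx; case: (Nat.eq_dec j (S p)) => [->|Hne].
    apply: Rle_trans (Rmax_r _ _); exact: H.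
  apply: Rle_trans (Rmax_l _ _); apply: IH => //; lia.
Qed.

Lemma smooth_bounded_support d (a b : R) : smooth d ->
  (forall j x, x < a \/ b < x -> d j x = 0) ->
  forall p, exists B, 0 <= B /\ forall j x, (j <= p)%nat -> Rabs (d j x) <= B.
Proof.
move=> Hd H0 p; have [B [HB H]] := smooth_bounded_on d a b Hd p.
exists B; split=> // j x Hj.
case: (Rlt_dec x a) => Hxa; first by rewrite H0 ?Rabs_R0; auto.
case: (Rlt_dec b x) => Hxb; first by rewrite H0 ?Rabs_R0; auto.
apply: H => //; lra.
Qed.


(** * Newton interpolation *)

Fixpoint increasing_from (a : R) (l : list R) : Prop :=
  match l with nil => True | x :: l' => a < x /\ increasing_from x l' end.

Lemma increasing_from_lt a b l : b <= a -> increasing_from a l -> increasing_from b l.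
Proof. case: l => [//|x l] H /= [H1 H2]; split=> //; lra. Qed.

Lemma insert_increasing (P : R -> Prop) x a l : increasing_from a l -> a < x -> P x ->
  Forall P l -> ~ In x l ->
  exists l', length l' = S (length l) /\ increasing_from a l' /\ Forall P l'.
Proof.
move=> + + Px; elim: l a => [|y l IH] a /=.
  by move=> _ Ha _ _; exists (x :: nil); repeat split => //; constructor.
move=> [Hay Hl] Hax /Forall_cons_iff [Py Pl] Hn.
case: (Rlt_dec x y) => Hxy.
  by exists (x :: y :: l); repeat split => //; repeat constructor.
have Hyx : y < x by case: (Req_dec x y) => [E|]; [case: Hn; left|lra].
have [l' [H1 [H2 H3]]] := IH y Hl Hyx Pl (fun H => Hn (or_intror H)).
by exists (y :: l'); rewrite /= H1; repeat split => //; constructor.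
Qed.

(** Interpolation nodes come unordered, while Rolle's theorem is applied between consecutive
    zeros. *)
Lemma sort_increasing (P : R -> Prop) a l : NoDup l -> Forall P l -> (forall x, P x -> a < x) ->
  exists l', length l' = length l /\ increasing_from a l' /\ Forall P l'.
Proof.
move=> Hd HP Ha.
suff : exists l', length l' = length l /\ increasing_from a l' /\
    Forall (fun x => P x /\ In x l) l'.
  move=> [l' [H1 [H2 H3]]]; exists l'; repeat split => //.
  by apply: Forall_impl H3 => x [].
elim: l Hd HP => [|x l IH] Hd HP; first by exists nil.
move/NoDup_cons_iff: Hd => [Hx Hd]; move/Forall_cons_iff: HP => [Px HP].
have [l' [H1 [H2 H3]]] := IH Hd HP.
have [l2 [H4 [H5 H6]]] := insert_increasing (fun y => P y /\ In y (x :: l)) x a l' H2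
  (Ha x Px) (conj Px (or_introl eq_refl))
  (Forall_impl _ (fun y '(conj u v) => conj u (or_intror v)) H3)
  (fun H => Hx (proj2 (proj1 (Forall_forall _ _) H3 x H))).
by exists l2; rewrite H4 H1.
Qed.

Lemma rolle_zero (f g : R -> R) (a b : R) : a < b ->
  (forall x, a <= x <= b -> is_derive f x (g x)) -> f a = 0 -> f b = 0 ->
  exists c, a < c < b /\ g c = 0.
Proof.
move=> Hab Hd Ha Hb.
have [c [H1 H2]] := MVT_cor2 f g a b Hab (fun c Hc => proj1 (is_derive_Reals _ _ _) (Hd c Hc)).
exists c; split=> //.
have : g c * (b - a) = 0 by lra.
case/Rmult_integral => //; lra.
Qed.

Lemma rolle_list (f g : R -> R) (a b z : R) (l : list R) :
  (forall x, a <= x <= b -> is_derive f x (g x)) -> a <= z <= b -> f z = 0 ->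
  Forall (fun x => a <= x <= b /\ f x = 0) l -> increasing_from z l ->
  exists l', length l' = length l /\ increasing_from z l' /\
    Forall (fun x => a <= x <= b /\ g x = 0) l'.
Proof.
move=> Hd; elim: l z => [|y l IH] z Hz H0 Hl Hi; first by exists nil.
move/Forall_cons_iff: Hl => [[Hy Hy0] Hl]; move: Hi => /= [Hzy Hi].
have [l' [H1 [H2 H3]]] := IH y Hy Hy0 Hl Hi.
have [c [Hc Hc0]] := rolle_zero f g z y Hzy (fun x Hx => Hd x ltac:(lra)) H0 Hy0.
exists (c :: l'); rewrite /= H1; repeat split; try lra.
- by apply: increasing_from_lt H2; lra.
- constructor=> //; split=> //; lra.
Qed.

Lemma rolle_iter q (d : Jet) (a b : R) (l : list R) : isjet q d -> NoDup l ->
  length l = S q -> Forall (fun x => a <= x <= b /\ d 0%nat x = 0) l ->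
  exists c, a <= c <= b /\ d q c = 0.
Proof.
move=> Hd Hn Hl HF.
(* [a - 1] is just a strict lower bound from which the sorted list can start. *)
have [l' [H1 [H2 H3]]] := sort_increasing _ (a - 1) l Hn HF (fun x Hx => ltac:(lra)).
rewrite -H1 in Hl; move: Hl H2 H3; clear -Hd.
elim: q l' (a - 1) d Hd => [|q IH] l s d Hd.
  case: l => [//|z [|//]] _ _ /Forall_cons_iff [Hz _]; by exists z.
case: l => [//|z l] [Hl] /= [Hs Hi] /Forall_cons_iff [[Hz Hz0] HF].
have [l' [H1 [H2 H3]]] := rolle_list (d 0%nat) (d 1%nat) a b z l
  (fun x _ => Hd 0%nat x ltac:(lia)) Hz Hz0 HF Hi.
apply: (IH l' z (shift d)) => //; last by rewrite H1.
move=> j x Hj; apply Hd; lia.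
Qed.

(** The j-th derivative of the product of x - node over the first l nodes. The recursion is
    Leibniz's rule for a linear factor; at j = 0 the weight [INR j] kills the meaningless [pred j]
    term. *)
Fixpoint node_poly (ns : list R) (l j : nat) (x : R) : R :=
  match l with
  | O => match j with O => 1 | S _ => 0 end
  | S k => node_poly ns k j x * (x - nth k ns 0) + INR j * node_poly ns k (pred j) x
  end.

Lemma smooth_node_poly ns l : smooth (node_poly ns l).
Proof.
elim: l => [|l IH] j x.
  case: j => [|j] /=; exact: is_derive_const.
have -> : node_poly ns (S l) (S j) x =
  (node_poly ns l (S j) x * (x - nth l ns 0) + node_poly ns l j x * 1) +
    INR j * node_poly ns l j x.
  by rewrite [LHS]/= -/(INR (S j)) S_INR; ring.
apply: (is_derive_plus (V := R_NormedModule)).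
- apply: (is_derive_mult (node_poly ns l j) (fun y => y - nth l ns 0)); [exact: IH| |exact: Rmult_comm].
  by auto_derive.
- case: j => [|j]; last by apply: is_derive_scal; exact: IH.
  rewrite Rmult_0_l; apply: (is_derive_ext (fun _ => 0)); last exact: is_derive_const.
  by move=> t; rewrite Rmult_0_l.
Qed.

Lemma node_poly_degree ns l j x : (l < j)%nat -> node_poly ns l j x = 0.
Proof.
elim: l j => [|l IH] [|j] H //=; try lia.
rewrite !IH; first ring; lia.
Qed.

Lemma node_poly_lead ns l x : node_poly ns l l x = INR (fact l).
Proof.
elim: l => [//|l IH].
rewrite [LHS]/= -/(INR (S l)) node_poly_degree; last lia.
rewrite IH fact_simpl mult_INR; ring.
Qed.

Lemma node_poly_0S ns l x :
  node_poly ns (S l) 0 x = node_poly ns l 0 x * (x - nth l ns 0).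
Proof. by rewrite /=; ring. Qed.

Lemma node_poly_root ns l i : (i < l)%nat -> node_poly ns l 0 (nth i ns 0) = 0.
Proof.
elim: l => [|l IH] Hi; first lia.
rewrite node_poly_0S; case: (Nat.eq_dec i l) => [->|Hne]; first ring.
rewrite IH; first ring; lia.
Qed.

Lemma node_poly_neq0 ns l x : (forall i, (i < l)%nat -> x <> nth i ns 0) ->
  node_poly ns l 0 x <> 0.
Proof.
elim: l => [|l IH] Hi; first by rewrite /=; lra.
rewrite node_poly_0S; apply: Rmult_integral_contrapositive; split.
- by apply: IH => i Hl; apply Hi; lia.
- have := Hi l ltac:(lia); lra.
Qed.

(** Per linear factor, 3 eps bounds the undifferentiated term and p eps the differentiated one;
    hence 3 + p. *)
Lemma node_poly_bound ns p eps l j x : 0 < eps -> (j <= p)%nat ->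
  (forall i, (i < l)%nat -> Rabs (x - nth i ns 0) <= 3 * eps) ->
  eps ^ j * Rabs (node_poly ns l j x) <= ((3 + INR p) * eps) ^ l.
Proof.
move=> He; elim: l j => [|l IH] j Hj Hi.
  case: j Hj => [|j] Hj; rewrite /= ?Rabs_R0 ?Rabs_R1; lra.
have HA := IH j Hj (fun i H => Hi i ltac:(lia)).
have Hx := Hi l ltac:(lia).
have Hej : 0 < eps ^ j by exact: pow_lt.
set W := ((3 + INR p) * eps) ^ l in HA *.
have HW : 0 <= W by apply: Rle_trans HA; apply: Rmult_le_pos; [lra|exact: Rabs_pos].
rewrite [node_poly _ _ _ _]/= -[(_ * eps) ^ S l]/((3 + INR p) * eps * W).
have H1 : eps ^ j * (Rabs (node_poly ns l j x) * Rabs (x - nth l ns 0)) <= W * (3 * eps).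
  rewrite -Rmult_assoc; apply: Rmult_le_compat => //.
  - by apply: Rmult_le_pos; [lra|exact: Rabs_pos].
  - exact: Rabs_pos.
have H2 : eps ^ j * (INR j * Rabs (node_poly ns l (pred j) x)) <= INR p * eps * W.
  case: j Hj {HA H1 Hej} => [|j] Hj.
    rewrite Rmult_0_l Rmult_0_r; apply: Rmult_le_pos => //.
    apply: Rmult_le_pos; [exact: pos_INR|lra].
  have HB := IH j ltac:(lia) (fun i H => Hi i ltac:(lia)).
  have -> : eps ^ S j * (INR (S j) * Rabs (node_poly ns l (pred (S j)) x)) =
    INR (S j) * (eps * (eps ^ j * Rabs (node_poly ns l j x))) by rewrite /=; ring.
  rewrite Rmult_assoc; apply: Rmult_le_compat.
  - exact: pos_INR.
  - apply: Rmult_le_pos; first lra. apply: Rmult_le_pos; last exact: Rabs_pos.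
    by apply: pow_le; lra.
  - exact: le_INR.
  - by apply: Rmult_le_compat_l; [lra|exact: HB].
apply: (Rle_trans _ (eps ^ j * (Rabs (node_poly ns l j x) * Rabs (x - nth l ns 0) +
   INR j * Rabs (node_poly ns l (pred j) x)))).
  apply: Rmult_le_compat_l; first lra.
  apply: Rle_trans (Rabs_triang _ _) _; rewrite !Rabs_mult (Rabs_pos_eq (INR j)); last exact: pos_INR.
  lra.
lra.
Qed.

(* The j-th derivative of the sum of the first l Newton terms; the terms beyond
   the length of ns vanish. *)
Fixpoint newton (ns : list R) (f : R -> R) (l j : nat) (x : R) : R :=
  match l with
  | O => 0
  | S k => newton ns f k j x +
      (if Nat.ltb k (length ns) then
         (f (nth k ns 0) - newton ns f k 0 (nth k ns 0)) / node_poly ns k 0 (nth k ns 0)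
       else 0) * node_poly ns k j x
  end.

(** For distinct nodes this is the divided difference at the first k + 1 of them, obtained by
    solving the interpolation condition at node k for the new Newton coefficient. *)
Definition ddiff (ns : list R) (f : R -> R) (k : nat) : R :=
  if Nat.ltb k (length ns) then
    (f (nth k ns 0) - newton ns f k 0 (nth k ns 0)) / node_poly ns k 0 (nth k ns 0)
  else 0.

Lemma newton_S ns f l j x :
  newton ns f (S l) j x = newton ns f l j x + ddiff ns f l * node_poly ns l j x.
Proof. by []. Qed.

Lemma newton_sum ns f l j x :
  newton ns f l j x = rsum l (fun k => ddiff ns f k * node_poly ns k j x).
Proof. by elim: l => [//|l IH]; rewrite newton_S IH. Qed.

Lemma smooth_newton ns f l : smooth (newton ns f l).
Proof.
move=> j x; rewrite newton_sum.
apply: (is_derive_ext (fun y => rsum l (fun k => ddiff ns f k * node_poly ns k j y))).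
  by move=> t; rewrite newton_sum.
apply: is_derive_rsum => i _; apply: is_derive_scal; exact: smooth_node_poly.
Qed.

Lemma newton_degree ns f l j x : (l <= j)%nat -> newton ns f l j x = 0.
Proof.
move=> H; rewrite newton_sum rsum_zero // => i Hi; rewrite node_poly_degree; first ring; lia.
Qed.

Lemma newton_interpolates ns f l i : NoDup ns -> (i < l)%nat -> (i < length ns)%nat ->
  newton ns f l 0 (nth i ns 0) = f (nth i ns 0).
Proof.
move=> Hn; elim: l => [|l IH] Hl Hi; first lia.
rewrite newton_S; case: (Nat.eq_dec i l) => [<-|Hne]; last first.
  rewrite IH //; last lia. rewrite node_poly_root; last lia. ring.
rewrite /ddiff (proj2 (Nat.ltb_lt _ _) Hi); field.
apply: node_poly_neq0 => k Hk E.
have := proj1 (NoDup_nth ns 0) Hn i k Hi ltac:(lia) E; lia.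
Qed.

Lemma newton_lin ns a b f g h l j x :
  (forall y, In y ns -> h y = a * f y + b * g y) ->
  newton ns h l j x = a * newton ns f l j x + b * newton ns g l j x.
Proof.
move=> H; elim: l j x => [|l IH] j x /=; first ring.
rewrite !IH; case: Nat.ltb_spec => Hl; last ring.
rewrite H; last exact: nth_In.
rewrite /Rdiv; ring.
Qed.

Lemma ddiff_lin ns a b f g h l :
  (forall y, In y ns -> h y = a * f y + b * g y) ->
  ddiff ns h l = a * ddiff ns f l + b * ddiff ns g l.
Proof.
move=> H; rewrite /ddiff; case: Nat.ltb_spec => Hl; last ring.
rewrite (newton_lin _ a b f g) // H; last exact: nth_In.
rewrite /Rdiv; ring.
Qed.

Lemma ddiff_zero ns f l : (forall i, (i <= l)%nat -> (i < length ns)%nat -> f (nth i ns 0) = 0) ->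
  ddiff ns f l = 0.
Proof.
have [n] : exists n, (l < n)%nat by exists (S l); lia.
elim: n l => [|n IH] l Hl H; first lia.
rewrite /ddiff; case: Nat.ltb_spec => Hll //.
rewrite newton_sum rsum_zero; last first.
  move=> i Hi; rewrite IH; [ring|lia|move=> k Hk; apply H; lia].
rewrite H //; rewrite /Rdiv; ring.
Qed.

Lemma newton_zeros ns f l q (a b : R) : NoDup ns -> Forall (fun x => a <= x <= b) ns ->
  (l <= length ns)%nat -> (l <= q)%nat ->
  NoDup (firstn l ns) /\ length (firstn l ns) = l /\
  Forall (fun x => a <= x <= b /\ f x - newton ns f q 0 x = 0) (firstn l ns).
Proof.
move=> Hn Hab Hl Hq.
have Hfl : length (firstn l ns) = l by rewrite length_firstn; lia.
split; [|split=> //].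
  by move: Hn; rewrite -{1}(firstn_skipn l ns); exact: NoDup_app_remove_r.
apply/Forall_forall => x Hx.
have [i [Hi <-]] := In_nth _ _ 0 Hx.
rewrite Hfl in Hi; rewrite nth_firstn (proj2 (Nat.ltb_lt _ _) Hi); split.
- apply: (proj1 (Forall_forall _ _) Hab); apply: nth_In; lia.
- rewrite newton_interpolates //; [ring|lia|lia].
Qed.

(** The error of interpolation at l + 1 nodes has l + 1 zeros, so its l-th derivative vanishes at
    some c. That of the interpolant is l! times the divided difference, which therefore equals
    f^(l)(c) / l!. *)
Lemma ddiff_bound ns (d : Jet) l (a b B : R) : isjet l d -> NoDup ns -> 0 <= B ->
  Forall (fun x => a <= x <= b) ns ->
  (forall x, a <= x <= b -> Rabs (d l x) <= B) -> Rabs (ddiff ns (d 0%nat) l) <= B.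
Proof.
move=> Hd Hn HB Hab Hl; case: (Nat.lt_ge_cases l (length ns)) => Hlen; last first.
  by rewrite /ddiff; case: Nat.ltb_spec => H; [lia|rewrite Rabs_R0].
pose e : Jet := fun j x => d j x - newton ns (d 0%nat) (S l) j x.
have He : isjet l e.
  move=> j x Hj; apply: (is_derive_minus (V := R_NormedModule)); [exact: Hd|exact: smooth_newton].
have [Hf1 [Hf2 Hf3]] := newton_zeros ns (d 0%nat) (S l) (S l) a b Hn Hab Hlen (le_n _).
have [c [Hc H0]] := rolle_iter l e a b _ He Hf1 Hf2 Hf3.
move: H0; rewrite /e newton_S newton_degree // node_poly_lead => H0.
have Hf : 1 <= INR (fact l) by apply: (le_INR 1); have := lt_O_fact l; lia.
have E : d l c = ddiff ns (d 0%nat) l * INR (fact l) by lra.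
have := Hl c Hc; rewrite E Rabs_mult (Rabs_pos_eq (INR _)); last lra.
have := Rabs_pos (ddiff ns (d 0%nat) l); nra.
Qed.

(** Downward induction on l. At l = m the interpolant, of degree below m, disappears. For l < m
    Rolle's theorem at l + 1 <= m nodes still gives a zero of the l-th derivative of the error;
    integrating from it costs one factor b - a. *)
Lemma newton_error ns (d : Jet) m (a b B : R) : isjet m d -> NoDup ns -> length ns = m ->
  Forall (fun x => a <= x <= b) ns ->
  (forall x, a <= x <= b -> Rabs (d m x) <= B) ->
  forall l x, (l <= m)%nat -> a <= x <= b ->
    Rabs (d l x - newton ns (d 0%nat) m l x) <= (b - a) ^ (m - l) * B.
Proof.
move=> Hd Hn Hlen Hab HB l x Hl; have [k Hk] : exists k, m = (l + k)%nat by exists (m - l)%nat; lia.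
have -> : (m - l)%nat = k by lia.
elim: k l x Hk Hl => [|k IH] l x Hk Hl Hx.
  have E : l = m by lia.
  rewrite E newton_degree // Rminus_0_r /= Rmult_1_l; exact: HB.
pose e : Jet := fun j x => d j x - newton ns (d 0%nat) m j x.
have He : isjet m e.
  move=> j y Hj; apply: (is_derive_minus (V := R_NormedModule)); [exact: Hd|exact: smooth_newton].
have [Hf1 [Hf2 Hf3]] := newton_zeros ns (d 0%nat) (S l) m a b Hn Hab ltac:(lia) ltac:(lia).
have [c [Hc H0]] := rolle_iter l e a b _ (isjet_le _ _ _ Hl He) Hf1 Hf2 Hf3.
have Hm := mvt_bound (e l) (e (S l)) c x ((b - a) ^ k * B) (fun y Hy => He l y ltac:(lia))
  (fun y Hy => IH (S l) y ltac:(lia) ltac:(lia) ltac:(move: Hy; rewrite /Rmin /Rmax; case: Rle_dec; lra)).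
rewrite -/(e l x); move: Hm; rewrite H0 Rminus_0_r => Hm.
apply: Rle_trans Hm _.
have -> : (b - a) ^ S k * B = (b - a) ^ k * B * (b - a) by rewrite /=; ring.
apply: Rmult_le_compat_l.
  apply: Rmult_le_pos; first by apply: pow_le; lra.
  by apply: Rle_trans (Rabs_pos _) (HB x Hx).
apply: Rabs_le; lra.
Qed.


(** * Interpolation at a single scale *)

(** Its translates by integers form a partition of unity: each is a difference of two consecutive
    translates of one step function. *)
Definition hat : Jet := plateau (-1) 0.

Lemma hat_out j x : 1 <= Rabs x -> hat j x = 0.
Proof.
move=> H; apply: plateau_out; first lra.
move: H; rewrite /Rabs; case: Rcase_abs; lra.
Qed.

Lemma hat_bounded p : exists B, 0 <= B /\ forall j x, (j <= p)%nat -> Rabs (hat j x) <= B.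
Proof.
apply: (smooth_bounded_support hat (-1) 1); first exact: smooth_plateau.
move=> j x Hx; apply: hat_out; rewrite /Rabs; case: Rcase_abs; lra.
Qed.

Definition hat_sup (p : nat) : R := proj1_sig (constructive_indefinite_description _ (hat_bounded p)).

Lemma hat_sup_ge0 p : 0 <= hat_sup p.
Proof. by rewrite /hat_sup; case: constructive_indefinite_description => B /= []. Qed.

Lemma hat_sup_bound p j x : (j <= p)%nat -> Rabs (hat j x) <= hat_sup p.
Proof. by rewrite /hat_sup; case: constructive_indefinite_description => B /= [] _ H; apply: H. Qed.

Section SingleScale.

Variables (M n m : nat).
Hypothesis Hn : (1 <= n)%nat.

Definition center (i : nat) : R := INR i / INR n - INR M.

Definition ncells : nat := (2 * M * n + 1)%nat.

Definition cell (i : nat) : Jet := jaff (INR n) (center i) hat.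

Let Hn0 : 0 < INR n.
Proof. apply: lt_0_INR; lia. Qed.

Let He : 0 < / INR n.
Proof. exact: Rinv_0_lt_compat. Qed.

Lemma smooth_cell i : smooth (cell i).
Proof. apply: smooth_jaff; exact: smooth_plateau. Qed.

Lemma cell_far i j x : / INR n <= Rabs (x - center i) -> cell i j x = 0.
Proof.
move=> H; rewrite /cell /jaff hat_out; first ring.
rewrite Rabs_mult (Rabs_pos_eq (INR n)); last lra.
have := Rmult_le_compat_l (INR n) _ _ ltac:(lra) H.
rewrite Rinv_r; lra.
Qed.

Lemma cell_bound p i j x : (j <= p)%nat -> (/ INR n) ^ j * Rabs (cell i j x) <= hat_sup p.
Proof.
move=> Hj; rewrite /cell /jaff Rabs_mult (Rabs_pos_eq (INR n ^ j)); last by apply: pow_le; lra.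
rewrite -Rmult_assoc -Rpow_mult_distr Rinv_l; last lra.
rewrite pow1 Rmult_1_l; exact: hat_sup_bound.
Qed.

Lemma cell_sum x : - INR M <= x <= INR M -> rsum ncells (fun i => cell i 0%nat x) = 1.
Proof.
move=> Hx.
have E k : rsum k (fun i => cell i 0%nat x) =
  step_jet 0%nat (INR n * (x + INR M) + 1) - step_jet 0%nat (INR n * (x + INR M) + 1 - INR k).
  elim: k => [|k IH]; first by rewrite /= Rminus_0_r; ring.
  rewrite [LHS]/= IH /cell /jaff /hat /plateau /center [_ ^ 0]/= Rmult_1_l S_INR.
  have -> : INR n * (x - (INR k / INR n - INR M)) - -1 = INR n * (x + INR M) + 1 - INR k by field; lra.
  have -> : INR n * (x - (INR k / INR n - INR M)) - 0 = INR n * (x + INR M) + 1 - (INR k + 1) by field; lra.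
  ring.
rewrite E step_jet_one; last first.
  have := Rmult_le_pos (INR n) (x + INR M) ltac:(lra) ltac:(lra); lra.
rewrite step_jet_neg; first ring.
rewrite /ncells plus_INR !mult_INR /=.
have := Rmult_le_compat_l (INR n) (x + INR M) (INR M + INR M) ltac:(lra) ltac:(lra); lra.
Qed.

(* Data for cell i: at most m interpolation nodes, all in W; fewer than m only
   if they exhaust W near the cell; and no node outside K precedes one of the
   points of K near the cell. *)
Definition good_nodes (K W : R -> Prop) (i : nat) (ns : list R) : Prop :=
  NoDup ns /\ (length ns <= m)%nat /\
  Forall (fun x => W x /\ Rabs (x - center i) <= / INR n) ns /\
  (length ns = m \/ forall x, W x -> Rabs (x - center i) <= / INR n -> In x ns) /\
  (forall l, (l < length ns)%nat -> (forall k, (k <= l)%nat -> K (nth k ns 0)) \/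
     (forall x, K x -> Rabs (x - center i) <= / INR n -> exists k, (k < l)%nat /\ x = nth k ns 0)).

(** [W] carries the admissible nodes: W = K will give operators that use values on K only, W =
    [-M, M] expansions valid on the whole interval. *)
Variables (K W : R -> Prop) (ns : nat -> list R).
Hypothesis HKW : forall x, K x -> W x.
Hypothesis HW : forall x, W x -> - INR M <= x <= INR M.
Hypothesis Hns : forall i, good_nodes K W i (ns i).

Definition basis (i l : nat) : Jet := fun j x =>
  if Nat.ltb l (length (ns i)) then jmul (cell i) (node_poly (ns i) l) j x else 0.

Definition approx (f : R -> R) (x : R) : R :=
  rsum ncells (fun i => rsum m (fun l => ddiff (ns i) f l * basis i l 0%nat x)).

(** Cells with fewer than m nodes are left out: there interpolation is exact on W, whereas the
    derivative bounds for the error need m nodes. The price is that this equals the interpolation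
    error on W only. *)
Definition remainder (d : Jet) : Jet := fun j x =>
  rsum ncells (fun i => if Nat.eqb (length (ns i)) m then
    jmul (cell i) (fun k y => d k y - newton (ns i) (d 0%nat) m k y) j x else 0).

Lemma smooth_basis i l : smooth (basis i l).
Proof.
move=> j x; rewrite /basis; case: Nat.ltb; last exact: is_derive_const.
apply: smooth_jmul; [exact: smooth_cell|exact: smooth_node_poly].
Qed.

Lemma basis_bound i l j x :
  (/ INR n) ^ j * Rabs (basis i l j x) <= 2 ^ j * hat_sup j * ((3 + INR j) * / INR n) ^ l.
Proof.
have H0 : 0 <= 2 ^ j * hat_sup j * ((3 + INR j) * / INR n) ^ l.
  apply: Rmult_le_pos; first by apply: Rmult_le_pos; [apply: pow_le; lra|exact: hat_sup_ge0].
  apply: pow_le; apply: Rmult_le_pos; last lra. have := pos_INR j; lra.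
rewrite /basis; case: Nat.ltb_spec => Hl; last by rewrite Rabs_R0 Rmult_0_r.
case: (Rle_dec (/ INR n) (Rabs (x - center i))) => Hx.
  rewrite jmul_zero_l; first by rewrite Rabs_R0 Rmult_0_r.
  by move=> k _; apply: cell_far.
apply: jmul_bound => // k Hk; first exact: cell_bound.
apply: node_poly_bound => // t Ht.
have [_ [_ [HF _]]] := Hns i.
have [_ Hc] := proj1 (Forall_forall _ _) HF _ (nth_In (ns i) 0 (Nat.lt_trans _ _ _ Ht Hl)).
have -> : x - nth t (ns i) 0 = (x - center i) - (nth t (ns i) 0 - center i) by ring.
apply: Rle_trans (Rabs_triang _ _) _; rewrite Rabs_Ropp; lra.
Qed.

Lemma approx_lin a b f g h : (forall x, W x -> h x = a * f x + b * g x) ->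
  forall x, approx h x = a * approx f x + b * approx g x.
Proof.
move=> H x; rewrite /approx -rsum_lin; apply: rsum_ext => i _.
rewrite -rsum_lin; apply: rsum_ext => l _.
rewrite (ddiff_lin _ a b f g); first ring.
have [_ [_ [HF _]]] := Hns i.
by move=> y Hy; apply: H; have [] := proj1 (Forall_forall _ _) HF _ Hy.
Qed.

(** If node l and all its predecessors lie in K, the divided difference sees only zeros of [f].
    Otherwise every point of K near the cell is an earlier node, hence a root of the node
    polynomial, and at the other points of K the cell function vanishes. *)
Lemma ddiff_basis_zero_K f i l : (forall x, K x -> f x = 0) ->
  ddiff (ns i) f l = 0 \/ forall x, K x -> basis i l 0%nat x = 0.
Proof.
move=> H; case: (Nat.lt_ge_cases l (length (ns i))) => Hl; last first.
  by left; rewrite /ddiff; case: Nat.ltb_spec => //; lia.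
have [_ [_ [_ [_ HK]]]] := Hns i.
case: (HK l Hl) => {}HK; [left|right].
- by apply: ddiff_zero => k Hk _; apply: H; apply: HK.
- move=> x Kx; rewrite /basis; case: Nat.ltb => //.
  case: (Rle_dec (Rabs (x - center i)) (/ INR n)) => Hx.
    have [k [Hk ->]] := HK x Kx Hx.
    rewrite [jmul _ _ _ _]/= node_poly_root //; ring.
  rewrite jmul_zero_l // => k _; apply: cell_far; lra.
Qed.

Lemma approx_cells f x : approx f x =
  rsum ncells (fun i => cell i 0%nat x * newton (ns i) f m 0%nat x).
Proof.
apply: rsum_ext => i _; rewrite newton_sum -rsum_scal; apply: rsum_ext => l _.
rewrite /basis /ddiff; case: Nat.ltb => /=; ring.
Qed.

Lemma remainder_val d x : W x -> remainder d 0%nat x = d 0%nat x - approx (d 0%nat) x.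
Proof.
move=> Wx; rewrite approx_cells.
have {1}-> : d 0%nat x = d 0%nat x * rsum ncells (fun i => cell i 0%nat x).
  by rewrite cell_sum ?Rmult_1_r //; apply: HW.
rewrite -rsum_scal.
have -> : forall a b, a - b = 1 * a + (-1) * b by move=> *; ring.
rewrite -rsum_lin; apply: rsum_ext => i _.
case: Nat.eqb_spec => Hm /=; first ring.
have [Hnd [Hlm [_ [[//|Hall] _]]]] := Hns i.
case: (Rle_dec (Rabs (x - center i)) (/ INR n)) => Hx; last first.
  rewrite cell_far; [ring|lra].
have [k [Hk <-]] := In_nth _ _ 0 (Hall x Wx Hx).
rewrite newton_interpolates //; [ring|lia].
Qed.

Lemma isjet_remainder d : isjet m d -> isjet m (remainder d).
Proof.
move=> Hd j x Hj; rewrite /remainder; apply: is_derive_rsum => i _.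
case: Nat.eqb; last exact: is_derive_const.
apply: (isjet_jmul m) => //.
- by apply: smooth_isjet; exact: smooth_cell.
- move=> k y Hk; apply: (is_derive_minus (V := R_NormedModule)); [exact: Hd|exact: smooth_newton].
Qed.

Lemma remainder_lin a b d e f :
  (forall x, W x -> f 0%nat x = a * d 0%nat x + b * e 0%nat x) ->
  forall x, W x -> remainder f 0%nat x = a * remainder d 0%nat x + b * remainder e 0%nat x.
Proof.
move=> H x Wx; rewrite !remainder_val // (approx_lin a b (d 0%nat) (e 0%nat)) //.
rewrite H //; ring.
Qed.

(** At most 3 cells overlap, Leibniz's rule costs 2^j, and intervals of length at most 2/n cost 2^m:
    together at most 3 * 4^m. Since this is independent of n, a large ratio of scales can beat
    it. *)
Lemma remainder_bound d B : isjet m d ->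
  (forall x, - INR M <= x <= INR M -> Rabs (d m x) <= B) ->
  forall j x, (j <= m)%nat -> - INR M <= x <= INR M ->
    Rabs (remainder d j x) <= 3 * 4 ^ m * hat_sup m * B * (/ INR n) ^ (m - j).
Proof.
move=> Hd HB j x Hj Hx.
have He' := He; set e := / INR n in He' *.
have HB0 : 0 <= B by apply: Rle_trans (HB x Hx); exact: Rabs_pos.
have Hej : 0 < e ^ j by exact: pow_lt.
have -> : 3 * 4 ^ m * hat_sup m * B * e ^ (m - j) = 3 * (4 ^ m * hat_sup m * B * e ^ (m - j)) by ring.
have Hpos : 0 <= 4 ^ m * hat_sup m * B * e ^ (m - j).
  repeat apply: Rmult_le_pos => //; try (by apply: pow_le; lra). exact: hat_sup_ge0.
apply: (rsum_overlap _ _ (INR n * (x + INR M))) => // i Hi; last first.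
  move=> Hy; case: Nat.eqb => //; apply: jmul_zero_l => k _; apply: cell_far.
  have -> : x - center i = / INR n * (INR n * (x + INR M) - INR i) by rewrite /center; field; lra.
  rewrite Rabs_mult (Rabs_pos_eq (/ INR n)); last lra.
  have := Rmult_le_compat_l (/ INR n) _ _ ltac:(lra) Hy; lra.
case: Nat.eqb_spec => Hm; last by rewrite Rabs_R0.
case: (Rle_dec e (Rabs (x - center i))) => Hxi.
  rewrite jmul_zero_l; first by rewrite Rabs_R0.
  by move=> k _; apply: cell_far.
have [Hnd [_ [HF _]]] := Hns i.
have Herr k : (k <= j)%nat -> e ^ k * Rabs (d k x - newton (ns i) (d 0%nat) m k x) <= 2 ^ m * (e ^ m * B).
  move=> Hk.
  (* The cell is intersected with [-M, M], where alone [d] is controlled. *)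
  have H := newton_error (ns i) d m (Rmax (- INR M) (center i - e)) (Rmin (INR M) (center i + e)) B Hd Hnd Hm.
  have Hmem y : Rmax (- INR M) (center i - e) <= y <= Rmin (INR M) (center i + e) <->
      (- INR M <= y <= INR M /\ Rabs (y - center i) <= e).
    rewrite /Rmax /Rmin /Rabs; case: Rle_dec => ?; case: Rle_dec => ?; case: Rcase_abs => ?; split; lra.
  have Hnx : Rabs (x - center i) <= e by lra.
  have {}H := H (Forall_impl _ (fun y '(conj u v) => proj2 (Hmem y) (conj (HW y u) v)) HF)
    (fun y Hy => HB y (proj1 (proj1 (Hmem y) Hy))) k x ltac:(lia)
    (proj2 (Hmem x) (conj Hx Hnx)).
  have Hlen : 0 <= Rmin (INR M) (center i + e) - Rmax (- INR M) (center i - e) <= 2 * e.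
    have [H1 H2] := proj2 (Hmem x) (conj Hx Hnx).
    have := Rmin_r (INR M) (center i + e); have := Rmax_r (- INR M) (center i - e). lra.
  have {}Hlen := pow_incr _ _ (m - k) Hlen.
  have Hek : 0 < e ^ k by exact: pow_lt.
  apply: (Rle_trans _ (e ^ k * ((2 * e) ^ (m - k) * B))).
    apply: Rmult_le_compat_l; first lra. apply: Rle_trans H _; exact: Rmult_le_compat_r.
  rewrite Rpow_mult_distr.
  have -> : e ^ k * (2 ^ (m - k) * e ^ (m - k) * B) = 2 ^ (m - k) * (e ^ (k + (m - k)) * B).
    by rewrite pow_add; ring.
  have -> : (k + (m - k))%nat = m by lia.
  apply: Rmult_le_compat_r; first by apply: Rmult_le_pos => //; apply: pow_le; lra.
  by apply: Rle_pow; [lra|lia].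
have H := jmul_bound e j (cell i) (fun k y => d k y - newton (ns i) (d 0%nat) m k y) x
  (hat_sup m) (2 ^ m * (e ^ m * B)) He' (fun k Hk => cell_bound m i k x ltac:(lia)) Herr.
apply: (Rmult_le_reg_l (e ^ j)) => //.
apply: Rle_trans H _.
have -> : e ^ j * (4 ^ m * hat_sup m * B * e ^ (m - j)) = 4 ^ m * hat_sup m * B * e ^ (j + (m - j)).
  by rewrite pow_add; ring.
have -> : (j + (m - j))%nat = m by lia.
have -> : 4 ^ m = 2 ^ m * 2 ^ m by rewrite -Rpow_mult_distr; congr pow; ring.
have H2 : 2 ^ j <= 2 ^ m by apply: Rle_pow; [lra|lia].
have H3 : 0 <= hat_sup m * (2 ^ m * (e ^ m * B)).
  repeat apply: Rmult_le_pos => //; try (by apply: pow_le; lra). exact: hat_sup_ge0.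
have := Rmult_le_compat_r _ _ _ H3 H2; lra.
Qed.

Lemma coef_bound d i l B : isjet m d -> (l <= m)%nat -> 0 <= B ->
  (forall x, - INR M <= x <= INR M -> Rabs (d l x) <= B) -> Rabs (ddiff (ns i) (d 0%nat) l) <= B.
Proof.
move=> Hd Hl HB H; have [Hnd [_ [HF _]]] := Hns i.
apply: (ddiff_bound (ns i) d l (- INR M) (INR M)) => //.
- exact: isjet_le Hd.
- by apply: Forall_impl HF => x [Wx _]; apply: HW.
Qed.

End SingleScale.

(** Greedy choice: points of [S] are appended until there are m or none is left. Keeping the prefix
    [l0] lets the nodes in K stay in front. *)
Lemma choose_nodes (S : R -> Prop) (m : nat) (l0 : list R) : NoDup l0 -> (length l0 <= m)%nat ->
  Forall S l0 -> exists l, NoDup (l0 ++ l) /\ (length (l0 ++ l) <= m)%nat /\ Forall S (l0 ++ l) /\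
    (length (l0 ++ l) = m \/ forall x, S x -> In x (l0 ++ l)).
Proof.
move=> H1 H2 H3; have [k Hk] : exists k, m = (length l0 + k)%nat by exists (m - length l0)%nat; lia.
elim: k l0 H1 H2 H3 Hk => [|k IH] l0 H1 H2 H3 Hk.
  exists nil; rewrite app_nil_r; split=> //; split=> //; split=> //; left; lia.
case: (classic (forall x, S x -> In x l0)) => [Hall|/not_all_ex_not [x Hx]].
  by exists nil; rewrite app_nil_r; split=> //; split=> //; split=> //; right.
have [Sx Hin] := imply_to_and _ _ Hx.
have Hlen : length (l0 ++ x :: nil) = (length l0 + 1)%nat by rewrite length_app.
have [l [G1 [G2 [G3 G4]]]] := IH (l0 ++ x :: nil)
  (NoDup_app (l1 := l0) H1 (NoDup_cons x (@in_nil _ _) (NoDup_nil _)) (fun y Hy Hy2 => ltac:(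
     case: Hy2 => [E|//]; by rewrite -E in Hy)))
  ltac:(lia) (proj2 (Forall_app _ _ _) (conj H3 (Forall_cons _ Sx (Forall_nil _)))) ltac:(lia).
by exists (x :: l); rewrite -app_assoc in G1 G2 G3 G4.
Qed.

Lemma good_nodes_exist (M n m : nat) (K W : R -> Prop) (i : nat) :
  (forall x, K x -> W x) -> exists l, good_nodes M n m K W i l.
Proof.
move=> HKW.
pose near x := Rabs (x - center M n i) <= / INR n.
have [ks [G1 [G2 [G3 G4]]]] := choose_nodes (fun x => K x /\ near x) m nil
  (NoDup_nil _) (Nat.le_0_l _) (Forall_nil _).
rewrite /= in G1 G2 G3 G4.
have [zs [J1 [J2 [J3 J4]]]] := choose_nodes (fun x => W x /\ near x) m ks G1 G2
  (Forall_impl _ (fun x '(conj u v) => conj (HKW x u) v) G3).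
exists (ks ++ zs); do 3 split => //; split.
- case: J4 => [->|H]; [by left|right=> x Wx Hx; exact: H].
- move=> l Hl; case: (Nat.lt_ge_cases l (length ks)) => Hk; [left|right].
    move=> k Hkl; rewrite app_nth1; last lia.
    by have [] := proj1 (Forall_forall _ _) G3 _ (nth_In ks 0 (Nat.le_lt_trans _ _ _ Hkl Hk)).
  (* There is a node behind [ks], so [ks] has fewer than m points and therefore exhausts K near the
     cell. *)
  move=> x Kx Hx; case: G4 => [Hm|Hall].
    by rewrite length_app in J2 Hl; lia.
  have [k [Hkl <-]] := In_nth _ _ 0 (Hall x (conj Kx Hx)).
  exists k; split; [lia|by rewrite app_nth1].
Qed.


(** * Multi-scale expansions *)

(* An expansion d = sum_nu sum_(i,l) coef(d) atom on W for C^m functions d, with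
   atoms living at scale e_nu and of size e_nu^l; it respects vanishing on K. *)
Record frame (M m : nat) (K W : R -> Prop) : Type := Frame {
  fr_scale : nat -> R;
  fr_size : nat -> nat;
  fr_coef : nat -> nat -> nat -> Jet -> R;
  fr_atom : nat -> nat -> nat -> Jet;
  fr_count : R;
  fr_atom_cst : nat -> R;
  fr_coef_cst : R;
  fr_scale_pos : forall v, 0 < fr_scale v <= (/ 2) ^ v;
  fr_size_le : forall v, INR (fr_size v) * fr_scale v <= fr_count;
  fr_smooth : forall v i l, smooth (fr_atom v i l);
  fr_atom_bound : forall j v i l x, (l < m)%nat ->
    fr_scale v ^ j * Rabs (fr_atom v i l j x) <= fr_atom_cst j * fr_scale v ^ l;
  fr_lin : forall v i l a b d e f,
    (forall x, W x -> f 0%nat x = a * d 0%nat x + b * e 0%nat x) ->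
    fr_coef v i l f = a * fr_coef v i l d + b * fr_coef v i l e;
  fr_coef_bound : forall d B, isjet m d ->
    (forall j x, (j <= m)%nat -> - INR M <= x <= INR M -> Rabs (d j x) <= B) ->
    forall v i l, (l < m)%nat ->
      Rabs (fr_coef v i l d) <= fr_coef_cst * B * fr_scale v ^ (m - 1 - l);
  fr_zero : forall d, (forall x, K x -> d 0%nat x = 0) -> forall v i l,
    fr_coef v i l d = 0 \/ forall x, K x -> fr_atom v i l 0%nat x = 0;
  fr_expansion : forall d B, isjet m d ->
    (forall j x, (j <= m)%nat -> - INR M <= x <= INR M -> Rabs (d j x) <= B) ->
    forall x, W x -> is_series (fun v => rsum (fr_size v) (fun i => rsum m (fun l =>
      fr_coef v i l d * fr_atom v i l 0%nat x))) (d 0%nat x) }.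

Section MultiScale.

Variables (M m : nat) (K W : R -> Prop) (L : nat).
Hypothesis Hm : (2 <= m)%nat.
Hypothesis HKW : forall x, K x -> W x.
Hypothesis HW : forall x, W x -> - INR M <= x <= INR M.
Hypothesis HL : (2 <= L)%nat.
(* The ratio of scales beats the constant lost at each interpolation step. *)
Hypothesis HLC : 3 * 4 ^ m * hat_sup m <= INR L.

Let nodes (v i : nat) : list R := proj1_sig (constructive_indefinite_description _
  (good_nodes_exist M (L ^ v) m K W i HKW)).

Let nodes_good v i : good_nodes M (L ^ v) m K W i (nodes v i).
Proof. exact: (proj2_sig (constructive_indefinite_description _ _)). Qed.

Let scale (v : nat) : R := / INR (L ^ v).

Fixpoint residual (v : nat) (d : Jet) : Jet :=
  match v with O => d | S u => remainder M (L ^ u) m (nodes u) (residual u d) end.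

Let HLv v : (1 <= L ^ v)%nat.
Proof. have := Nat.pow_nonzero L v; lia. Qed.

Let INRL : 2 <= INR L.
Proof. exact: (le_INR 2). Qed.

Let scale_eq v : scale v = (/ INR L) ^ v.
Proof. by rewrite /scale pow_INR pow_inv. Qed.

Let scale_pos v : 0 < scale v.
Proof. rewrite scale_eq; apply: pow_lt; apply: Rinv_0_lt_compat; lra. Qed.

Let scale_S v : INR L * scale (S v) = scale v.
Proof. rewrite !scale_eq /=; field; lra. Qed.

Let scale_half v : scale v <= (/ 2) ^ v.
Proof.
rewrite scale_eq; apply: pow_incr; split; first by left; apply: Rinv_0_lt_compat; lra.
by apply: Rinv_le_contravar; lra.
Qed.

Lemma isjet_residual d v : isjet m d -> isjet m (residual v d).
Proof. by move=> Hd; elim: v => [//|v IH]; apply: isjet_remainder. Qed.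

Lemma residual_lin a b d e f :
  (forall x, W x -> f 0%nat x = a * d 0%nat x + b * e 0%nat x) ->
  forall v x, W x -> residual v f 0%nat x = a * residual v d 0%nat x + b * residual v e 0%nat x.
Proof.
move=> H; elim=> [//|v IH] /= x Wx.
exact: (remainder_lin M (L ^ v) m (HLv v) K W (nodes v) HW (nodes_good v) a b).
Qed.

Lemma residual_zero d : (forall x, K x -> d 0%nat x = 0) ->
  forall v x, K x -> residual v d 0%nat x = 0.
Proof.
move=> H; elim=> [//|v IH] /= x Kx.
rewrite (remainder_val M (L ^ v) m (HLv v) K W (nodes v) HW (nodes_good v)); last exact: HKW.
rewrite IH // /approx rsum_zero; first ring.
move=> i _; apply: rsum_zero => l _.
have [->|->//] := ddiff_basis_zero_K M (L ^ v) m (HLv v) K W (nodes v) (nodes_good v)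
  (residual v d 0%nat) i l IH; ring.
Qed.

(** One step multiplies the bound of the m-th derivative by at most L and gives the j-th one m - j
    powers of the scale used, which is [L * scale v] for the step leading to level v. As L^v = 1 /
    scale v, one power of the scale is lost; hence the exponent m - 1 - l of the coefficients. *)
Lemma residual_bound d B : isjet m d ->
  (forall j x, (j <= m)%nat -> - INR M <= x <= INR M -> Rabs (d j x) <= B) ->
  forall v j x, (j <= m)%nat -> - INR M <= x <= INR M ->
    Rabs (residual v d j x) <= B * INR L ^ v * (INR L * scale v) ^ (m - j).
Proof.
move=> Hd HB; elim=> [|v IH] j x Hj Hx.
  have -> : scale 0 = 1 by rewrite scale_eq.
  rewrite /= !Rmult_1_r; apply: Rle_trans (HB j x Hj Hx) _.
  have H1 : 1 <= INR L ^ (m - j) by apply: pow_R1_Rle; lra.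
  have := Rle_trans _ _ _ (Rabs_pos _) (HB j x Hj Hx); nra.
have Htop y : - INR M <= y <= INR M -> Rabs (residual v d m y) <= B * INR L ^ v.
  by move=> Hy; have := IH m y (le_n _) Hy; rewrite Nat.sub_diag Rmult_1_r.
apply: Rle_trans (remainder_bound M (L ^ v) m (HLv v) K W (nodes v) HW (nodes_good v)
  _ _ (isjet_residual d v Hd) Htop j x Hj Hx) _.
rewrite -/(scale v) scale_S.
apply: Rmult_le_compat_r; first by apply: pow_le; have := scale_pos v; lra.
have H0 : 0 <= B * INR L ^ v by apply: Rle_trans (Htop x Hx); exact: Rabs_pos.
have := Rmult_le_compat_r _ _ _ H0 HLC. rewrite /=; lra.
Qed.

Let Lv v : INR L ^ v = / scale v.
Proof. by rewrite scale_eq pow_inv Rinv_inv. Qed.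

Definition coef (v i l : nat) (d : Jet) : R := ddiff (nodes v i) (residual v d 0%nat) l.

Lemma coef_bound_scale d B : isjet m d ->
  (forall j x, (j <= m)%nat -> - INR M <= x <= INR M -> Rabs (d j x) <= B) ->
  forall v i l, (l < m)%nat -> Rabs (coef v i l d) <= INR L ^ m * B * scale v ^ (m - 1 - l).
Proof.
move=> Hd HB v i l Hl.
have Hs := scale_pos v.
have HB0 : 0 <= B.
  apply: (Rle_trans _ _ _ (Rabs_pos (d 0%nat 0))); apply: HB; first lia.
  have := pos_INR M; lra.
have HE : B * INR L ^ v * (INR L * scale v) ^ (m - l) <= INR L ^ m * B * scale v ^ (m - 1 - l).
  have -> : (m - l)%nat = S (m - 1 - l) by lia.
  rewrite Rpow_mult_distr Lv.
  have -> : B * / scale v * (INR L ^ S (m - 1 - l) * scale v ^ S (m - 1 - l)) =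
     INR L ^ S (m - 1 - l) * B * scale v ^ (m - 1 - l) by rewrite /=; field; lra.
  apply: Rmult_le_compat_r; first by apply: pow_le; lra.
  apply: Rmult_le_compat_r => //. apply: Rle_pow; [lra|lia].
apply: Rle_trans HE.
apply: (coef_bound M (L ^ v) m K W (nodes v) HW (nodes_good v)).
- exact: isjet_residual.
- lia.
- repeat apply: Rmult_le_pos => //; apply: pow_le; first lra.
  apply: Rmult_le_pos; lra.
- move=> x Hx; apply: residual_bound => //; lia.
Qed.

Lemma residual_partial d : forall x, W x -> forall v,
  d 0%nat x - residual (S v) d 0%nat x = sum_n (fun u => rsum (ncells M (L ^ u)) (fun i =>
    rsum m (fun l => coef u i l d * basis M (L ^ u) (nodes u) i l 0%nat x))) v.
Proof.
move=> x Wx.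
have E v := remainder_val M (L ^ v) m (HLv v) K W (nodes v) HW (nodes_good v) (residual v d) x Wx.
elim=> [|v IH].
  by rewrite sum_O; have := E 0%nat => /= ->; rewrite /approx; ring_simplify.
rewrite sum_Sn -IH /plus /= -/(residual (S v) d) (E (S v)) /approx /coef /=; ring.
Qed.

Lemma multiscale_expansion d B : isjet m d ->
  (forall j x, (j <= m)%nat -> - INR M <= x <= INR M -> Rabs (d j x) <= B) ->
  forall x, W x -> is_series (fun u => rsum (ncells M (L ^ u)) (fun i =>
    rsum m (fun l => coef u i l d * basis M (L ^ u) (nodes u) i l 0%nat x))) (d 0%nat x).
Proof.
move=> Hd HB x Wx.
have HB0 : 0 <= B by apply: Rle_trans (HB 0%nat x ltac:(lia) (HW _ Wx)); exact: Rabs_pos.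
suff : is_lim_seq (sum_n (fun u => rsum (ncells M (L ^ u)) (fun i =>
    rsum m (fun l => coef u i l d * basis M (L ^ u) (nodes u) i l 0%nat x)))) (d 0%nat x) by [].
apply: (is_lim_seq_ext (fun v => d 0%nat x - residual (S v) d 0%nat x)).
  move=> v; exact: residual_partial.
have -> : Finite (d 0%nat x) = Rbar_minus (d 0%nat x) 0.
  by rewrite /= ; congr Finite; ring.
apply: is_lim_seq_minus'; first exact: is_lim_seq_const.
apply: (proj1 (is_lim_seq_incr_1 (fun v => residual v d 0%nat x) 0)).
apply/is_lim_seq_abs_0.
apply: (is_lim_seq_le_le (fun _ => 0) _ (fun v => B * INR L ^ m * (/ 2) ^ v)).
- move=> v; split; first exact: Rabs_pos.
  apply: Rle_trans (residual_bound d B Hd HB v 0%nat x ltac:(lia) (HW _ Wx)) _.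
  rewrite Nat.sub_0_r Rpow_mult_distr Lv.
  have Hs := scale_pos v.
  (* The residual has size scale^(m-1), which tends to 0 because m >= 2. *)
  have -> : m = S (m - 1) by lia. set k := (m - 1)%nat.
  have -> : B * / scale v * (INR L ^ S k * scale v ^ S k) = B * INR L ^ S k * scale v ^ k.
    by rewrite /=; field; lra.
  apply: Rmult_le_compat_l.
    by apply: Rmult_le_pos => //; apply: pow_le; lra.
  apply: Rle_trans (scale_half v).
  have -> : k = S (k - 1) by rewrite /k; lia.
  have H1 : scale v ^ (k - 1) <= 1.
    rewrite -(pow1 (k - 1)); apply: pow_incr; split; first lra.
    apply: Rle_trans (scale_half v) _; rewrite -(pow1 v); apply: pow_incr; lra.
  rewrite /=; have := Rmult_le_compat_l _ _ _ (Rlt_le _ _ Hs) H1; lra.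
- exact: is_lim_seq_const.
- have -> : Finite 0 = Rbar_mult (B * INR L ^ m) 0 by rewrite /= Rmult_0_r.
  apply: is_lim_seq_scal_l; apply: is_lim_seq_geom; rewrite Rabs_pos_eq; lra.
Qed.

Lemma frame_at_ratio : frame M m K W.
Proof.
apply: (@Frame M m K W scale (fun v => ncells M (L ^ v)) coef
  (fun v => basis M (L ^ v) (nodes v)) (2 * INR M + 1)
  (fun j => 2 ^ j * hat_sup j * (3 + INR j) ^ m) (INR L ^ m)).
- by move=> v; split; [exact: scale_pos|exact: scale_half].
- move=> v; have H := scale_pos v; rewrite /ncells plus_INR !mult_INR /=.
  have Hs1 : scale v <= 1.
    apply: Rle_trans (scale_half v) _; rewrite -(pow1 v); apply: pow_incr; lra.
  have -> : (2 * INR M * INR (L ^ v) + 1) * scale v = 2 * INR M + scale v.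
    rewrite /scale; field; apply: not_0_INR; have := HLv v; lia.
  lra.
- move=> v i l; exact: (smooth_basis M (L ^ v)).
- move=> j v i l x Hl.
  apply: Rle_trans (basis_bound M (L ^ v) m (HLv v) K W (nodes v) (nodes_good v) i l j x) _.
  rewrite -/(scale v) Rpow_mult_distr -Rmult_assoc.
  apply: Rmult_le_compat_r; first by apply: pow_le; have := scale_pos v; lra.
  apply: Rmult_le_compat_l; first by apply: Rmult_le_pos; [apply: pow_le; lra|exact: hat_sup_ge0].
  apply: Rle_pow; [have := pos_INR j; lra|lia].
- move=> v i l a b d e f H; apply: ddiff_lin => y Hy.
  have [_ [_ [HF _]]] := nodes_good v i.
  by apply: residual_lin => //; have [] := proj1 (Forall_forall _ _) HF _ Hy.
- exact: coef_bound_scale.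
- move=> d H v i l.
  exact: (ddiff_basis_zero_K M (L ^ v) m (HLv v) K W (nodes v) (nodes_good v)
    _ i l (residual_zero d H v)).
- exact: multiscale_expansion.
Qed.

End MultiScale.

Lemma frame_exists (M m : nat) (K W : R -> Prop) : (2 <= m)%nat ->
  (forall x, K x -> W x) -> (forall x, W x -> - INR M <= x <= INR M) -> frame M m K W.
Proof.
move=> Hm HKW HW.
pose L := (2 + Z.to_nat (up (3 * 4 ^ m * hat_sup m)))%nat.
apply: (frame_at_ratio M m K W L) => //; first by rewrite /L; lia.
have [H _] := archimed (3 * 4 ^ m * hat_sup m).
have H0 : 0 <= 3 * 4 ^ m * hat_sup m.
  apply: Rmult_le_pos; last exact: hat_sup_ge0.
  by apply: Rmult_le_pos; [lra|apply: pow_le; lra].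
have Hz : (0 <= up (3 * 4 ^ m * hat_sup m))%Z by apply: le_IZR; lra.
rewrite /L plus_INR INR_IZR_INZ [in X in _ + X]INR_IZR_INZ Z2Nat.id //=; lra.
Qed.


(** * Hahn-Banach *)

Definition inf (E : R -> Prop) : R := real (Glb_Rbar E).

Lemma inf_spec (E : R -> Prop) (x b : R) : E x -> (forall y, E y -> b <= y) ->
  (forall y, E y -> inf E <= y) /\ (forall c, (forall y, E y -> c <= y) -> c <= inf E).
Proof.
move=> Ex Hb; rewrite /inf.
have [H1 H2] := Glb_Rbar_correct E.
have Hx := H1 x Ex.
have Hbb := H2 (Finite b) (fun y Ey => Hb y Ey).
case: (Glb_Rbar E) H1 H2 Hx Hbb => [g| |] //= H1 H2 _ _.
by split=> [y Ey|c Hc]; [exact: (H1 y Ey)|exact: (H2 (Finite c) Hc)].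
Qed.

Section HahnBanach.

Variable X : ModuleSpace R_Ring.

Definition sublinear (p : X -> R) : Prop :=
  (forall x y, p (plus x y) <= p x + p y) /\ (forall a x, 0 <= a -> p (scal a x) = a * p x).

Lemma sublinear_zero p : sublinear p -> p zero = 0.
Proof. by move=> [_ H]; rewrite -(scal_zero_l (@zero X)) H; [exact: Rmult_0_l|right]. Qed.

Lemma sublinear_opp p x : sublinear p -> - p (opp x) <= p x.
Proof.
move=> Hp; have := proj1 Hp x (opp x).
rewrite plus_opp_r (sublinear_zero p Hp); lra.
Qed.

(* Equality in the last hypothesis follows by applying it to 1/a as well. *)
Lemma sublinear_from p : p zero = 0 -> (forall x y, p (plus x y) <= p x + p y) ->
  (forall a x, 0 < a -> p (scal a x) <= a * p x) -> sublinear p.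
Proof.
move=> H0 Hadd Hs; split=> // a x [Ha|<-]; last first.
  by rewrite (scal_zero_l x) H0; ring.
apply: Rle_antisym; first exact: Hs.
have Hi : 0 < / a by exact: Rinv_0_lt_compat.
have := Hs (/ a) (scal a x) Hi.
have -> : scal (/ a) (scal a x) = x.
  rewrite scal_assoc.
  have -> : mult (/ a) a = one by rewrite /mult /one /=; field; lra.
  exact: scal_one.
move=> H; have := Rmult_le_compat_l a _ _ (Rlt_le _ _ Ha) H.
have -> : a * (/ a * p (scal a x)) = p (scal a x) by field; lra.
done.
Qed.

(** Taking t = 1 gives [tilt p y x] <= p(x + y) - p(y), so the equality [tilt p y] = p is the
    reverse of subadditivity. *)
Definition tilt (p : X -> R) (y x : X) : R :=
  inf (fun r => exists t, 0 <= t /\ r = p (plus x (scal t y)) - t * p y).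

Lemma tilt_spec p y x : sublinear p ->
  (forall t, 0 <= t -> tilt p y x <= p (plus x (scal t y)) - t * p y) /\
  (forall c, (forall t, 0 <= t -> c <= p (plus x (scal t y)) - t * p y) -> c <= tilt p y x).
Proof.
move=> Hp.
have [H1 H2] := inf_spec (fun r => exists t, 0 <= t /\ r = p (plus x (scal t y)) - t * p y)
  (p (plus x (scal 0 y)) - 0 * p y) (- p (opp x))
  (ex_intro _ 0 (conj (Rle_refl 0) eq_refl)) (fun r '(ex_intro t (conj Ht E)) => ltac:(
    rewrite E -(proj2 Hp t y Ht);
    have := proj1 Hp (plus x (scal t y)) (opp x);
    rewrite (plus_comm x) -plus_assoc plus_opp_r plus_zero_r; lra)).
split=> [t Ht|c Hc]; first by apply: H1; exists t.
by apply: H2 => r [t [Ht ->]]; apply: Hc.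
Qed.

Lemma tilt_le p y x : sublinear p -> tilt p y x <= p x.
Proof.
move=> Hp; have [H _] := tilt_spec p y x Hp.
have := H 0 (Rle_refl 0); rewrite (scal_zero_l y) plus_zero_r; lra.
Qed.

Lemma sublinear_tilt p y : sublinear p -> sublinear (tilt p y).
Proof.
move=> Hp; apply: sublinear_from.
- apply: Rle_antisym; first by have := tilt_le p y zero Hp; rewrite (sublinear_zero p Hp).
  apply: (proj2 (tilt_spec p y zero Hp)) => t Ht; rewrite plus_zero_l (proj2 Hp t y Ht); lra.
- move=> x z.
  have [H1 _] := tilt_spec p y (plus x z) Hp.
  have : tilt p y (plus x z) - tilt p y z <= tilt p y x; last lra.
  apply: (proj2 (tilt_spec p y x Hp)) => t Ht.
  have : tilt p y (plus x z) - (p (plus x (scal t y)) - t * p y) <= tilt p y z; last lra.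
  apply: (proj2 (tilt_spec p y z Hp)) => u Hu.
  have := H1 (t + u) ltac:(lra).
  have -> : plus (plus x z) (scal (t + u) y) = plus (plus x (scal t y)) (plus z (scal u y)).
    have -> : scal (t + u) y = plus (scal t y) (scal u y) by exact: scal_distr_r.
    rewrite -!plus_assoc; congr plus; rewrite !plus_assoc; congr plus; exact: plus_comm.
  have := proj1 Hp (plus x (scal t y)) (plus z (scal u y)); lra.
- move=> a x Ha.
  have : tilt p y (scal a x) / a <= tilt p y x.
    apply: (proj2 (tilt_spec p y x Hp)) => t Ht.
    have := proj1 (tilt_spec p y (scal a x) Hp) (a * t) ltac:(nra).
    have -> : plus (scal a x) (scal (a * t) y) = scal a (plus x (scal t y)).
      by rewrite scal_distr_l scal_assoc.
    rewrite (proj2 Hp a) ?[0 <= a]/=; last lra. move=> H.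
    apply: (Rmult_le_reg_l a) => //.
    have -> : a * (tilt p y (scal a x) / a) = tilt p y (scal a x) by field; lra.
    lra.
  move=> H; have := Rmult_le_compat_l a _ _ (Rlt_le _ _ Ha) H.
  have -> : a * (tilt p y (scal a x) / a) = tilt p y (scal a x) by field; lra.
  done.
Qed.

(* A minimal sublinear functional agrees with its tilts, hence is additive. *)
Lemma minimal_sublinear_linear p : sublinear p ->
  (forall q, sublinear q -> (forall x, q x <= p x) -> forall x, q x = p x) ->
  (forall x y, p (plus x y) = p x + p y) /\ (forall a x, p (scal a x) = a * p x).
Proof.
move=> Hp Hmin.
have Hadd x y : p (plus x y) = p x + p y.
  apply: Rle_antisym; first exact: (proj1 Hp).
  have H := Hmin (tilt p y) (sublinear_tilt p y Hp) (fun z => tilt_le p y z Hp) x.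
  have := proj1 (tilt_spec p y x Hp) 1 ltac:(lra).
  rewrite H (scal_one (K := R_Ring) y); lra.
split=> // a x; case: (Rle_dec 0 a) => Ha; first exact: (proj2 Hp).
have E : plus (scal a x) (scal (- a) x) = zero.
  rewrite -scal_distr_r.
  have -> : plus a (- a) = zero by rewrite /plus /zero /=; ring.
  exact: scal_zero_l.
have := Hadd (scal a x) (scal (- a) x).
rewrite E (sublinear_zero p Hp) (proj2 Hp (- a)); lra.
Qed.

Section Zorn.

Variable s : X -> R.
Hypothesis Hs : sublinear s.

Let below := {p : X -> R | sublinear p /\ forall x, p x <= s x}.

Let below_lower (p : below) x : - s (opp x) <= proj1_sig p x.
Proof.
case: p => p [Hp Hps] /=; have := sublinear_opp p x Hp; have := Hps (opp x); lra.
Qed.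

Let chain_inf (A : below -> Prop) (x : X) : R := inf (fun r => exists p, A p /\ r = proj1_sig p x).

Let chain_inf_spec (A : below -> Prop) p0 x : A p0 ->
  (forall p, A p -> chain_inf A x <= proj1_sig p x) /\
  (forall c, (forall p, A p -> c <= proj1_sig p x) -> c <= chain_inf A x).
Proof.
move=> A0.
have [H1 H2] := inf_spec (fun r => exists p, A p /\ r = proj1_sig p x) (proj1_sig p0 x) (- s (opp x))
  (ex_intro _ p0 (conj A0 eq_refl)) (fun r '(ex_intro p (conj Ap E)) =>
     eq_ind_r (fun r => _ <= r) (below_lower p x) E).
split=> [p Ap|c Hc]; first by apply: H1; exists p.
by apply: H2 => r [p [Ap ->]]; apply: Hc.
Qed.

Let chain_bound (A : below -> Prop) p0 : A p0 ->
  (forall p q, A p -> A q -> (forall x, proj1_sig q x <= proj1_sig p x) \/ (forall x, proj1_sig p x <= proj1_sig q x)) ->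
  sublinear (chain_inf A) /\ (forall x, chain_inf A x <= s x).
Proof.
move=> A0 Htot; split; last first.
  move=> x; apply: Rle_trans (proj1 (chain_inf_spec A p0 x A0) p0 A0) _.
  by case: p0 A0 => p [].
apply: sublinear_from.
- apply: Rle_antisym.
    apply: Rle_trans (proj1 (chain_inf_spec A p0 zero A0) p0 A0) _.
    by rewrite sublinear_zero; [right|case: p0 A0 => p []].
  apply: (proj2 (chain_inf_spec A p0 zero A0)) => p Ap.
  by rewrite sublinear_zero; [right|case: p Ap => p []].
- move=> x y.
  have : chain_inf A (plus x y) - chain_inf A y <= chain_inf A x; last lra.
  apply: (proj2 (chain_inf_spec A p0 x A0)) => p Ap.
  have : chain_inf A (plus x y) - proj1_sig p x <= chain_inf A y; last lra.
  apply: (proj2 (chain_inf_spec A p0 y A0)) => q Aq.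
  have H1 := proj1 (chain_inf_spec A p0 (plus x y) A0) p Ap.
  have H2 := proj1 (chain_inf_spec A p0 (plus x y) A0) q Aq.
  have H3 := proj1 (proj1 (proj2_sig p)) x y.
  have H4 := proj1 (proj1 (proj2_sig q)) x y.
  (* An infimum of sublinear functionals is subadditive only if one of them serves both arguments:
     in a chain, the smaller of p and q does. *)
  case: (Htot p q Ap Aq) => H.
  + have := H x; lra.
  + have := H y; lra.
- move=> a x Ha.
  have : chain_inf A (scal a x) / a <= chain_inf A x.
    apply: (proj2 (chain_inf_spec A p0 x A0)) => p Ap.
    have := proj1 (chain_inf_spec A p0 (scal a x) A0) p Ap.
    rewrite (proj2 (proj1 (proj2_sig p)) a x ltac:(lra)) => H.
    apply: (Rmult_le_reg_l a) => //.
    have -> : a * (chain_inf A (scal a x) / a) = chain_inf A (scal a x) by field; lra.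
    exact: H.
  move=> H; have := Rmult_le_compat_l a _ _ (Rlt_le _ _ Ha) H.
  have -> : a * (chain_inf A (scal a x) / a) = chain_inf A (scal a x) by field; lra.
  done.
Qed.

(** Zorn's lemma is applied to the sublinear functionals below [s], with the order reversed, instead
    of partially defined linear ones; no subspaces are needed, and minimality yields linearity. *)
Lemma hahn_banach : exists f : X -> R, (forall x y, f (plus x y) = f x + f y) /\
  (forall a x, f (scal a x) = a * f x) /\ (forall x, f x <= s x).
Proof.
have [|||A Htot|p Hp] := classical_sets.Zorn (T := below)
    (R := fun p q => boolp.asbool (forall x, proj1_sig q x <= proj1_sig p x)).
- by move=> p; apply: boolp.asboolT => x; right.
- move=> q p r /boolp.asboolW H1 /boolp.asboolW H2; apply: boolp.asboolT => x.
  exact: Rle_trans (H2 x) (H1 x).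
- move=> p q /boolp.asboolW H1 /boolp.asboolW H2.
  case: p q H1 H2 => p Hp [q Hq] /= H1 H2.
  have E : p = q by apply: functional_extensionality => x; apply: Rle_antisym.
  by subst q; congr exist; exact: proof_irrelevance.
- case: (classic (exists p0, A p0)) => [[p0 A0]|HA]; last first.
    exists (exist _ s (conj Hs (fun x => Rle_refl _)) : below) => p Ap.
    by case: HA; exists p.
  have Hc := chain_bound A p0 A0 (fun p q Ap Aq => match Htot p q Ap Aq with
    | or_introl H => or_introl (fun x => boolp.asboolW H x)
    | or_intror H => or_intror (fun x => boolp.asboolW H x) end).
  exists (exist _ (chain_inf A) Hc : below) => p Ap; apply: boolp.asboolT => x /=.
  exact: (proj1 (chain_inf_spec A p0 x A0)).
- exists (proj1_sig p); have [Hsub Hle] := proj2_sig p.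
  have Hmin q : sublinear q -> (forall x, q x <= proj1_sig p x) -> forall x, q x = proj1_sig p x.
    move=> Hq Hqp x.
    pose q' : below := exist _ q (conj Hq (fun y => Rle_trans _ _ _ (Hqp y) (Hle y))).
    by rewrite -(Hp q' (boolp.asboolT Hqp)).
  have [Ha Hm] := minimal_sublinear_linear (proj1_sig p) Hsub Hmin.
  by split; [|split].
Qed.

End Zorn.

(** Hahn-Banach for the infimal convolution of the two majorants that g must respect. The hypothesis
    on f bounds this infimum from below by f - p2. *)
Lemma sandwich_split (p1 p2 f : X -> R) : sublinear p1 -> sublinear p2 ->
  (forall x y, f (plus x y) = f x + f y) -> (forall a x, f (scal a x) = a * f x) ->
  (forall x, f x <= p1 x + p2 x) ->
  exists g : X -> R, (forall x y, g (plus x y) = g x + g y) /\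
    (forall a x, g (scal a x) = a * g x) /\ (forall x, g x <= p1 x) /\
    (forall x, f x - g x <= p2 x).
Proof.
move=> Hp1 Hp2 Hfa Hfs Hf.
have Hfo x : f (opp x) = - f x.
  have := Hfs (-1) x; have -> : scal (-1) x = opp x by exact: (scal_opp_one (K := R_Ring)).
  lra.
(* g must satisfy g x <= p1 x and g x <= p2 (-x) + f x *)
pose E x r := exists y, r = p1 (plus x y) + (p2 y - f y).
have HE x : (forall y, inf (E x) <= p1 (plus x y) + (p2 y - f y)) /\
    (forall c, (forall y, c <= p1 (plus x y) + (p2 y - f y)) -> c <= inf (E x)).
  have [H1 H2] := inf_spec (E x) (p1 (plus x zero) + (p2 zero - f zero)) (f x - p2 x)
    (ex_intro _ zero eq_refl) (fun r '(ex_intro y Er) => ltac:(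
      rewrite Er; have := Hf (plus x y); have := proj1 Hp2 x y; rewrite Hfa; lra)).
  split=> [y|c Hc]; first by apply: H1; exists y.
  by apply: H2 => r [y ->].
have Hsub : sublinear (fun x => inf (E x)).
  apply: sublinear_from.
  - apply: Rle_antisym.
      have := proj1 (HE zero) zero; rewrite plus_zero_l (sublinear_zero p1 Hp1) (sublinear_zero p2 Hp2).
      have := Hfs 0 zero; rewrite (scal_zero_l (K := R_Ring)); lra.
    apply: (proj2 (HE zero)) => y; rewrite plus_zero_l; have := Hf y; lra.
  - move=> x z.
    have : inf (E (plus x z)) - inf (E z) <= inf (E x); last lra.
    apply: (proj2 (HE x)) => y.
    have : inf (E (plus x z)) - (p1 (plus x y) + (p2 y - f y)) <= inf (E z); last lra.
    apply: (proj2 (HE z)) => w.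
    have := proj1 (HE (plus x z)) (plus y w).
    have -> : plus (plus x z) (plus y w) = plus (plus x y) (plus z w).
      rewrite -!plus_assoc; congr plus; rewrite !plus_assoc; congr plus; exact: plus_comm.
    have := proj1 Hp1 (plus x y) (plus z w); have := proj1 Hp2 y w; rewrite Hfa; lra.
  - move=> a x Ha.
    have : inf (E (scal a x)) / a <= inf (E x).
      apply: (proj2 (HE x)) => y.
      have := proj1 (HE (scal a x)) (scal a y).
      rewrite -scal_distr_l (proj2 Hp1 a) ?(proj2 Hp2 a) ?Hfs; try lra. move=> H.
      apply: (Rmult_le_reg_l a) => //.
      have -> : a * (inf (E (scal a x)) / a) = inf (E (scal a x)) by field; lra.
      lra.
    move=> H; have := Rmult_le_compat_l a _ _ (Rlt_le _ _ Ha) H.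
    have -> : a * (inf (E (scal a x)) / a) = inf (E (scal a x)) by field; lra.
    done.
have [g [Ga [Gs Gle]]] := hahn_banach _ Hsub.
exists g; split=> //; split=> //; split=> x.
- have := Gle x; have := proj1 (HE x) zero; rewrite plus_zero_r (sublinear_zero p2 Hp2).
  have := Hfs 0 zero; rewrite (scal_zero_l (K := R_Ring)); lra.
- have := Gle (opp x); have := proj1 (HE (opp x)) x.
  rewrite plus_opp_l (sublinear_zero p1 Hp1).
  have := Gs (-1) x; have -> : scal (-1) x = opp x by exact: (scal_opp_one (K := R_Ring)).
  lra.
Qed.

End HahnBanach.


(** * The quotient norms *)

Section QuotientNorm.

Variables (V : NormedModule R_AbsRing) (K : R -> Prop).

Definition bounded_by (n : nat) (F : Cinf V) (b : R) : Prop :=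
  forall j x, (j <= n)%nat -> norm (jet F j x) <= b.

Lemma Cinf_norm_le n (F : Cinf V) (b : R) : Rbar_le (Cinf_norm n F) b <-> bounded_by n F b.
Proof.
have [H1 H2] := Lub_Rbar_correct (fun r => exists j x, (j <= n)%nat /\ r = norm (jet F j x)).
split=> H.
- move=> j x Hj; apply: (Rbar_le_trans (norm (jet F j x)) (Cinf_norm n F) b _ H).
  by apply: H1; exists j, x.
- by apply: H2 => r [j [x [Hj ->]]]; apply: H.
Qed.

Lemma Cinf_norm_ge0 n (F : Cinf V) : Rbar_le 0 (Cinf_norm n F).
Proof.
have [H1 _] := Lub_Rbar_correct (fun r => exists j x, (j <= n)%nat /\ r = norm (jet F j x)).
apply: (Rbar_le_trans _ (norm (jet F 0%nat 0))); first exact: norm_ge_0.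
by apply: H1; exists 0%nat, 0; split; [lia|].
Qed.

Lemma restr_eq (F G : Cinf V) :
  (forall x, K x -> jet F 0%nat x = jet G 0%nat x) <-> restr K F = restr K G.
Proof.
split=> [H|H x Kx].
- rewrite /restr.
  have E : (fun x : {x : R | K x} => eval F (proj1_sig x)) = (fun x => eval G (proj1_sig x)).
    by apply: functional_extensionality => -[x Kx]; apply: H.
  move: (ex_intro _ F _) (ex_intro _ G _); rewrite E => p1 p2.
  by congr exist; exact: proof_irrelevance.
- have := f_equal (fun f : CinfK V K => evalK f (exist _ x Kx)) H; exact.
Qed.

Lemma CinfK_restr (f : CinfK V K) : exists F, f = restr K F.
Proof.
case: f => f [F HF]; exists F; subst f; rewrite /restr; congr exist; exact: proof_irrelevance.
Qed.

(** Defined on representatives, so that [CinfK] never has to be given a vector space structure. *)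
Definition qnorm (n : nat) (F : Cinf V) : R := real (CinfK_norm V K n (restr K F)).

(** A single bounded extension makes the infimum finite. The last clause asks for strict inequality
    since the infimum need not be attained; this is the source of the epsilons below. *)
Lemma qnorm_spec n F (F0 : Cinf V) b0 :
  (forall x, K x -> jet F0 0%nat x = jet F 0%nat x) -> bounded_by n F0 b0 ->
  CinfK_norm V K n (restr K F) = Finite (qnorm n F) /\ 0 <= qnorm n F /\
  (forall G b, (forall x, K x -> jet G 0%nat x = jet F 0%nat x) -> bounded_by n G b ->
     qnorm n F <= b) /\
  (forall b, qnorm n F < b ->
     exists G, (forall x, K x -> jet G 0%nat x = jet F 0%nat x) /\ bounded_by n G b).
Proof.
move=> H0 Hb0; rewrite /qnorm /CinfK_norm /Rbar_glb.
case: Rbar_ex_glb => g [H1 H2] /=.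
have Hle G b : (forall x, K x -> jet G 0%nat x = jet F 0%nat x) -> bounded_by n G b -> Rbar_le g b.
  move=> /restr_eq HG /Cinf_norm_le Hb; apply: Rbar_le_trans Hb; apply: H1.
  by exists G.
have Hg0 : Rbar_le 0 g by apply: H2 => r [G [_ ->]]; exact: Cinf_norm_ge0.
have := Hle F0 b0 H0 Hb0.
case: g H1 H2 Hle Hg0 => [g| |] //= H1 H2 Hle Hg0 _; split=> //; split=> //; split=> //.
move=> b Hb; apply: NNPP => Hn.
suff : Rbar_le b g by rewrite /=; lra.
apply: H2 => r [G [HG ->]].
case: (Rbar_le_dec b (Cinf_norm n G)) => // Hbn; case: Hn; exists G; split.
  exact/restr_eq.
by apply/Cinf_norm_le; apply: Rbar_lt_le; exact: Rbar_not_le_lt.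
Qed.

End QuotientNorm.

Arguments bounded_by {V}.
Arguments qnorm {V}.

(** * The vector space of real smooth functions *)

Notation CR := (Cinf R_NormedModule).

Definition rjet (F : CR) : Jet := jet F.

Lemma smooth_rjet F : smooth (rjet F).
Proof. exact: (jet_derive F). Qed.

Definition mkCR (d : Jet) (H : smooth d) : CR := @MkCinf R_NormedModule d H.

Lemma CR_ext (F G : CR) : (forall j x, rjet F j x = rjet G j x) -> F = G.
Proof.
case: F G => f Hf [g Hg] H.
have E : f = g.
  by apply: functional_extensionality => j; apply: functional_extensionality => x; apply: (H j x).
by subst g; congr MkCinf; exact: proof_irrelevance.
Qed.

Lemma smooth_comb a b d e : smooth d -> smooth e ->
  smooth (fun j x => a * d j x + b * e j x).
Proof.
move=> Hd He j x; apply: (is_derive_plus (V := R_NormedModule)); by apply: is_derive_scal.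
Qed.

Definition CR_comb (a b : R) (F G : CR) : CR :=
  mkCR _ (smooth_comb a b _ _ (smooth_rjet F) (smooth_rjet G)).

Lemma CR_combE a b F G j x : rjet (CR_comb a b F G) j x = a * rjet F j x + b * rjet G j x.
Proof. by []. Qed.

Definition CR_zero : CR := mkCR (fun _ _ => 0) (fun _ _ => is_derive_const _ _).

Definition CR_AbelianMonoid_mixin : AbelianMonoid.mixin_of CR.
Proof.
apply: (AbelianMonoid.Mixin CR (fun F G => CR_comb 1 1 F G) CR_zero) => *;
  apply: CR_ext => j t; rewrite !CR_combE /=; ring.
Defined.

Definition CR_AbelianGroup_mixin :
  AbelianGroup.mixin_of (AbelianMonoid.Pack CR CR_AbelianMonoid_mixin CR).
Proof.
apply: (AbelianGroup.Mixin (AbelianMonoid.Pack CR CR_AbelianMonoid_mixin CR)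
  (fun F => CR_comb (-1) 0 F F : CR)) => F.
apply: (CR_ext (CR_comb 1 1 F (CR_comb (-1) 0 F F)) CR_zero) => j t; rewrite !CR_combE /=; ring.
Defined.

Definition CR_AbelianGroup : AbelianGroup :=
  AbelianGroup.Pack CR (AbelianGroup.Class CR _ CR_AbelianGroup_mixin) CR.

Definition CR_ModuleSpace_mixin : ModuleSpace.mixin_of R_Ring CR_AbelianGroup.
Proof.
apply: (ModuleSpace.Mixin R_Ring CR_AbelianGroup (fun (a : R) (F : CR) => CR_comb a 0 F F : CR)).
- move=> a b F; apply: (CR_ext (CR_comb a 0 (CR_comb b 0 F F) (CR_comb b 0 F F)) (CR_comb (a * b) 0 F F)).
  by move=> j t; rewrite !CR_combE; ring.
- move=> F; apply: (CR_ext (CR_comb 1 0 F F) F) => j t; rewrite !CR_combE; ring.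
- move=> a F G; apply: (CR_ext (CR_comb a 0 (CR_comb 1 1 F G) (CR_comb 1 1 F G))
    (CR_comb 1 1 (CR_comb a 0 F F) (CR_comb a 0 G G))) => j t; rewrite !CR_combE; ring.
- move=> a b F; apply: (CR_ext (CR_comb (a + b) 0 F F)
    (CR_comb 1 1 (CR_comb a 0 F F) (CR_comb b 0 F F))) => j t; rewrite !CR_combE; ring.
Defined.

Definition CR_ModuleSpace : ModuleSpace R_Ring :=
  ModuleSpace.Pack R_Ring CR (ModuleSpace.Class R_Ring CR _ CR_ModuleSpace_mixin) CR.

Lemma CR_plusE (F G : CR_ModuleSpace) j x : rjet (plus F G) j x = rjet F j x + rjet G j x.
Proof. by rewrite -[plus F G]/(CR_comb 1 1 F G) CR_combE; ring. Qed.

Lemma CR_scalE (a : R) (F : CR_ModuleSpace) j x : rjet (scal a F) j x = a * rjet F j x.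
Proof. by rewrite -[scal a F]/(CR_comb a 0 F F) CR_combE; ring. Qed.

(** * Cut-off functions and the real quotient norms *)

Definition plateau_bounded (a b : R) (H : a <= b) p :=
  smooth_bounded_support (plateau a b) a (b + 1) (smooth_plateau a b)
    (fun j x Hx => plateau_out a b j x H ltac:(lra)) p.

Section RealNorms.

Variables (K : R -> Prop) (M : nat).
Hypothesis HM : (2 <= M)%nat.
Hypothesis HK : forall x, K x -> - INR M + 2 <= x <= INR M - 2.

Let INRM : 2 <= INR M.
Proof. exact: (le_INR 2). Qed.

(** Equal to 1 on [-M+2, M-2], which contains K, and zero outside [-M+1, M-1]. The unit strip left
    inside (-M, M) allows gluing with 0 of functions controlled on (-M, M) only. *)
Definition cut : Jet := plateau (- INR M + 1) (INR M - 2).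

Lemma smooth_cut : smooth cut.
Proof. exact: smooth_plateau. Qed.

Lemma cut_in x : K x -> cut 0%nat x = 1.
Proof. move=> /HK Hx; apply: plateau_in; lra. Qed.

Lemma cut_out j x : x <= - INR M + 1 \/ INR M - 1 <= x -> cut j x = 0.
Proof. move=> H; apply: plateau_out; lra. Qed.

Lemma cut_bounded p : exists B, 0 <= B /\ forall j x, (j <= p)%nat -> Rabs (cut j x) <= B.
Proof. apply: plateau_bounded; lra. Qed.

Definition cut_sup (p : nat) : R := proj1_sig (constructive_indefinite_description _ (cut_bounded p)).

Lemma cut_sup_ge0 p : 0 <= cut_sup p.
Proof. by rewrite /cut_sup; case: constructive_indefinite_description => B /= []. Qed.

Lemma cut_sup_bound p j x : (j <= p)%nat -> Rabs (cut j x) <= cut_sup p.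
Proof. by rewrite /cut_sup; case: constructive_indefinite_description => B /= [] _ H; apply: H. Qed.

Lemma cut_mul_bound n d b : 0 <= b ->
  (forall j x, (j <= n)%nat -> - INR M <= x <= INR M -> Rabs (d j x) <= b) ->
  forall j x, (j <= n)%nat -> Rabs (jmul cut d j x) <= 2 ^ n * cut_sup n * b.
Proof.
move=> Hb Hd j x Hj.
have H0 : 0 <= 2 ^ n * cut_sup n * b.
  apply: Rmult_le_pos => //; apply: Rmult_le_pos; [apply: pow_le; lra|exact: cut_sup_ge0].
case: (Rle_dec (- INR M) x) => H1; last first.
  rewrite jmul_zero_l ?Rabs_R0 // => i _; apply: cut_out; lra.
case: (Rle_dec x (INR M)) => H2; last first.
  rewrite jmul_zero_l ?Rabs_R0 // => i _; apply: cut_out; lra.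
have H := jmul_bound 1 j cut d x (cut_sup n) b ltac:(lra)
  (fun i Hi => ltac:(rewrite pow1 Rmult_1_l; apply: cut_sup_bound; lia))
  (fun i Hi => ltac:(rewrite pow1 Rmult_1_l; apply: Hd; [lia|lra])).
rewrite pow1 Rmult_1_l in H; apply: Rle_trans H _.
have H3 : 2 ^ j <= 2 ^ n by apply: Rle_pow; [lra|lia].
have H4 : 0 <= cut_sup n * b by apply: Rmult_le_pos => //; exact: cut_sup_ge0.
have := Rmult_le_compat_r _ _ _ H4 H3; lra.
Qed.

Definition cutoff (F : CR) : CR := mkCR _ (smooth_jmul _ _ smooth_cut (smooth_rjet F)).

Lemma cutoff_in F x : K x -> rjet (cutoff F) 0%nat x = rjet F 0%nat x.
Proof. by move=> Kx; rewrite /= cut_in //; exact: Rmult_1_l. Qed.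

Lemma bounded_extension n (F : CR) : exists G b,
  (forall x, K x -> rjet G 0%nat x = rjet F 0%nat x) /\ bounded_by n G b.
Proof.
have [B [HB H]] := smooth_bounded_on (rjet F) (- INR M) (INR M) (smooth_rjet F) n.
exists (cutoff F), (2 ^ n * cut_sup n * B); split; first exact: cutoff_in.
exact: (cut_mul_bound n (rjet F) B HB H).
Qed.

Notation q := (qnorm K).

Lemma q_finite n (F : CR) : CinfK_norm R_NormedModule K n (restr K F) = Finite (q n F).
Proof.
have [G [b [H1 H2]]] := bounded_extension n F.
by have [H _] := qnorm_spec _ K n F G b H1 H2.
Qed.

Lemma q_ge0 n (F : CR) : 0 <= q n F.
Proof.
have [G [b [H1 H2]]] := bounded_extension n F.
by have [_ [H _]] := qnorm_spec _ K n F G b H1 H2.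
Qed.

Lemma q_le n (F G : CR) b : (forall x, K x -> rjet G 0%nat x = rjet F 0%nat x) ->
  bounded_by n G b -> q n F <= b.
Proof. by move=> H1 H2; have [_ [_ [H _]]] := qnorm_spec _ K n F G b H1 H2; apply: H H2. Qed.

Lemma q_approx n (F : CR) b : q n F < b ->
  exists G : CR, (forall x, K x -> rjet G 0%nat x = rjet F 0%nat x) /\ bounded_by n G b.
Proof.
have [G [b0 [H1 H2]]] := bounded_extension n F.
by have [_ [_ [_ H]]] := qnorm_spec _ K n F G b0 H1 H2; exact: H.
Qed.

(** Links uniform convergence on compact sets with the quotient norms: cutting off provides a
    bounded extension. *)
Lemma q_local n (F : CR) b : 0 <= b ->
  (forall j x, (j <= n)%nat -> - INR M <= x <= INR M -> Rabs (rjet F j x) <= b) ->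
  q n F <= 2 ^ n * cut_sup n * b.
Proof.
move=> Hb H; apply: (q_le n F (cutoff F)); first exact: cutoff_in.
exact: (cut_mul_bound n (rjet F) b Hb H).
Qed.

Lemma q_mono n m (F : CR) : (n <= m)%nat -> q n F <= q m F.
Proof.
move=> Hnm; apply: le_epsilon => e He.
have [G [H1 H2]] := q_approx m F (q m F + e) ltac:(lra).
by apply: (q_le n F G) => // j x Hj; apply: H2; lia.
Qed.

Lemma q_zero n (F : CR) : (forall x, K x -> rjet F 0%nat x = 0) -> q n F = 0.
Proof.
move=> H; apply: Rle_antisym; last exact: q_ge0.
apply: (q_le n F CR_zero) => [x Kx|j x _]; first by rewrite H.
rewrite (@norm_zero R_AbsRing R_NormedModule); lra.
Qed.

Lemma q_comb n (F G H : CR) a b :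
  (forall x, K x -> rjet H 0%nat x = a * rjet F 0%nat x + b * rjet G 0%nat x) ->
  q n H <= Rabs a * q n F + Rabs b * q n G.
Proof.
move=> HH; apply: le_epsilon => e He.
pose e' := e / (Rabs a + Rabs b + 1).
have Ha := Rabs_pos a. have Hb := Rabs_pos b.
have He' : 0 < e' by apply: Rdiv_lt_0_compat; lra.
have [F' [F1 F2]] := q_approx n F (q n F + e') ltac:(lra).
have [G' [G1 G2]] := q_approx n G (q n G + e') ltac:(lra).
apply: (Rle_trans _ (Rabs a * (q n F + e') + Rabs b * (q n G + e'))).
  apply: (q_le n H (CR_comb a b F' G')).
    by move=> x Kx; rewrite CR_combE F1 // G1 // HH.
  move=> j x Hj.
  have X1 : Rabs (rjet F' j x) <= q n F + e' by exact: (F2 j x Hj).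
  have X2 : Rabs (rjet G' j x) <= q n G + e' by exact: (G2 j x Hj).
  apply: Rle_trans (Rabs_triang (a * rjet F' j x) (b * rjet G' j x)) _.
  rewrite !Rabs_mult; apply: Rplus_le_compat; exact: Rmult_le_compat_l.
have : (Rabs a + Rabs b) * e' <= e; last lra.
have -> : e = (Rabs a + Rabs b + 1) * e' by rewrite /e'; field; lra.
nra.
Qed.

Lemma q_sublinear n : sublinear CR_ModuleSpace (q n).
Proof.
apply: sublinear_from.
- by apply: q_zero.
- move=> F G; have := q_comb n F G (plus (F : CR_ModuleSpace) G) 1 1
    (fun x _ => ltac:(rewrite CR_plusE; ring)).
  rewrite Rabs_R1; lra.
- move=> a F Ha; have := q_comb n F F (scal a (F : CR_ModuleSpace)) a 0
    (fun x _ => ltac:(rewrite CR_scalE; ring)).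
  rewrite Rabs_R0 (Rabs_pos_eq a); lra.
Qed.

Lemma q_opp n (F G : CR) : (forall x, K x -> rjet G 0%nat x = - rjet F 0%nat x) -> q n G = q n F.
Proof.
move=> H; apply: Rle_antisym.
- have := q_comb n F F G (-1) 0 (fun x Kx => ltac:(rewrite H //; ring)).
  rewrite Rabs_R0 Rabs_left; lra.
- have := q_comb n G G F (-1) 0 (fun x Kx => ltac:(rewrite H //; ring)).
  rewrite Rabs_R0 Rabs_left; lra.
Qed.

(* Linear functionals on C^oo(K), given on representatives: a = 1 and b = 0 show
   that f F depends on F|_K only. *)
Definition klinear (f : CR -> R) : Prop := forall a b F G H,
  (forall x, K x -> rjet H 0%nat x = a * rjet F 0%nat x + b * rjet G 0%nat x) ->
  f H = a * f F + b * f G.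

(** The dual of a sum of two seminorms: a functional bounded by the sum is a sum of functionals
    bounded by each of them. *)
Lemma functional_split (f : CR -> R) n k (r s : R) : klinear f -> 0 <= r -> 0 <= s ->
  (forall F, Rabs (f F) <= r * q n F + s * q k F) ->
  exists g, klinear g /\ (forall F, Rabs (g F) <= r * q n F) /\
    (forall F, Rabs (f F - g F) <= s * q k F).
Proof.
move=> Hf Hr Hs Hb.
have Hsub n' r' : 0 <= r' -> sublinear CR_ModuleSpace (fun F => r' * q n' F).
  move=> Hr'; have [H1 H2] := q_sublinear n'; split=> [F G|a F Ha].
    have := Rmult_le_compat_l r' _ _ Hr' (H1 F G); lra.
  by rewrite H2 //; ring.
have [g [Ga [Gs [G1 G2]]]] := sandwich_split CR_ModuleSpace _ _ f (Hsub n r Hr) (Hsub k s Hs)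
  (fun F G => ltac:(rewrite (Hf 1 1 F G (plus (F : CR_ModuleSpace) G)) => [|x _];
     [ring|rewrite CR_plusE; ring]))
  (fun a F => ltac:(rewrite (Hf a 0 F F (scal a (F : CR_ModuleSpace))) => [|x _];
     [ring|rewrite CR_scalE; ring]))
  (fun F => Rle_trans _ _ _ (Rle_abs _) (Hb F)).
have Hopp n' (F : CR) : q n' (scal (-1) (F : CR_ModuleSpace)) = q n' F.
  by apply: q_opp => x _; rewrite CR_scalE; ring.
have Gabs F : Rabs (g F) <= r * q n F.
  apply: Rabs_le; split; last exact: G1.
  have := G1 (scal (-1) (F : CR_ModuleSpace)); rewrite Gs Hopp; lra.
exists g; split; [|split=> //].
(* [g] is linear on representatives; that it depends on restrictions only follows from its bound, as
   [q n] is 0 on functions vanishing on K. *)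
- move=> a b F G H E.
  pose D : CR_ModuleSpace := plus (scal a (F : CR_ModuleSpace)) (scal b (G : CR_ModuleSpace)).
  have E2 : g D = a * g F + b * g G by rewrite Ga !Gs.
  pose Z : CR_ModuleSpace := plus (H : CR_ModuleSpace) (scal (-1) D).
  have Hz : q n Z = 0.
    apply: q_zero => x Kx; rewrite CR_plusE CR_scalE CR_plusE !CR_scalE E //; ring.
  have := Gabs Z; rewrite Hz Rmult_0_r => Hz0.
  have : g Z = 0 by have := Rabs_pos (g Z); case: (Req_dec (g Z) 0) => // /Rabs_pos_lt; lra.
  rewrite Ga Gs E2; lra.
- move=> F; apply: Rabs_le; split; last exact: G2.
  have := G2 (scal (-1) (F : CR_ModuleSpace)); rewrite Gs Hopp.
  rewrite (Hf (-1) 0 F F (scal (-1) (F : CR_ModuleSpace))); last by move=> x _; rewrite CR_scalE; ring.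
  lra.
Qed.

(** Evaluation at nearly optimal extensions turns a bound by the norm of a representative into one
    by the quotient norm. *)
Lemma functional_bound (f : CR -> R) n C : 0 <= C -> klinear f ->
  (forall F b, 0 <= b -> bounded_by n F b -> Rabs (f F) <= C * b) ->
  forall F, Rabs (f F) <= C * q n F.
Proof.
move=> HC Hf Hb F; apply: le_epsilon => e He.
pose e' := e / (C + 1).
have He' : 0 < e' by apply: Rdiv_lt_0_compat; lra.
have [G [H1 H2]] := q_approx n F (q n F + e') ltac:(lra).
have -> : f F = f G by rewrite (Hf 1 0 G G F) => [|x Kx]; [ring|rewrite H1 //; ring].
have Hq := q_ge0 n F.
apply: Rle_trans (Hb G (q n F + e') ltac:(lra) H2) _.
have -> : e = (C + 1) * e' by rewrite /e'; field; lra.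
nra.
Qed.

End RealNorms.


(** * Limits of jets *)

Lemma is_lim_seq_halves c : is_lim_seq (fun n => c * (/ 2) ^ n) 0.
Proof.
have -> : Finite 0 = Rbar_mult c 0 by rewrite /= Rmult_0_r.
apply: is_lim_seq_scal_l; apply: is_lim_seq_geom; rewrite Rabs_pos_eq; lra.
Qed.

Lemma fast_limit (s : nat -> R) (c : R) : (forall n, Rabs (s (S n) - s n) <= c * (/ 2) ^ n) ->
  is_lim_seq s (real (Lim_seq s)) /\ forall n, Rabs (s n - real (Lim_seq s)) <= 2 * c * (/ 2) ^ n.
Proof.
move=> H.
have H2 n k : Rabs (s (n + k)%nat - s n) <= 2 * c * (/ 2) ^ n * (1 - (/ 2) ^ k).
  elim: k => [|k IH]; first by rewrite Nat.add_0_r Rminus_eq_0 Rabs_R0 /=; lra.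
  have -> : (n + S k)%nat = S (n + k) by lia.
  have -> : s (S (n + k)) - s n = (s (S (n + k)) - s (n + k)%nat) + (s (n + k)%nat - s n) by ring.
  apply: Rle_trans (Rabs_triang _ _) _.
  have := H (n + k)%nat; rewrite pow_add /=; lra.
have Hc : 0 <= c by have := H 0%nat; rewrite /= Rmult_1_r; apply: Rle_trans; exact: Rabs_pos.
have Hp n : 0 < (/ 2) ^ n by apply: pow_lt; lra.
have H3 n k : Rabs (s (n + k)%nat - s n) <= 2 * c * (/ 2) ^ n.
  apply: Rle_trans (H2 n k) _.
  have := Hp n; have := Hp k => h1 h2.
  have : 0 <= 2 * c * (/ 2) ^ n by nra.
  nra.
have Hg := is_lim_seq_halves (2 * c).
have Hex : ex_finite_lim_seq s.
  apply/ex_lim_seq_cauchy_corr => eps.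
  have [N HN] : exists N, 2 * c * (/ 2) ^ N < eps / 2.
    have /is_lim_seq_spec /= := Hg => Hg'.
    have [N HN] := Hg' (pos_div_2 eps); exists N.
    have := HN N (le_n _) => /Rabs_def2 [h _]; rewrite Rminus_0_r in h; exact: h.
  exists N => n m Hn Hm.
  have := H3 N (n - N)%nat; have := H3 N (m - N)%nat.
  have -> : (N + (n - N))%nat = n by lia.
  have -> : (N + (m - N))%nat = m by lia.
  rewrite [Rabs (s m - _)]Rabs_minus_sym => h1 h2.
  have -> : s n - s m = (s n - s N) + (s N - s m) by ring.
  apply: Rle_lt_trans (Rabs_triang _ _) _; lra.
have Hl : is_lim_seq s (real (Lim_seq s)).
  by case: Hex => l Hl; rewrite (is_lim_seq_unique _ _ Hl).
split=> // n.
have := is_lim_seq_le (fun k => Rabs (s n - s (k + n)%nat)) (fun _ => 2 * c * (/ 2) ^ n)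
  (Rabs (s n - real (Lim_seq s))) (2 * c * (/ 2) ^ n).
apply.
- by move=> k; rewrite Rabs_minus_sym Nat.add_comm.
- apply: (is_lim_seq_abs _ (Finite (s n - real (Lim_seq s)))).
  apply: is_lim_seq_minus'; first exact: is_lim_seq_const.
  exact: (proj1 (is_lim_seq_incr_n s n _)).
- exact: is_lim_seq_const.
Qed.

(** The mean value theorem for f_p - f_n, as p tends to infinity, bounds the difference quotient of
    F - f_n by e_n. No continuity of the derivatives is involved. *)
Lemma derive_limit (f g : nat -> R -> R) (F G : R -> R) (a b : R) (e : nat -> R) x :
  a < x < b -> (forall n y, a < y < b -> is_derive (f n) y (g n y)) ->
  (forall n y, a < y < b -> Rabs (g n y - G y) <= e n) -> is_lim_seq e 0 ->
  (forall y, a < y < b -> is_lim_seq (fun n => f n y) (F y)) -> is_derive F x (G x).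
Proof.
move=> Hx Hf Hg He HF; apply/is_derive_Reals => eps Heps.
have [n Hn] : exists n, e n < eps / 4.
  have /is_lim_seq_spec /= He' := He.
  have H4 : 0 < eps / 4 by lra.
  have [N HN] := He' (mkposreal _ H4); exists N.
  have := HN N (le_n _) => /= /Rabs_def2 [h _]; lra.
have [d Hd] := proj1 (is_derive_Reals _ _ _) (Hf n x Hx) (eps / 4) ltac:(lra).
have Hpos : 0 < Rmin d (Rmin (x - a) (b - x)).
  by apply: Rmin_pos; [exact: cond_pos|apply: Rmin_pos; lra].
exists (mkposreal _ Hpos) => h Hh0 /= Hh.
have Hh1 := Rlt_le_trans _ _ _ Hh (Rmin_l _ _).
have Hh2 := Rlt_le_trans _ _ _ (Rlt_le_trans _ _ _ Hh (Rmin_r _ _)) (Rmin_l _ _).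
have Hh3 := Rlt_le_trans _ _ _ (Rlt_le_trans _ _ _ Hh (Rmin_r _ _)) (Rmin_r _ _).
have [Hha Hhb] : a < x + h < b.
  by move/Rabs_def2: Hh2; move/Rabs_def2: Hh3; lra.
have Hab : 0 < Rabs h by exact: Rabs_pos_lt.
have Hdiff : Rabs ((F (x + h) - F x) - (f n (x + h) - f n x)) <= e n * Rabs h.
  have := is_lim_seq_le
    (fun p => Rabs ((f p (x + h) - f p x) - (f n (x + h) - f n x)))
    (fun p => (e p + e n) * Rabs h)
    (Rabs ((F (x + h) - F x) - (f n (x + h) - f n x))) ((0 + e n) * Rabs h).
  rewrite Rplus_0_l; apply.
  - move=> p.
    have Hm := mvt_bound (fun y => f p y - f n y) (fun y => g p y - g n y) x (x + h) (e p + e n).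
    have Hin y : Rmin x (x + h) <= y <= Rmax x (x + h) -> a < y < b.
      rewrite /Rmin /Rmax; case: Rle_dec; lra.
    have Hd' y : Rmin x (x + h) <= y <= Rmax x (x + h) -> Rabs (g p y - g n y) <= e p + e n.
      move=> /Hin Hy; have := Hg p y Hy; have := Hg n y Hy.
      have -> : g p y - g n y = (g p y - G y) + - (g n y - G y) by ring.
      have := Rabs_triang (g p y - G y) (- (g n y - G y)); rewrite Rabs_Ropp; lra.
    have -> : f p (x + h) - f p x - (f n (x + h) - f n x) =
      f p (x + h) - f n (x + h) - (f p x - f n x) by ring.
    have -> : Rabs h = Rabs (x + h - x) by congr Rabs; ring.
    apply: Hm Hd' => y /Hin Hy.
    apply: (is_derive_minus (V := R_NormedModule)); exact: Hf.
  - apply: (is_lim_seq_abs _ (Finite (F (x + h) - F x - (f n (x + h) - f n x)))).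
    apply: is_lim_seq_minus'; last exact: is_lim_seq_const.
    by apply: is_lim_seq_minus'; apply: HF.
  - have -> : Finite (e n * Rabs h) = Rbar_mult (0 + e n) (Rabs h) by rewrite /= Rplus_0_l.
    apply: is_lim_seq_scal_r; apply: is_lim_seq_plus'; [exact: He|exact: is_lim_seq_const].
have Hfh := Hd h Hh0 Hh1.
have -> : (F (x + h) - F x) / h - G x =
  ((F (x + h) - F x) - (f n (x + h) - f n x)) / h +
  (((f n (x + h) - f n x) / h - g n x) + (g n x - G x)) by field.
apply: Rle_lt_trans (Rabs_triang _ _) _.
have H1 : Rabs (((F (x + h) - F x) - (f n (x + h) - f n x)) / h) <= e n.
  rewrite Rabs_div //; apply: (Rmult_le_reg_r (Rabs h)) => //.
  have -> : forall t, t / Rabs h * Rabs h = t by move=> t; field; lra.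
  exact: Hdiff.
have H2 := Rabs_triang ((f n (x + h) - f n x) / h - g n x) (g n x - G x).
have H3 := Hg n x Hx. lra.
Qed.

(** * Operators *)

Section Operators.

Variables (K : R -> Prop) (M : nat).
Hypothesis HM : (2 <= M)%nat.
Hypothesis HK : forall x, K x -> - INR M + 2 <= x <= INR M - 2.

Notation q := (qnorm K).

Let INRM : 2 <= INR M.
Proof. exact: (le_INR 2). Qed.

Let qge0 := q_ge0 K M HM HK.
Let qmono := q_mono K M HM HK.

(* T F j is meaningful for j <= p only; as T is klinear, T F 0 depends on F|_K only. *)
Definition operator (p k : nat) (C : R) (T : CR -> Jet) : Prop :=
  0 <= C /\ (forall F, isjet p (T F)) /\
  (forall F j x, (j <= p)%nat -> Rabs (T F j x) <= C * q k F) /\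
  (forall x, klinear K (fun F => T F 0%nat x)).

Lemma operator_weaken p p' k k' C T : (p' <= p)%nat -> (k <= k')%nat ->
  operator p k C T -> operator p' k' C T.
Proof.
move=> Hp Hk [HC [H1 [H2 H3]]]; split=> //; split; [|split=> //].
- by move=> F; apply: isjet_le (H1 F).
- move=> F j x Hj; apply: Rle_trans (H2 F j x ltac:(lia)) _.
  apply: Rmult_le_compat_l => //; exact: qmono.
Qed.

Lemma operator_minus p k1 C1 T1 k2 C2 T2 : operator p k1 C1 T1 -> operator p k2 C2 T2 ->
  operator p (Nat.max k1 k2) (C1 + C2) (fun F j x => T1 F j x - T2 F j x).
Proof.
move=> /(operator_weaken p p k1 (Nat.max k1 k2) _ _ (le_n _) ltac:(lia)) [HC1 [J1 [B1 L1]]].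
move=> /(operator_weaken p p k2 (Nat.max k1 k2) _ _ (le_n _) ltac:(lia)) [HC2 [J2 [B2 L2]]].
split; [lra|split; [|split]].
- move=> F j x Hj; apply: (is_derive_minus (V := R_NormedModule)); [exact: J1|exact: J2].
- move=> F j x Hj; have := B1 F j x Hj; have := B2 F j x Hj.
  have -> : T1 F j x - T2 F j x = T1 F j x + - T2 F j x by ring.
  have := Rabs_triang (T1 F j x) (- T2 F j x); rewrite Rabs_Ropp; lra.
- move=> x a b F G H E; rewrite (L1 x a b F G H E) (L2 x a b F G H E); ring.
Qed.

(** * Operators given by series of atoms *)

Section SeriesOperator.

Variables (m p k : nat) (W : R -> Prop) (fr : frame M m K W).
(** Atoms and coefficients are not those of [fr], which supplies only scales, sizes and constants:
    later some atoms are replaced by 0 and coefficients by the two halves of a splitting. *)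
Variables (atom : nat -> nat -> nat -> Jet) (mu : nat -> nat -> nat -> CR -> R) (D : R).
Hypothesis Hsm : forall v i l, smooth (atom v i l).
Hypothesis Hat : forall j v i l x, (l < m)%nat ->
  fr_scale _ _ _ _ fr v ^ j * Rabs (atom v i l j x) <=
  fr_atom_cst _ _ _ _ fr j * fr_scale _ _ _ _ fr v ^ l.
Hypothesis Hmu : forall v i l, klinear K (mu v i l).
Hypothesis HD : 0 <= D.
Hypothesis Hb : forall v i l F, (l < m)%nat ->
  Rabs (mu v i l F) * fr_scale _ _ _ _ fr v ^ l <= D * q k F * fr_scale _ _ _ _ fr v ^ (p + 2).

Definition level (v : nat) (F : CR) : Jet := fun j x =>
  rsum (fr_size _ _ _ _ fr v) (fun i => rsum m (fun l => mu v i l F * atom v i l j x)).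

Definition partial (n : nat) (F : CR) : Jet := fun j x => rsum n (fun v => level v F j x).

Definition series_op (F : CR) : Jet := fun j x => real (Lim_seq (fun n => partial n F j x)).

Definition level_cst : R :=
  fr_count _ _ _ _ fr * INR m * rsum (S p) (fun j => Rabs (fr_atom_cst _ _ _ _ fr j)).

Lemma rsum_ge_term n f i : (forall j, 0 <= f j) -> (i < n)%nat -> f i <= rsum n f.
Proof.
move=> H; elim: n => [|n IH] Hi /=; first lia.
have Hn := H n.
have H0 : 0 <= rsum n f.
  clear -H; elim: n => [|n IH] /=; [lra|have := H n; lra].
case: (Nat.eq_dec i n) => [->|Hne]; first lra.
have := IH ltac:(lia); lra.
Qed.

Lemma fr_count_ge0 : 0 <= fr_count _ _ _ _ fr.
Proof.
apply: (Rle_trans _ _ _ _ (fr_size_le _ _ _ _ fr 0%nat)).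
apply: Rmult_le_pos; first exact: pos_INR. have := fr_scale_pos _ _ _ _ fr 0%nat; lra.
Qed.

Lemma level_cst_ge0 : 0 <= level_cst.
Proof.
apply: Rmult_le_pos; first by apply: Rmult_le_pos; [exact: fr_count_ge0|exact: pos_INR].
apply: Rle_trans (Rabs_pos _) (rsum_ge_term (S p) (fun j => Rabs (fr_atom_cst _ _ _ _ fr j)) 0%nat
  (fun j => Rabs_pos _) ltac:(lia)).
Qed.

(** A j-th derivative with j <= p costs s^-j, so s^(p+2) leaves s^2: one factor s pays for the
    number of cells, the other is at most 2^-v and makes the levels summable. *)
Lemma level_bound v F j x : (j <= p)%nat ->
  Rabs (level v F j x) <= level_cst * D * q k F * (/ 2) ^ v.
Proof.
move=> Hj; have [Hs1 Hs2] := fr_scale_pos _ _ _ _ fr v.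
set s := fr_scale _ _ _ _ fr v in Hs1 Hs2.
have Hs3 : s <= 1.
  by apply: Rle_trans Hs2 _; rewrite -(pow1 v); apply: pow_incr; lra.
set A := rsum (S p) (fun j => Rabs (fr_atom_cst _ _ _ _ fr j)).
have HA : fr_atom_cst _ _ _ _ fr j <= A.
  apply: Rle_trans (Rle_abs _) _.
  exact: (rsum_ge_term (S p) (fun j => Rabs (fr_atom_cst _ _ _ _ fr j)) j (fun j => Rabs_pos _) ltac:(lia)).
have HA0 : 0 <= A.
  exact: Rle_trans (Rabs_pos _) (rsum_ge_term (S p) (fun j => Rabs (fr_atom_cst _ _ _ _ fr j)) 0%nat
    (fun j => Rabs_pos _) ltac:(lia)).
have Hq := qge0 k F.
have Hterm i l : (l < m)%nat -> Rabs (mu v i l F * atom v i l j x) <= A * D * q k F * s ^ 2.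
  move=> Hl; rewrite Rabs_mult.
  have H1 := Hat j v i l x Hl. have H2 := Hb v i l F Hl.
  rewrite -/s in H1 H2.
  have Hsj : 0 < s ^ j by exact: pow_lt.
  have Hsl : 0 < s ^ l by exact: pow_lt.
  have H3 : s ^ j * Rabs (atom v i l j x) <= A * s ^ l.
    by apply: Rle_trans H1 _; apply: Rmult_le_compat_r; lra.
  have H4 : s ^ j * (Rabs (mu v i l F) * Rabs (atom v i l j x)) <= A * (D * q k F * s ^ (p + 2)).
    have := Rmult_le_compat_l _ _ _ (Rabs_pos (mu v i l F)) H3.
    have := Rmult_le_compat_l _ _ _ HA0 H2; lra.
  have H5 : s ^ (p + 2) <= s ^ j * s ^ 2.
    have -> : (p + 2 = j + 2 + (p - j))%nat by lia.
    rewrite !pow_add -[X in _ <= X]Rmult_1_r; apply: Rmult_le_compat_l.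
      by apply: Rmult_le_pos; apply: pow_le; lra.
    by rewrite -(pow1 (p - j)); apply: pow_incr; lra.
  have H6 : 0 <= A * (D * q k F) by apply: Rmult_le_pos => //; exact: Rmult_le_pos.
  have := Rmult_le_compat_l _ _ _ H6 H5 => H7.
  apply: (Rmult_le_reg_l (s ^ j)) => //; lra.
have H8 : Rabs (level v F j x) <= INR (fr_size _ _ _ _ fr v) * (INR m * (A * D * q k F * s ^ 2)).
  by apply: rsum_abs_le => i _; apply: rsum_abs_le => l Hl; apply: Hterm.
apply: Rle_trans H8 _.
have Hcnt := fr_size_le _ _ _ _ fr v; rewrite -/s in Hcnt.
have H9 : 0 <= INR m * (A * D * q k F) * s.
  apply: Rmult_le_pos; last lra. apply: Rmult_le_pos; first exact: pos_INR.
  by repeat apply: Rmult_le_pos.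
have H10 := Rmult_le_compat_r _ _ _ H9 Hcnt.
have H11 : 0 <= level_cst * D * q k F.
  by apply: Rmult_le_pos => //; apply: Rmult_le_pos => //; exact: level_cst_ge0.
have H12 := Rmult_le_compat_l _ _ _ H11 Hs2.
rewrite /level_cst -/A in H12 *; lra.
Qed.

Lemma smooth_partial n F : smooth (partial n F).
Proof.
move=> j x; rewrite /partial /level.
apply: is_derive_rsum => v _; apply: is_derive_rsum => i _; apply: is_derive_rsum => l _.
apply: is_derive_scal; exact: Hsm.
Qed.

Lemma partial_limit F j x : (j <= p)%nat ->
  is_lim_seq (fun n => partial n F j x) (series_op F j x) /\
  forall n, Rabs (partial n F j x - series_op F j x) <= 2 * (level_cst * D * q k F) * (/ 2) ^ n.
Proof.
move=> Hj; apply: fast_limit => n.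
rewrite /partial /=.
have -> : forall a b : R, a + b - a = b by move=> *; ring.
exact: level_bound.
Qed.

Lemma series_operator : operator p k (2 * level_cst * D) series_op.
Proof.
have Hc0 := level_cst_ge0.
split; [|split; [|split]].
- by apply: Rmult_le_pos; lra.
- move=> F j x Hj.
  apply: (derive_limit (fun n => partial n F j) (fun n => partial n F (S j)) _ _ (x - 1) (x + 1)
     (fun n => 2 * (level_cst * D * q k F) * (/ 2) ^ n)); first lra.
  + move=> n y _; exact: smooth_partial.
  + by move=> n y _; exact: (proj2 (partial_limit F (S j) y Hj)).
  + exact: is_lim_seq_halves.
  + by move=> y _; exact: (proj1 (partial_limit F j y ltac:(lia))).
- move=> F j x Hj; have := proj2 (partial_limit F j x Hj) 0%nat.
  rewrite [partial _ _ _ _]/= Rminus_0_l Rabs_Ropp /=; lra.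
- move=> x a b F G H E.
  have [LF _] := partial_limit F 0%nat x ltac:(lia).
  have [LG _] := partial_limit G 0%nat x ltac:(lia).
  have LH : is_lim_seq (fun n => partial n H 0%nat x) (a * series_op F 0%nat x + b * series_op G 0%nat x).
    apply: (is_lim_seq_ext (fun n => a * partial n F 0%nat x + b * partial n G 0%nat x)).
      move=> n; rewrite /partial -rsum_lin; apply: rsum_ext => v _.
      rewrite /level -rsum_lin; apply: rsum_ext => i _.
      rewrite -rsum_lin; apply: rsum_ext => l _.
      rewrite (Hmu v i l a b F G H E); ring.
    apply: is_lim_seq_plus'.
    + exact: (is_lim_seq_scal_l _ a (Finite _) LF).
    + exact: (is_lim_seq_scal_l _ b (Finite _) LG).
  by rewrite {1}/series_op (is_lim_seq_unique _ _ LH).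
Qed.

Lemma series_op_zero F x : (forall v i l, atom v i l 0%nat x = 0) -> series_op F 0%nat x = 0.
Proof.
move=> H; rewrite /series_op (Lim_seq_ext _ (fun _ => 0)); first by rewrite Lim_seq_const.
move=> n; apply: rsum_zero => v _; apply: rsum_zero => i _; apply: rsum_zero => l _.
by rewrite H Rmult_0_r.
Qed.

End SeriesOperator.

Lemma is_series_rsum a l : is_series a l -> is_lim_seq (fun n => rsum n a) l.
Proof.
move=> H; apply: (proj2 (is_lim_seq_incr_1 (fun n => rsum n a) l)).
apply: (is_lim_seq_ext (sum_n a)); last exact: H.
elim=> [|n IH]; first by rewrite sum_O /= Rplus_0_l.
by rewrite sum_Sn IH.
Qed.

(** A frame of order p + 3 with nodes in K has coefficients of size s^(p+3-1-l) = s^(p+2-l), just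
    enough for convergence in C^p. *)
Lemma local_extension (p : nat) : exists k C E, operator p k C E /\
  forall F x, K x -> E F 0%nat x = rjet F 0%nat x.
Proof.
have HW x : K x -> - INR M <= x <= INR M by move/HK; lra.
have fr := frame_exists M (p + 3) K K ltac:(lia) (fun x Kx => Kx) HW.
pose mu v i l (F : CR) := fr_coef _ _ _ _ fr v i l (rjet F).
pose D := Rabs (fr_coef_cst _ _ _ _ fr).
have Hmu v i l : klinear K (mu v i l).
  by move=> a b F G H E; apply: (fr_lin _ _ _ _ fr).
have HD : 0 <= D by exact: Rabs_pos.
have Hs v := proj1 (fr_scale_pos _ _ _ _ fr v).
have Hb v i l F : (l < p + 3)%nat ->
   Rabs (mu v i l F) * fr_scale _ _ _ _ fr v ^ l <=
   D * q (p + 3) F * fr_scale _ _ _ _ fr v ^ (p + 2).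
  move=> Hl.
  have HC : 0 <= D * fr_scale _ _ _ _ fr v ^ (p + 3 - 1 - l).
    by apply: Rmult_le_pos => //; apply: pow_le; have := Hs v; lra.
  have HG (G : CR) b : 0 <= b -> bounded_by (p + 3) G b ->
      Rabs (mu v i l G) <= D * fr_scale _ _ _ _ fr v ^ (p + 3 - 1 - l) * b.
    move=> Hb0 HGb.
    apply: Rle_trans (fr_coef_bound _ _ _ _ fr (rjet G) b
      (smooth_isjet _ _ (smooth_rjet G)) (fun j x Hj _ => HGb j x Hj) v i l Hl) _.
    have Hsl : 0 <= b * fr_scale _ _ _ _ fr v ^ (p + 3 - 1 - l).
      by apply: Rmult_le_pos => //; apply: pow_le; have := Hs v; lra.
    have := Rmult_le_compat_r _ _ _ Hsl (Rle_abs (fr_coef_cst _ _ _ _ fr)); rewrite -/D; lra.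
  have H := functional_bound K M HM HK (mu v i l) (p + 3) _ HC (Hmu v i l) HG F.
  have Hsl : 0 <= fr_scale _ _ _ _ fr v ^ l by apply: pow_le; have := Hs v; lra.
  apply: Rle_trans (Rmult_le_compat_r _ _ _ Hsl H) _; right.
  have -> : (p + 2 = (p + 3 - 1 - l) + l)%nat by lia.
  rewrite pow_add; ring.
have Hop := series_operator (p + 3) p (p + 3) K fr (fr_atom _ _ _ _ fr) mu D
  (fr_smooth _ _ _ _ fr) (fr_atom_bound _ _ _ _ fr) Hmu HD Hb.
do 3 eexists; split; first exact: Hop.
move=> F x Kx.
have [B [HB HBb]] := smooth_bounded_on (rjet F) (- INR M) (INR M) (smooth_rjet F) (p + 3).
have Hexp := fr_expansion _ _ _ _ fr (rjet F) B (smooth_isjet _ _ (smooth_rjet F)) HBb x Kx.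
by rewrite /series_op (is_lim_seq_unique _ _ (is_series_rsum _ _ Hexp)).
Qed.

End Operators.


(** * From (DN) to an extension operator *)

Section MittagLeffler.

Variables (K : R -> Prop) (M : nat).
Hypothesis HM : (2 <= M)%nat.
Hypothesis HK : forall x, K x -> - INR M + 2 <= x <= INR M - 2.

Notation q := (qnorm K).

Let INRM : 2 <= INR M.
Proof. exact: (le_INR 2). Qed.

Let qge0 := q_ge0 K M HM HK.
Let qmono := q_mono K M HM HK.

Variable n : nat.
Hypothesis Hdn : forall m, (n <= m)%nat -> exists k c, (m <= k)%nat /\ 0 < c /\
  forall F : CR, q m F * q m F <= c * (q k F * q n F).

(** By (DN), q_m is at most the geometric mean of r q_n and (c/r) q_k, hence at most their sum. The
    free parameter r will depend on the scale. *)
Lemma dn_split m : (n <= m)%nat -> exists k c, 0 < c /\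
  forall (F : CR) r, 0 < r -> q m F <= r * q n F + c / r * q k F.
Proof.
move=> /Hdn [k [c [_ [Hc H]]]]; exists k, c; split=> // F r Hr.
have Hn := qge0 n F. have Hk := qge0 k F. have Hm := qge0 m F.
have Hcr : 0 < c / r by exact: Rdiv_lt_0_compat.
have H1 : 0 <= r * q n F by nra.
have H2 : 0 <= c / r * q k F by nra.
apply: Rsqr_incr_0_var; last lra.
rewrite /Rsqr; have := H F.
have -> : c * (q k F * q n F) = (r * q n F) * (c / r * q k F) by field; lra.
nra.
Qed.

Lemma zero_klinear : klinear K (fun _ => 0).
Proof. by move=> a b F G H _; ring. Qed.

(* The decomposition T = A + B on [-M, M]: the coefficients of T in the frame of
   functions vanishing on K are split by duality at a rate depending on the scale. *)
Lemma operator_split m k C T delta : (7 <= m)%nat -> 0 < delta -> operator K m k C T ->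
  (forall F x, K x -> T F 0%nat x = 0) ->
  exists k' C' A B, operator K (m + 1) k' C' A /\ operator K (m - 7) n delta B /\
    (forall F x, K x -> A F 0%nat x = 0) /\ (forall F x, K x -> B F 0%nat x = 0) /\
    (forall F x, - INR M <= x <= INR M -> T F 0%nat x = A F 0%nat x + B F 0%nat x).
Proof.
move=> Hm Hdelta HT0 HTK.
have {HT0} := operator_weaken K M HM HK m m k (Nat.max k n) C T (le_n _) ltac:(lia) HT0.
(* (DN) speaks of norms beyond the dominating one, so k is raised to at least n. *)
move: (Nat.max k n) (Nat.le_max_r k n) => {}k Hk [HC [TJ [TB TL]]].
have HKW x : K x -> - INR M <= x <= INR M by move/HK; lra.
(* Nodes throughout [-M, M]: the function [T F] has to be recovered on the whole interval, not only
   on K. *)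
have fr := frame_exists M m K (fun x => - INR M <= x <= INR M) ltac:(lia) HKW (fun x Hx => Hx).
pose s := fr_scale _ _ _ _ fr.
have Hs v : 0 < s v by exact: (proj1 (fr_scale_pos _ _ _ _ fr v)).
pose vanishing v i l := forall x, K x -> fr_atom _ _ _ _ fr v i l 0%nat x = 0.
(* An atom not vanishing on K has coefficient 0 in [T F], but the two halves of that coefficient
   need not be 0. Such atoms are replaced by 0, so that both series vanish on K. *)
pose atom v i l : Jet := fun j x =>
  match excluded_middle_informative (vanishing v i l) with
  | left _ => fr_atom _ _ _ _ fr v i l j x | right _ => 0 end.
have Hsm v i l : smooth (atom v i l).
  rewrite /atom; case: excluded_middle_informative => _ j x; first exact: fr_smooth.
  exact: is_derive_const.
have HatK v i l x : K x -> atom v i l 0%nat x = 0.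
  by rewrite /atom; case: excluded_middle_informative => // H Kx; apply: H.
have Hat j v i l x : (l < m)%nat ->
    s v ^ j * Rabs (atom v i l j x) <= fr_atom_cst _ _ _ _ fr j * s v ^ l.
  move=> Hl; have H := fr_atom_bound _ _ _ _ fr j v i l x Hl.
  rewrite /atom; case: excluded_middle_informative => _ //.
  rewrite Rabs_R0 Rmult_0_r; apply: Rle_trans H.
  by apply: Rmult_le_pos; [apply: pow_le; have := Hs v; rewrite /s; lra|exact: Rabs_pos].
pose mu v i l (F : CR) := fr_coef _ _ _ _ fr v i l (T F).
have Hmu v i l : klinear K (mu v i l).
  by move=> a b F G H E; apply: (fr_lin _ _ _ _ fr) => x _; apply: TL.
pose c0 := Rabs (fr_coef_cst _ _ _ _ fr).
have Hc0 : 0 <= c0 by exact: Rabs_pos.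
have Hmub v i l F : (l < m)%nat -> Rabs (mu v i l F) <= c0 * C * s v ^ (m - 1 - l) * q k F.
  move=> Hl; apply: Rle_trans (fr_coef_bound _ _ _ _ fr (T F) (C * q k F) (TJ F)
    (fun j x Hj _ => TB F j x Hj) v i l Hl) _.
  have H1 : 0 <= C * q k F * s v ^ (m - 1 - l).
    apply: Rmult_le_pos; first exact: Rmult_le_pos. apply: pow_le; have := Hs v; lra.
  have := Rmult_le_compat_r _ _ _ H1 (Rle_abs (fr_coef_cst _ _ _ _ fr)).
  rewrite -/c0 -/s; lra.
have [k' [c [Hc Hsplit]]] := dn_split k Hk.
pose lc := 2 * level_cst K M m (m - 7) _ fr.
have Hlc : 0 <= lc by have := level_cst_ge0 K M HM m (m - 7) _ fr; rewrite /lc; lra.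
(* Makes the constant of the [psi]-series at most [delta]; the summand 1 avoids division by zero. *)
pose d := delta / (lc * (c0 * C) + 1).
have Hden : 0 < lc * (c0 * C) + 1.
  have : 0 <= lc * (c0 * C) by apply: Rmult_le_pos => //; exact: Rmult_le_pos. lra.
have Hd : 0 < d by exact: Rdiv_lt_0_compat.
have Hlcd : lc * (c0 * C * d) <= delta.
  have -> : delta = (lc * (c0 * C) + 1) * d by rewrite /d; field; lra.
  nra.
(* With r = d / s^4 the coefficient bound s^(m-1-l) becomes s^(m-5-l) = s^((m-7)+2-l) for [psi] and
   s^(m+3-l) = s^((m+1)+2-l) for the rest, the exponents required for orders m - 7 and m + 1. *)
have Hpsi v i l : exists psi, klinear K psi /\ ((l < m)%nat -> forall F,
    Rabs (psi F) * s v ^ l <= c0 * C * d * q n F * s v ^ (m - 7 + 2) /\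
    Rabs (mu v i l F - psi F) * s v ^ l <= c0 * C * (c / d) * q k' F * s v ^ (m + 1 + 2)).
  case: (Nat.lt_ge_cases l m) => Hl; last first.
    exists (fun _ => 0); split; [exact: zero_klinear|lia].
  have Hsv := Hs v.
  have Hp4 : 0 < s v ^ 4 by exact: pow_lt.
  have Hpl : 0 < s v ^ l by exact: pow_lt.
  have Hr : 0 < d / s v ^ 4 by exact: Rdiv_lt_0_compat.
  set X := c0 * C * s v ^ (m - 1 - l).
  have HX : 0 <= X.
    by apply: Rmult_le_pos; [exact: Rmult_le_pos|apply: pow_le; lra].
  have H1 : 0 <= X * (d / s v ^ 4) by apply: Rmult_le_pos; lra.
  have H2 : 0 <= X * (c / (d / s v ^ 4)).
    apply: Rmult_le_pos => //; left; exact: Rdiv_lt_0_compat.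
  have Hb F : Rabs (mu v i l F) <= X * (d / s v ^ 4) * q n F + X * (c / (d / s v ^ 4)) * q k' F.
    apply: Rle_trans (Hmub v i l F Hl) _; rewrite -/X.
    have := Rmult_le_compat_l _ _ _ HX (Hsplit F _ Hr); lra.
  have [psi [P1 [P2 P3]]] := functional_split K M HM HK (mu v i l) n k' _ _ (Hmu v i l) H1 H2 Hb.
  exists psi; split=> // _ F; split.
  - apply: Rle_trans (Rmult_le_compat_r _ _ _ (Rlt_le _ _ Hpl) (P2 F)) _; right.
    have -> : c0 * C * d * q n F * s v ^ (m - 7 + 2) = c0 * C * d * q n F * (s v ^ (m - 7 + 2) * s v ^ 4) / s v ^ 4.
      by field; lra.
    rewrite -pow_add /X.
    have -> : (m - 7 + 2 + 4 = (m - 1 - l) + l)%nat by lia.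
    rewrite pow_add; field; lra.
  - apply: Rle_trans (Rmult_le_compat_r _ _ _ (Rlt_le _ _ Hpl) (P3 F)) _; right.
    have -> : (m + 1 + 2 = (m - 1 - l) + l + 4)%nat by lia.
    rewrite !pow_add /X; field; lra.
pose psi v i l := proj1_sig (constructive_indefinite_description _ (Hpsi v i l)).
have Hpsi1 v i l : klinear K (psi v i l).
  exact: (proj1 (proj2_sig (constructive_indefinite_description _ (Hpsi v i l)))).
have Hpsi2 v i l (Hl : (l < m)%nat) F :=
  proj2 (proj2_sig (constructive_indefinite_description _ (Hpsi v i l))) Hl F.
rewrite -/(psi _ _ _) in Hpsi2.
have HDB : 0 <= c0 * C * d by apply: Rmult_le_pos; [exact: Rmult_le_pos|lra].
have Hcd : 0 < c / d by exact: Rdiv_lt_0_compat.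
have HDA : 0 <= c0 * C * (c / d) by apply: Rmult_le_pos; [exact: Rmult_le_pos|lra].
pose rho v i l F := mu v i l F - psi v i l F.
have Hrho v i l : klinear K (rho v i l).
  move=> a b F G H E; rewrite /rho (Hmu v i l a b F G H E) (Hpsi1 v i l a b F G H E); ring.
have OB := series_operator K M HM HK m (m - 7) n _ fr atom psi _ Hsm Hat Hpsi1 HDB
  (fun v i l F Hl => proj1 (Hpsi2 v i l Hl F)).
have OA := series_operator K M HM HK m (m + 1) k' _ fr atom rho _ Hsm Hat Hrho HDA
  (fun v i l F Hl => proj2 (Hpsi2 v i l Hl F)).
exists k', (2 * level_cst K M m (m + 1) _ fr * (c0 * C * (c / d))),
  (series_op K M m _ fr atom rho), (series_op K M m _ fr atom psi).
split; [exact: OA|split; [|split; [|split]]].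
- case: OB => [_ [J [B L]]]; split; [lra|split; [exact: J|split; [|exact: L]]].
  move=> F j x Hj; apply: Rle_trans (B F j x Hj) _; apply: Rmult_le_compat_r => //.
- by move=> F x Kx; apply: series_op_zero => v i l; apply: HatK.
- by move=> F x Kx; apply: series_op_zero => v i l; apply: HatK.
- move=> F x Hx.
  have [LB _] := partial_limit K M HM HK m (m - 7) n _ fr atom psi _ Hat HDB
    (fun v i l F Hl => proj1 (Hpsi2 v i l Hl F)) F 0%nat x ltac:(lia).
  have [LA _] := partial_limit K M HM HK m (m + 1) k' _ fr atom rho _ Hat HDA
    (fun v i l F Hl => proj2 (Hpsi2 v i l Hl F)) F 0%nat x ltac:(lia).
  have LT := is_series_rsum _ _ (fr_expansion _ _ _ _ fr (T F) (C * q k F) (TJ F)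
    (fun j y Hj _ => TB F j y Hj) x Hx).
  have LS := is_lim_seq_plus' _ _ _ _ LA LB.
  have E : forall u : nat, partial K M m _ fr atom rho u F 0%nat x + partial K M m _ fr atom psi u F 0%nat x =
    rsum u (fun v => rsum (fr_size _ _ _ _ fr v) (fun i => rsum m (fun l =>
      fr_coef _ _ _ _ fr v i l (T F) * fr_atom _ _ _ _ fr v i l 0%nat x))).
    move=> u; rewrite /partial -rsum_plus; apply: rsum_ext => v _.
    rewrite /level -rsum_plus; apply: rsum_ext => i _.
    rewrite -rsum_plus; apply: rsum_ext => l _.
    rewrite -Rmult_plus_distr_r /rho -/(mu v i l F).
    have -> : mu v i l F - psi v i l F + psi v i l F = mu v i l F by ring.
    rewrite /atom; case: excluded_middle_informative => // Hv.
    have [Z|//] := fr_zero _ _ _ _ fr (T F) (HTK F) v i l.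
    by rewrite /mu Z; ring.
  have := is_lim_seq_unique _ _ LT.
  rewrite (is_lim_seq_unique _ _ (is_lim_seq_ext _ _ _ E LS)) => -[] //.
Qed.

(** Seven derivatives are held in reserve: splitting at order t + 7 leaves a correction of order
    t. *)
Definition stage (t : nat) (H : CR -> Jet) : Prop :=
  (exists k C, operator K (t + 7) k C H) /\ forall F x, K x -> H F 0%nat x = rjet F 0%nat x.

(** Let E be an extension operator of order t + 8 and split E - H = A + B. Then H' = E - A is of
    order t + 8 and still extends, since A vanishes on K, while H' - H = B is small in C^t. *)
Lemma stage_next t H : stage t H -> exists H', stage (S t) H' /\
  forall F j x, (j <= t)%nat -> - INR M < x < INR M ->
    Rabs (H' F j x - H F j x) <= q n F * (/ 2) ^ t.
Proof.
move=> [[k [C HH]] HHK].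
have [k1 [C1 [E [HE HEK]]]] := local_extension K M HM HK (t + 8).
have HE7 := operator_weaken K M HM HK (t + 8) (t + 7) k1 k1 C1 E ltac:(lia) (le_n _) HE.
have HT := operator_minus K M HM HK (t + 7) k1 C1 E k C H HE7 HH.
have HTK F x : K x -> E F 0%nat x - H F 0%nat x = 0.
  by move=> Kx; rewrite HEK // HHK //; ring.
have [k2 [C2 [A [B [HA [HB [HA0 [HB0 HAB]]]]]]]] :=
  operator_split (t + 7) _ _ _ ((/ 2) ^ t) ltac:(lia) ltac:(apply: pow_lt; lra) HT HTK.
have -> : (S t = t + 1)%nat by lia.
have E8 : (t + 7 + 1 = t + 1 + 7)%nat by lia.
have E88 : (t + 8 = t + 1 + 7)%nat by lia.
have E0 : (t + 7 - 7 = t)%nat by lia.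
rewrite E8 in HA; rewrite E88 in HE; rewrite E0 in HB.
exists (fun F j x => E F j x - A F j x); split; [split|].
- do 2 eexists; exact: (operator_minus K M HM HK _ _ _ _ _ _ _ HE HA).
- by move=> F x Kx; rewrite HEK // HA0 //; ring.
- move=> F j x Hj Hx.
  have JH := isjet_le (t + 7) t _ ltac:(lia) (proj1 (proj2 HH) F).
  have JE := isjet_le (t + 1 + 7) t _ ltac:(lia) (proj1 (proj2 HE) F).
  have JA := isjet_le (t + 1 + 7) t _ ltac:(lia) (proj1 (proj2 HA) F).
  have JB := proj1 (proj2 HB) F.
  have -> : E F j x - A F j x - H F j x = B F j x.
    apply: (jet_unique (- INR M) (INR M) (fun i y => E F i y - A F i y - H F i y) (B F) t) => //.
    + move=> i y Hi; apply: (is_derive_minus (V := R_NormedModule)); last exact: JH.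
      apply: (is_derive_minus (V := R_NormedModule)); [exact: JE|exact: JA].
    + move=> y Hy; have := HAB F y ltac:(lra) => /= E1; lra.
  rewrite Rmult_comm; exact: (proj1 (proj2 (proj2 HB)) F j x Hj).
Qed.

Lemma stage_zero : exists H, stage 0 H.
Proof.
have [k1 [C1 [E [HE HEK]]]] := local_extension K M HM HK 7.
by exists E; split=> //; exists k1, C1.
Qed.

Fixpoint stages (t : nat) : {H : CR -> Jet | stage t H} :=
  match t with
  | O => constructive_indefinite_description _ stage_zero
  | S u => let w := constructive_indefinite_description _
             (stage_next u (proj1_sig (stages u)) (proj2_sig (stages u))) in
           exist _ (proj1_sig w) (proj1 (proj2_sig w))
  end.

Definition approx_ext (t : nat) : CR -> Jet := proj1_sig (stages t).

Lemma approx_ext_stage t : stage t (approx_ext t).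
Proof. exact: (proj2_sig (stages t)). Qed.

Lemma approx_ext_step t F j x : (j <= t)%nat -> - INR M < x < INR M ->
  Rabs (approx_ext (S t) F j x - approx_ext t F j x) <= q n F * (/ 2) ^ t.
Proof.
rewrite /approx_ext /=; case: constructive_indefinite_description => H' [_ H] /=.
exact: H.
Qed.

Definition limit_ext (F : CR) : Jet := fun j x => real (Lim_seq (fun t => approx_ext t F j x)).

(** The step estimate covers the j-th derivative only from stage j on; the shift by i >= j drops the
    earlier stages. *)
Lemma limit_ext_spec F j i x : (j <= i)%nat -> - INR M < x < INR M ->
  is_lim_seq (fun t => approx_ext (t + i) F j x) (limit_ext F j x) /\
  forall t, Rabs (approx_ext (t + i) F j x - limit_ext F j x) <= 2 * q n F * (/ 2) ^ t.
Proof.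
move=> Hi Hx; rewrite /limit_ext -(Lim_seq_incr_n _ i).
apply: (fast_limit (fun t => approx_ext (t + i) F j x)) => t.
apply: Rle_trans (approx_ext_step (t + i) F j x ltac:(lia) Hx) _.
rewrite pow_add; apply: Rmult_le_compat_l => //.
have H1 : 0 < (/ 2) ^ t by apply: pow_lt; lra.
have H2 : (/ 2) ^ i <= 1 by rewrite -(pow1 i); apply: pow_incr; lra.
nra.
Qed.

Lemma limit_ext_derive F j x : - INR M < x < INR M ->
  is_derive (limit_ext F j) x (limit_ext F (S j) x).
Proof.
move=> Hx.
apply: (derive_limit (fun t => approx_ext (t + S j) F j) (fun t => approx_ext (t + S j) F (S j))
  _ _ (- INR M) (INR M) (fun t => 2 * q n F * (/ 2) ^ t)) => //.
- move=> t y _; have [[k [C [_ [J _]]]] _] := approx_ext_stage (t + S j).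
  apply: J; lia.
- by move=> t y Hy; apply: (proj2 (limit_ext_spec F (S j) (S j) y (le_n _) Hy)).
- exact: is_lim_seq_halves.
- by move=> y Hy; apply: (proj1 (limit_ext_spec F j (S j) y ltac:(lia) Hy)).
Qed.

Lemma limit_ext_K F x : K x -> limit_ext F 0%nat x = rjet F 0%nat x.
Proof.
move=> Kx; rewrite /limit_ext (Lim_seq_ext _ (fun _ => rjet F 0%nat x)) ?Lim_seq_const //.
by move=> t; apply: (proj2 (approx_ext_stage t)).
Qed.

Lemma limit_ext_klinear x : - INR M < x < INR M -> klinear K (fun F => limit_ext F 0%nat x).
Proof.
move=> Hx a b F G H E.
have [LF _] := limit_ext_spec F 0%nat 0%nat x (le_n _) Hx.
have [LG _] := limit_ext_spec G 0%nat 0%nat x (le_n _) Hx.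
have [LH _] := limit_ext_spec H 0%nat 0%nat x (le_n _) Hx.
have LC := is_lim_seq_plus' _ _ _ _ (is_lim_seq_scal_l _ a (Finite _) LF)
  (is_lim_seq_scal_l _ b (Finite _) LG).
have := is_lim_seq_unique _ _ LH.
rewrite (is_lim_seq_unique _ _ (is_lim_seq_ext _ _ _ _ LC)) => [|t]; first by case.
have [[k [C [_ [_ [_ L]]]]] _] := approx_ext_stage (t + 0).
by rewrite (L x a b F G H E).
Qed.

(** All corrections after stage p are bounded in the one norm [q n], with sum at most 2 [q n F];
    only stage p itself brings in another norm. *)
Lemma limit_ext_bound p : exists k C, 0 <= C /\ forall F j x, (j <= p)%nat -> - INR M < x < INR M ->
  Rabs (limit_ext F j x) <= C * q k F.
Proof.
have [[k [C [HC [_ [B _]]]]] _] := approx_ext_stage p.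
exists (Nat.max k n), (C + 2); split; first lra. move=> F j x Hj Hx.
have [_ H] := limit_ext_spec F j p x Hj Hx.
have := H 0%nat; rewrite [(0 + p)%nat]/= Rmult_1_r => H1.
have H2 := B F j x ltac:(lia).
have H3 := qmono k (Nat.max k n) F ltac:(lia).
have H4 := qmono n (Nat.max k n) F ltac:(lia).
have -> : limit_ext F j x = approx_ext p F j x + - (approx_ext p F j x - limit_ext F j x) by ring.
have := Rabs_triang (approx_ext p F j x) (- (approx_ext p F j x - limit_ext F j x)).
rewrite Rabs_Ropp. have := Rmult_le_compat_l _ _ _ HC H3; lra.
Qed.

(** [limit_ext] is differentiable on (-M, M) only; around every other point the product is locally
    0, whatever [limit_ext] is there. *)
Lemma smooth_cut_limit F : smooth (jmul (cut M) (limit_ext F)).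
Proof.
have Hout j x : x <= - INR M + 1 \/ INR M - 1 <= x -> jmul (cut M) (limit_ext F) j x = 0.
  move=> Hx; apply: jmul_zero_l => i _; exact: cut_out.
move=> j x; case: (classic (- INR M < x < INR M)) => Hx.
  apply: jmul_derive => i _; [exact: smooth_cut|exact: limit_ext_derive].
rewrite Hout; last lra.
apply: (is_derive_ext_loc (fun _ => 0)); last exact: is_derive_const.
exists (mkposreal 1 Rlt_0_1) => y /Rabs_def2; rewrite /minus /plus /opp /= => Hy.
rewrite Hout //; lra.
Qed.

Definition extend (F : CR) : CR := mkCR _ (smooth_cut_limit F).

Lemma extend_K F x : K x -> rjet (extend F) 0%nat x = rjet F 0%nat x.
Proof. move=> Kx; rewrite /= (cut_in K) // limit_ext_K //; exact: Rmult_1_l. Qed.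

Lemma extend_klinear x : klinear K (fun F => rjet (extend F) 0%nat x).
Proof.
move=> a b F G H E; rewrite /=.
case: (classic (- INR M < x < INR M)) => Hx.
  rewrite (limit_ext_klinear x Hx a b F G H E); ring.
rewrite cut_out //; [ring|lra].
Qed.

Lemma extend_bound p : exists k C, 0 <= C /\ forall F j x, (j <= p)%nat ->
  Rabs (rjet (extend F) j x) <= C * q k F.
Proof.
have [k [C [HC H]]] := limit_ext_bound p.
exists k, (2 ^ p * cut_sup M HM p * C); split.
  by apply: Rmult_le_pos => //; apply: Rmult_le_pos; [apply: pow_le; lra|exact: cut_sup_ge0].
move=> F j x Hj.
have Hq : 0 <= C * q k F by exact: Rmult_le_pos.
rewrite Rmult_assoc.
case: (classic (- INR M < x < INR M)) => Hx; last first.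
  rewrite /= jmul_zero_l; last by move=> i _; apply: (cut_out M HM); move: Hx INRM; clear; lra.
  rewrite Rabs_R0; apply: Rmult_le_pos => //.
  by apply: Rmult_le_pos; [apply: pow_le; lra|exact: cut_sup_ge0].
have Hj' := jmul_bound 1 j (cut M) (limit_ext F) x (cut_sup M HM p) (C * q k F) ltac:(lra)
  (fun i Hi => ltac:(rewrite pow1 Rmult_1_l; apply: cut_sup_bound; lia))
  (fun i Hi => ltac:(rewrite pow1 Rmult_1_l; apply: H => //; lia)).
rewrite pow1 Rmult_1_l in Hj'; apply: Rle_trans Hj' _.
have H3 : 2 ^ j <= 2 ^ p by apply: Rle_pow; [lra|lia].
have H4 : 0 <= cut_sup M HM p * (C * q k F) by apply: Rmult_le_pos => //; exact: cut_sup_ge0.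
have := Rmult_le_compat_r _ _ _ H4 H3; lra.
Qed.

(** The choice is not linear in f; the composite with [extend] is, because [extend] depends linearly
    on the restriction to K. *)
Definition representative (f : CinfK R_NormedModule K) : CR :=
  proj1_sig (constructive_indefinite_description _ (CinfK_restr _ K f)).

Lemma representativeE f : f = restr K (representative f).
Proof. by rewrite /representative; case: constructive_indefinite_description. Qed.

Lemma representative_val f x (Kx : K x) : evalK f (exist _ x Kx) = rjet (representative f) 0%nat x.
Proof. by rewrite {1}(representativeE f). Qed.

Lemma representative_restr F x : K x -> rjet (representative (restr K F)) 0%nat x = rjet F 0%nat x.
Proof. by move: x; apply/restr_eq; rewrite -representativeE. Qed.

Lemma dn_extension : smooth_extension_property R_NormedModule Rmult K.
Proof.
exists (fun f => extend (representative f)); split; [|split].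
- move=> a b f g h Hh t.
  apply: (extend_klinear t a b) => x Kx.
  have := Hh (exist _ x Kx); rewrite !representative_val; exact.
- move=> U HU F UF.
  have [L [p [eps [HL [Heps HG]]]]] := HU _ UF.
  have [k [C [HC HB]]] := extend_bound p.
  set c1 := 2 ^ k * cut_sup M HM k.
  have Hc1 : 0 <= c1 by apply: Rmult_le_pos; [apply: pow_le; lra|exact: cut_sup_ge0].
  have HCc : 0 < C * c1 + 1 by have := Rmult_le_pos _ _ HC Hc1; lra.
  (* If k derivatives on [-M, M] differ by less than e, the extensions differ by at most C c1 e <
     eps. *)
  pose e := eps / (C * c1 + 1).
  have He : 0 < e by exact: Rdiv_lt_0_compat.
  exists (fun x => - INR M <= x <= INR M), k, e.
  split; [exact: compact_P3|split=> // G HGF].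
  apply: HG => j x Hj _.
  set fF := representative (restr K F); set fG := representative (restr K G).
  pose D := CR_comb 1 (-1) G F.
  have HD : q k D <= c1 * e.
    apply: (q_local K M HM HK k D e) => [|i y Hi Hy]; first lra.
    rewrite CR_combE; have := HGF i y Hi Hy.
    rewrite /norm /= /abs /minus /plus /opp /= => Habs.
    have -> : 1 * rjet G i y + -1 * rjet F i y = rjet G i y + - rjet F i y by ring.
    exact: Rlt_le.
  have Hval i y : rjet (extend D) i y = rjet (extend fG) i y - rjet (extend fF) i y.
    apply: (jet_unique (y - 1) (y + 1) (rjet (extend D))
      (fun i y => rjet (extend fG) i y - rjet (extend fF) i y) i) => //; last lra.
    + apply: smooth_isjet; exact: smooth_rjet.
    + move=> i' y' _; apply: (is_derive_minus (V := R_NormedModule)); exact: smooth_rjet.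
    + move=> z _; rewrite (extend_klinear z 1 (-1) fG fF D); first ring.
      by move=> w Kw; rewrite CR_combE /fF /fG !representative_restr //.
  have := HB D j x Hj; rewrite Hval => H1.
  apply: Rle_lt_trans H1 _.
  have -> : eps = (C * c1 + 1) * e by rewrite /e; field; lra.
  have := Rmult_le_compat_l _ _ _ HC HD; nra.
- move=> f; rewrite {2}(representativeE f); apply/restr_eq => x Kx.
  exact: extend_K.
Qed.

End MittagLeffler.


(** * From an extension operator to (DN) *)

(* An m-th difference with step h equals h^m times an m-th derivative. *)
Lemma difference_point m d A0 h x : smooth d -> 0 < h -> (forall y, Rabs (d 0%nat y) <= A0) ->
  exists y, x <= y <= x + INR m * h /\ h ^ m * Rabs (d m y) <= 2 ^ m * A0.
Proof.
elim: m d A0 => [|m IH] d A0 Hd Hh HA.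
  exists x; rewrite /= !Rmult_1_l; split; [lra|exact: HA].
pose u : Jet := fun j y => d j (y + h) - d j y.
have Hu : smooth u.
  move=> j y; apply: (is_derive_minus (V := R_NormedModule)); last exact: Hd.
  rewrite -[d (S j) (y + h)]Rmult_1_l.
  apply: (is_derive_comp (d j) (fun y => y + h)); first exact: Hd.
  by auto_derive => //; ring.
have [y [Hy HB]] := IH u (2 * A0) Hu Hh (fun y => ltac:(
  rewrite /u; have := HA (y + h); have := HA y;
  have := Rabs_triang (d 0%nat (y + h)) (- d 0%nat y); rewrite Rabs_Ropp /Rminus; lra)).
have [z [Hz E]] := MVT_gen (d m) y (y + h) (d (S m)) (fun z _ => Hd m z)
  (fun z _ => proj2 (continuity_pt_filterlim (d m) z)
     (ex_derive_continuous (d m) z (ex_intro _ _ (Hd m z)))).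
rewrite Rmin_left in Hz; last lra. rewrite Rmax_right in Hz; last lra.
exists z; rewrite S_INR; split; first lra.
have -> : h ^ S m * Rabs (d (S m) z) = h ^ m * Rabs (u m y).
  rewrite /u E; have -> : y + h - y = h by ring.
  rewrite Rabs_mult (Rabs_pos_eq h) /=; lra.
rewrite /= ; lra.
Qed.

(** Some point within distance m h of x has a good bound for the m-th derivative; the mean value
    theorem carries it to x. *)
Lemma landau_step m d A0 B h x : smooth d -> 0 < h -> (forall y, Rabs (d 0%nat y) <= A0) ->
  (forall y, Rabs (d (S m) y) <= B) ->
  h ^ m * Rabs (d m x) <= 2 ^ m * A0 + INR m * h ^ S m * B.
Proof.
move=> Hd Hh HA HB.
have [y [Hy H]] := difference_point m d A0 h x Hd Hh HA.
have H1 := mvt_bound (d m) (d (S m)) y x B (fun z _ => Hd m z) (fun z _ => HB z).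
have H2 : Rabs (d m x) <= Rabs (d m y) + B * (INR m * h).
  have -> : d m x = d m y + (d m x - d m y) by ring.
  apply: Rle_trans (Rabs_triang _ _) _; apply: Rplus_le_compat_l; apply: Rle_trans H1 _.
  apply: Rmult_le_compat_l; first by apply: Rle_trans (HB x); exact: Rabs_pos.
  rewrite Rabs_minus_sym Rabs_pos_eq; lra.
have Hp : 0 < h ^ m by exact: pow_lt.
have := Rmult_le_compat_l _ _ _ (Rlt_le _ _ Hp) H2. rewrite /=; lra.
Qed.

(** Induction on the gap p: the derivative of order m + p is bounded by those of orders 0 and m + p
    + 1 with the same h, so C stays independent of h. *)
Lemma landau m p : exists C, 0 <= C /\ forall d A0 B h, smooth d -> 0 < h ->
  (forall y, Rabs (d 0%nat y) <= A0) -> (forall y, Rabs (d (m + p)%nat y) <= B) ->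
  forall x, h ^ m * Rabs (d m x) <= C * (A0 + h ^ (m + p) * B).
Proof.
elim: p => [|p [C [HC IH]]].
  exists 1; split; first lra. move=> d A0 B h Hd Hh HA HB x.
  rewrite Nat.add_0_r in HB *; have Hp : 0 < h ^ m by exact: pow_lt.
  have := Rmult_le_compat_l _ _ _ (Rlt_le _ _ Hp) (HB x).
  have := Rle_trans _ _ _ (Rabs_pos _) (HA x); lra.
exists (C * (1 + 2 ^ (m + p) + INR (m + p))).
have H2 : 0 <= 2 ^ (m + p) by apply: pow_le; lra.
have HN := pos_INR (m + p).
split; first by apply: Rmult_le_pos => //; lra.
move=> d A0 B h Hd Hh HA HB x.
have HA0 := Rle_trans _ _ _ (Rabs_pos _) (HA x).
have HB0 := Rle_trans _ _ _ (Rabs_pos _) (HB x).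
rewrite -plus_n_Sm in HB *.
have Hp : 0 < h ^ (m + p) by exact: pow_lt.
have Hp' : 0 < h ^ S (m + p) by exact: pow_lt.
have Hs y : Rabs (d (m + p)%nat y) <= (2 ^ (m + p) * A0 + INR (m + p) * h ^ S (m + p) * B) / h ^ (m + p).
  apply: (Rmult_le_reg_l (h ^ (m + p))) => //.
  apply: Rle_trans (landau_step (m + p) d A0 B h y Hd Hh HA HB) _; right; field; lra.
apply: Rle_trans (IH d A0 _ h Hd Hh HA Hs x) _.
have -> : h ^ (m + p) * ((2 ^ (m + p) * A0 + INR (m + p) * h ^ S (m + p) * B) / h ^ (m + p)) =
  2 ^ (m + p) * A0 + INR (m + p) * (h ^ S (m + p) * B) by field; lra.
rewrite Rmult_assoc; apply: Rmult_le_compat_l => //.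
have H3 : 0 <= h ^ S (m + p) * B by apply: Rmult_le_pos => //; lra.
nra.
Qed.

(** The order m lies halfway to 2m: with t = h^m the top term carries t^2, and balancing the two
    terms produces the geometric mean of (DN). For h <= 1 also h^m <= h^j, which covers all j <= m
    at once. *)
Lemma interpolation m : exists C, 0 <= C /\ forall d A0 B t, smooth d -> 0 < t <= 1 ->
  (forall y, Rabs (d 0%nat y) <= A0) -> (forall y, Rabs (d (2 * m)%nat y) <= B) ->
  forall j x, (j <= m)%nat -> t * Rabs (d j x) <= C * (A0 + t ^ 2 * B).
Proof.
(* Treated apart because h = t^(1/m) below. *)
case: (Nat.eq_dec m 0) => [->|Hm].
  exists 1; split; first lra. move=> d A0 B t Hd Ht HA HB j x Hj.
  have -> : j = 0%nat by lia.
  have := HA x; have := HB x => /=; have := Rabs_pos (d 0%nat x).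
  move=> h1 h2 h3. have : 0 <= t * (t * 1) * B by apply: Rmult_le_pos; nra.
  nra.
have [C [HC H]] : exists C, 0 <= C /\ forall d A0 B h, smooth d -> 0 < h <= 1 ->
  (forall y, Rabs (d 0%nat y) <= A0) -> (forall y, Rabs (d (2 * m)%nat y) <= B) ->
  forall j x, (j <= m)%nat -> h ^ m * Rabs (d j x) <= C * (A0 + h ^ (2 * m) * B).
  have Hj : forall i, (i <= m)%nat -> exists C, 0 <= C /\ forall d A0 B h, smooth d -> 0 < h <= 1 ->
    (forall y, Rabs (d 0%nat y) <= A0) -> (forall y, Rabs (d (2 * m)%nat y) <= B) ->
    forall j x, (j <= i)%nat -> h ^ m * Rabs (d j x) <= C * (A0 + h ^ (2 * m) * B).
  { have Hone i : (i <= m)%nat -> exists C, 0 <= C /\ forall d A0 B h, smooth d -> 0 < h <= 1 ->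
      (forall y, Rabs (d 0%nat y) <= A0) -> (forall y, Rabs (d (2 * m)%nat y) <= B) ->
      forall x, h ^ m * Rabs (d i x) <= C * (A0 + h ^ (2 * m) * B).
    { move=> Hi; have [C [HC H]] := landau i (2 * m - i).
      exists C; split=> // d A0 B h Hd Hh HA HB x.
      have E : (i + (2 * m - i) = 2 * m)%nat by lia.
      rewrite E in H; apply: Rle_trans (H d A0 B h Hd (proj1 Hh) HA HB x).
      apply: Rmult_le_compat_r; first exact: Rabs_pos.
      have -> : (m = i + (m - i))%nat by lia.
      rewrite pow_add -[X in _ <= X]Rmult_1_r; apply: Rmult_le_compat_l; first by apply: pow_le; lra.
      rewrite -(pow1 (m - i)); apply: pow_incr; lra. }
    elim=> [|i IH] Hi.
      have [C [HC H]] := Hone 0%nat ltac:(lia).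
      exists C; split=> // d A0 B h Hd Hh HA HB j x Hj.
      have -> : j = 0%nat by lia. exact: H.
    have [C1 [HC1 H1]] := IH ltac:(lia). have [C2 [HC2 H2]] := Hone (S i) Hi.
    exists (C1 + C2); split; first lra. move=> d A0 B h Hd Hh HA HB j x Hj.
    have H0 : 0 <= A0 + h ^ (2 * m) * B.
      have := Rle_trans _ _ _ (Rabs_pos _) (HA x); have := Rle_trans _ _ _ (Rabs_pos _) (HB x).
      move=> b0 a0; have := Rmult_le_pos (h ^ (2 * m)) B ltac:(apply: pow_le; lra) b0; lra.
    case: (Nat.eq_dec j (S i)) => [->|Hne].
      have := H2 d A0 B h Hd Hh HA HB x; nra.
    have := H1 d A0 B h Hd Hh HA HB j x ltac:(lia); nra. }
  exact: Hj.
exists C; split=> // d A0 B t Hd [Ht Ht1] HA HB j x Hj.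
pose h := Rpower t (/ INR m).
have HM : 0 < INR m by apply: lt_0_INR; lia.
have Hh : 0 < h by exact: exp_pos.
have Ehm : h ^ m = t.
  rewrite -Rpower_pow // /h Rpower_mult Rinv_l; last lra. exact: Rpower_1.
have Hh1 : h <= 1.
  apply: Rnot_lt_le => Hgt.
  have := Rlt_pow_R1 h m Hgt ltac:(lia). lra.
have := H d A0 B h Hd (conj Hh Hh1) HA HB j x Hj.
by rewrite Nat.mul_comm pow_mult Ehm.
Qed.

Section Necessity.

Variables (K : R -> Prop) (M : nat).
Hypothesis HM : (2 <= M)%nat.
Hypothesis HK : forall x, K x -> - INR M + 2 <= x <= INR M - 2.

Notation q := (qnorm K).

Let qge0 := q_ge0 K M HM HK.

Variable E : CinfK R_NormedModule K -> CR.
Hypothesis Elin : linear_operator Rmult E.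
Hypothesis Econt : continuous_operator E.
Hypothesis Eext : forall f, restr K (E f) = f.

Lemma ext_jet_klinear j x : klinear K (fun F => rjet (E (restr K F)) j x).
Proof.
move=> a b F G H HH.
apply: (jet_unique (x - 1) (x + 1) (rjet (E (restr K H)))
  (fun i y => a * rjet (E (restr K F)) i y + b * rjet (E (restr K G)) i y) j) => //; last lra.
- by apply: smooth_isjet; exact: smooth_rjet.
- by apply: smooth_isjet; apply: smooth_comb; exact: smooth_rjet.
- move=> y _; exact: (Elin a b (restr K F) (restr K G) (restr K H)
    (fun z => HH (proj1_sig z) (proj2_sig z)) y).
Qed.

(** Continuity at 0 gives a neighbourhood whose image is bounded by 1 in C^p([-M, M]); homogeneity
    does the rest. *)
Lemma ext_bound p : exists k C, 0 <= C /\ forall F j x, (j <= p)%nat ->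
  - INR M <= x <= INR M -> Rabs (rjet (E (restr K F)) j x) <= C * q k F.
Proof.
(* A bound d < 1 uniform in j and x makes openness immediate, without a compactness argument. *)
pose U (G : CR) := exists d, d < 1 /\ forall j x, (j <= p)%nat -> - INR M <= x <= INR M ->
  Rabs (rjet G j x) <= d.
have HU : Cinf_open U.
  move=> G [d [Hd HG]]; exists (fun x => - INR M <= x <= INR M), p, ((1 - d) / 2).
  split; [exact: compact_P3|split; first lra].
  move=> G' HG'; exists ((1 + d) / 2); split; first lra.
  move=> j x Hj Hx; have := HG j x Hj Hx; have := HG' j x Hj Hx.
  rewrite /norm /= /abs /minus /plus /opp /= -/(rjet G' j x) -/(rjet G j x) => h1 h2.
  have -> : rjet G' j x = (rjet G' j x + - rjet G j x) + rjet G j x by ring.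
  apply: Rle_trans (Rabs_triang _ _) _; lra.
have H0 : U (E (restr K CR_zero)).
  exists 0; split; first lra. move=> j x _ _.
  rewrite (ext_jet_klinear j x 0 0 CR_zero CR_zero CR_zero) => [|y _].
    by rewrite !Rmult_0_l Rplus_0_r Rabs_R0; right.
  by rewrite /=; ring.
have [L [k [eps [_ [Heps HG]]]]] := Econt U HU CR_zero H0.
have HC : 0 <= 2 / eps by left; apply: Rdiv_lt_0_compat; lra.
exists k, (2 / eps); split=> //.
suff Hb j x : (j <= p)%nat -> - INR M <= x <= INR M -> forall F : CR,
    Rabs (rjet (E (restr K F)) j x) <= 2 / eps * q k F.
  by move=> F j x Hj Hx; apply: Hb.
move=> Hj Hx; apply: (functional_bound K M HM HK _ k _ HC (ext_jet_klinear j x)) => F b Hb HF.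
apply: le_epsilon => e He.
(* Strictly larger than b, so that scaling also works for b = 0; after multiplication by 2 / eps the
   excess is exactly e. *)
pose b' := b + e * eps / 2.
have Hee : 0 < e * eps by exact: Rmult_lt_0_compat.
have Hb' : 0 < b' by rewrite /b'; lra.
pose s := eps / (2 * b').
have Hs : 0 < s by apply: Rdiv_lt_0_compat; lra.
have [d [Hd Hbd]] : U (E (restr K (CR_comb s 0 F F))).
  apply: HG => i y Hi _.
  rewrite /norm /= /abs /minus /plus /opp /= -/(rjet F i y).
  have -> : s * rjet F i y + 0 * rjet F i y + - 0 = s * rjet F i y by ring.
  rewrite Rabs_mult (Rabs_pos_eq s); last lra.
  have h : Rabs (rjet F i y) <= b by exact: (HF i y Hi).
  apply: (Rle_lt_trans _ (s * b')).
    apply: Rmult_le_compat_l; rewrite /b'; lra.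
  rewrite /s; have -> : eps / (2 * b') * b' = eps / 2 by field; lra. lra.
have := Hbd j x Hj Hx.
rewrite (ext_jet_klinear j x s 0 F F (CR_comb s 0 F F)) => [|y _]; last exact: CR_combE.
rewrite Rmult_0_l Rplus_0_r Rabs_mult (Rabs_pos_eq s); last lra.
move=> h.
have -> : 2 / eps * b + e = 2 / eps * b' by rewrite /b'; field; lra.
apply: (Rmult_le_reg_l s) => //.
have -> : s * (2 / eps * b') = 1 by rewrite /s; field; lra.
lra.
Qed.

(** The dominating norm is the one that bounds the values of E on [-M, M], while k also controls
    derivatives up to order 2m. Interpolation of the cut-off extension with t = sqrt(q_n / q_k), at
    most 1 since n <= k, balances both terms. *)
Lemma extension_dn : exists n, forall m, (n <= m)%nat -> exists k c, (m <= k)%nat /\ 0 < c /\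
  forall F : CR, q m F * q m F <= c * (q k F * q n F).
Proof.
have [n [C0 [HC0 H0]]] := ext_bound 0.
exists n => m Hnm.
have [k0 [C1 [HC1 H1]]] := ext_bound (2 * m).
have [C2 [HC2 H2]] := interpolation m.
pose k := Nat.max k0 m.
pose a0 := 2 ^ 0 * cut_sup M HM 0 * C0 + 1.
pose a1 := 2 ^ (2 * m) * cut_sup M HM (2 * m) * C1 + 1.
have Hcut p C : 0 <= C -> 0 <= 2 ^ p * cut_sup M HM p * C.
  move=> HC; apply: Rmult_le_pos => //; apply: Rmult_le_pos; [apply: pow_le; lra|exact: cut_sup_ge0].
have Ha0 : 1 <= a0 by have := Hcut 0%nat C0 HC0; rewrite /a0; lra.
have Ha1 : 1 <= a1 by have := Hcut (2 * m)%nat C1 HC1; rewrite /a1; lra.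
pose c := C2 * (a0 + a1) + 1.
have Hc1 : 1 <= c by rewrite /c; have := Rmult_le_pos C2 (a0 + a1) HC2 ltac:(lra); lra.
exists k, (c * c); split; [rewrite /k; lia|split; [nra|]] => F.
have Hn := qge0 n F. have Hk := qge0 k F. have Hm := qge0 m F.
pose G := cutoff M (E (restr K F)).
have HG x : K x -> rjet G 0%nat x = rjet F 0%nat x.
  move=> Kx; rewrite (cutoff_in K M HK) //.
  by move: x Kx; apply/restr_eq; exact: Eext.
have HG0 y : Rabs (rjet G 0%nat y) <= a0 * q n F.
  have := cut_mul_bound M HM 0 (rjet (E (restr K F))) (C0 * q n F) (Rmult_le_pos _ _ HC0 Hn)
    (fun j x Hj Hx => H0 F j x Hj Hx) 0%nat y (le_n _).
  rewrite /a0 -[jmul _ _ _ _]/(rjet G 0%nat y); lra.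
have HG1 y : Rabs (rjet G (2 * m)%nat y) <= a1 * q k F.
  have Hk0 := qge0 k0 F.
  have := cut_mul_bound M HM (2 * m) (rjet (E (restr K F))) (C1 * q k0 F) (Rmult_le_pos _ _ HC1 Hk0)
    (fun j x Hj Hx => H1 F j x Hj Hx) (2 * m)%nat y (le_n _).
  have Hkk := q_mono K M HM HK k0 k F ltac:(rewrite /k; lia).
  have := Rmult_le_compat_l _ _ _ (Hcut (2 * m)%nat C1 HC1) Hkk.
  rewrite /a1 -[jmul _ _ _ _]/(rjet G (2 * m)%nat y); lra.
have Hint t : 0 < t <= 1 -> t * q m F <= C2 * (a0 * q n F + t ^ 2 * (a1 * q k F)).
  move=> Ht.
  have Hle : q m F <= C2 * (a0 * q n F + t ^ 2 * (a1 * q k F)) / t.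
    apply: (q_le K m F G) => [|j x Hj]; first exact: HG.
    apply: (Rmult_le_reg_l t); first lra.
    have -> : forall z, t * (z / t) = z by move=> z; field; lra.
    exact: (H2 (rjet G) _ _ t (smooth_rjet G) Ht HG0 HG1 j x Hj).
  have := Rmult_le_compat_l t _ _ ltac:(lra) Hle.
  have -> : forall z, t * (z / t) = z by move=> z; field; lra.
  done.
(* If q_n vanishes no balance is possible, but arbitrarily small t then force q_m = 0. *)
case: (Rle_lt_dec (q n F) 0) => Hn0.
  have E0 : q n F = 0 by lra.
  suff : q m F <= 0 by rewrite E0; nra.
  apply: Rnot_lt_le => Hpos.
  pose b := C2 * a1 * q k F.
  have Hb : 0 <= b by apply: Rmult_le_pos => //; apply: Rmult_le_pos; lra.
  pose t := Rmin 1 (q m F / (2 * (b + 1))).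
  have Hq : 0 < q m F / (2 * (b + 1)) by apply: Rdiv_lt_0_compat; lra.
  have Ht : 0 < t <= 1 by split; [apply: Rmin_pos; lra|exact: Rmin_l].
  have := Hint t Ht; rewrite E0.
  have -> : C2 * (a0 * 0 + t ^ 2 * (a1 * q k F)) = t * (t * b) by rewrite /b; ring.
  move=> /(Rmult_le_reg_l _ _ _ (proj1 Ht)) h.
  have h2 : t <= q m F / (2 * (b + 1)) by exact: Rmin_r.
  have := Rmult_le_compat_r b _ _ Hb h2.
  have : q m F / (2 * (b + 1)) * b <= q m F / 2.
    have -> : q m F / 2 = q m F / (2 * (b + 1)) * (b + 1) by field; lra.
    apply: Rmult_le_compat_l; lra.
  lra.
have Hnk := q_mono K M HM HK n k F ltac:(rewrite /k; lia).
pose t := sqrt (q n F / q k F).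
have Hr : 0 < q n F / q k F by apply: Rdiv_lt_0_compat; lra.
have Ht0 : 0 < t by exact: sqrt_lt_R0.
have Htt : t * t = q n F / q k F by apply: sqrt_sqrt; lra.
have Htk : t ^ 2 * q k F = q n F by rewrite /= Rmult_1_r Htt; field; lra.
have Ht1 : t <= 1.
  rewrite -sqrt_1; apply: sqrt_le_1; try lra.
  apply: (Rmult_le_reg_r (q k F)); first lra.
  have -> : q n F / q k F * q k F = q n F by field; lra. lra.
have := Hint t (conj Ht0 Ht1).
have -> : C2 * (a0 * q n F + t ^ 2 * (a1 * q k F)) = C2 * (a0 + a1) * q n F.
  have -> : t ^ 2 * (a1 * q k F) = a1 * (t ^ 2 * q k F) by ring.
  rewrite Htk; ring.
move=> h.
have h2 : t * q m F <= c * q n F by rewrite /c; lra.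
have h3 : (t * q m F) * (t * q m F) <= (c * q n F) * (c * q n F).
  have : 0 <= t * q m F by apply: Rmult_le_pos; lra.
  move=> h0; apply: Rmult_le_compat => //.
have Ht2 : 0 < t * t by exact: Rmult_lt_0_compat.
apply: (Rmult_le_reg_l (t * t)) => //.
have -> : t * t * (c * c * (q k F * q n F)) = c * q n F * (c * (t ^ 2 * q k F)) by ring.
rewrite Htk; lra.
Qed.

End Necessity.


(** * Real and complex scalars *)

Lemma real_characterization (K : R -> Prop) (M : nat) : (2 <= M)%nat ->
  (forall x, K x -> - INR M + 2 <= x <= INR M - 2) ->
  (smooth_extension_property R_NormedModule Rmult K <-> DN (CinfK_norm R_NormedModule K)).
Proof.
move=> HM HK; split.
- move=> [E [Elin [Econt Eext]]].
  have [n H] := extension_dn K M HM HK E Elin Econt Eext.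
  exists n => m Hm; have [k [c [Hk [Hc HH]]]] := H m Hm.
  exists k, c; split=> //; split=> // f.
  have [F ->] := CinfK_restr _ K f.
  rewrite !(q_finite K M HM HK) /=; exact: HH.
- move=> [n H]; apply: (dn_extension K M HM HK n) => m Hm.
  have [k [c [Hk [Hc HH]]]] := H m Hm.
  exists k, c; split=> //; split=> // F.
  have := HH (restr K F); by rewrite !(q_finite K M HM HK).
Qed.

Notation CC := (Cinf C_R_NormedModule).
Notation CV := C_R_NormedModule.

Lemma CV_norm (z : CV) : norm z = sqrt (fst z ^ 2 + snd z ^ 2).
Proof.
rewrite -(pow2_abs (fst z)) -(pow2_abs (snd z)); reflexivity.
Qed.

Lemma CV_norm_fst (z : CV) : Rabs (fst z) <= norm z.
Proof.
rewrite CV_norm; have [h _] := sqrt_plus_sqr (fst z) (snd z).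
exact: Rle_trans (Rmax_l _ _) h.
Qed.

Lemma CV_norm_snd (z : CV) : Rabs (snd z) <= norm z.
Proof.
rewrite CV_norm; have [h _] := sqrt_plus_sqr (fst z) (snd z).
exact: Rle_trans (Rmax_r _ _) h.
Qed.

Lemma CV_norm_le (z : CV) : norm z <= Rabs (fst z) + Rabs (snd z).
Proof.
have H1 := Rabs_pos (fst z); have H2 := Rabs_pos (snd z).
rewrite CV_norm -(sqrt_Rsqr (Rabs (fst z) + Rabs (snd z))); last lra.
apply: sqrt_le_1_alt; rewrite /Rsqr -(pow2_abs (fst z)) -(pow2_abs (snd z)); nra.
Qed.

Lemma smooth_fst (F : CC) : smooth (fun j x => fst (jet F j x)).
Proof.
move=> j x.
apply: (filterdiff_comp' (K := R_AbsRing) (U := R_NormedModule) (V := CV) (W := R_NormedModule)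
  (jet F j) (fun z => fst z) x _ (fun z => fst z) (jet_derive F j x)).
exact: (filterdiff_linear (U := CV) (V := R_NormedModule) (fun z => fst z)
  (is_linear_fst (U := R_NormedModule) (V := R_NormedModule))).
Qed.

Lemma smooth_snd (F : CC) : smooth (fun j x => snd (jet F j x)).
Proof.
move=> j x.
apply: (filterdiff_comp' (K := R_AbsRing) (U := R_NormedModule) (V := CV) (W := R_NormedModule)
  (jet F j) (fun z => snd z) x _ (fun z => snd z) (jet_derive F j x)).
exact: (filterdiff_linear (U := CV) (V := R_NormedModule) (fun z => snd z)
  (is_linear_snd (U := R_NormedModule) (V := R_NormedModule))).
Qed.

Definition re_part (F : CC) : CR := mkCR _ (smooth_fst F).
Definition im_part (F : CC) : CR := mkCR _ (smooth_snd F).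

Lemma is_derive_pair (u v : R -> R) (x a b : R) : is_derive u x a -> is_derive v x b ->
  is_derive (V := CV) (fun y => (u y, v y) : CV) x ((a, b) : CV).
Proof.
move=> Hu Hv.
have E s t : ((s, t) : CV) = plus (scal s ((1, 0) : CV)) (scal t ((0, 1) : CV)).
  by rewrite /plus /scal /= /prod_plus /prod_scal /= /plus /scal /= /mult /=; congr pair; ring.
rewrite (E a b).
apply: (is_derive_ext (fun y => plus (scal (u y) ((1, 0) : CV)) (scal (v y) ((0, 1) : CV)))).
  by move=> t; rewrite (E (u t)).
by apply: (is_derive_plus (V := CV)); apply: (is_derive_scal_l (V := CV)).
Qed.

Definition of_parts (u v : CR) : CC :=
  @MkCinf CV (fun j x => (rjet u j x, rjet v j x))
    (fun j x => is_derive_pair _ _ x _ _ (smooth_rjet u j x) (smooth_rjet v j x)).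

Section Complexification.

Variables (K : R -> Prop) (M : nat).
Hypothesis HM : (2 <= M)%nat.
Hypothesis HK : forall x, K x -> - INR M + 2 <= x <= INR M - 2.

Notation q := (@qnorm R_NormedModule K).
Notation qC := (@qnorm CV K).

Lemma C_bounded_extension n (F : CC) : exists G b,
  (forall x, K x -> jet G 0%nat x = jet F 0%nat x) /\ bounded_by n G b.
Proof.
have [G1 [b1 [E1 B1]]] := bounded_extension K M HM HK n (re_part F).
have [G2 [b2 [E2 B2]]] := bounded_extension K M HM HK n (im_part F).
exists (of_parts G1 G2), (b1 + b2); split.
- move=> x Kx; rewrite /= E1 // E2 //=; by case: (jet F 0%nat x).
- move=> j x Hj; apply: Rle_trans (CV_norm_le _) _.
  apply: Rplus_le_compat; [exact: (B1 j x Hj)|exact: (B2 j x Hj)].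
Qed.

Lemma qC_finite n (F : CC) : CinfK_norm CV K n (restr K F) = Finite (qC n F).
Proof.
have [G [b [H1 H2]]] := C_bounded_extension n F.
by have [H _] := qnorm_spec _ K n F G b H1 H2.
Qed.

Lemma qC_ge0 n (F : CC) : 0 <= qC n F.
Proof.
have [G [b [H1 H2]]] := C_bounded_extension n F.
by have [_ [H _]] := qnorm_spec _ K n F G b H1 H2.
Qed.

Lemma qC_approx n (F : CC) b : qC n F < b ->
  exists G : CC, (forall x, K x -> jet G 0%nat x = jet F 0%nat x) /\ bounded_by n G b.
Proof.
have [G [b0 [H1 H2]]] := C_bounded_extension n F.
by have [_ [_ [_ H]]] := qnorm_spec _ K n F G b0 H1 H2; exact: H.
Qed.

Lemma qC_le n (F G : CC) b : (forall x, K x -> jet G 0%nat x = jet F 0%nat x) ->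
  bounded_by n G b -> qC n F <= b.
Proof. by move=> H1 H2; have [_ [_ [H _]]] := qnorm_spec _ K n F G b H1 H2; apply: H H2. Qed.

Lemma q_re n F : q n (re_part F) <= qC n F.
Proof.
apply: le_epsilon => e He.
have [G [H1 H2]] := qC_approx n F (qC n F + e) ltac:(lra).
apply: (q_le K n (re_part F) (re_part G)) => [x Kx|j x Hj]; first by rewrite /= H1.
exact: Rle_trans (CV_norm_fst _) (H2 j x Hj).
Qed.

Lemma q_im n F : q n (im_part F) <= qC n F.
Proof.
apply: le_epsilon => e He.
have [G [H1 H2]] := qC_approx n F (qC n F + e) ltac:(lra).
apply: (q_le K n (im_part F) (im_part G)) => [x Kx|j x Hj]; first by rewrite /= H1.
exact: Rle_trans (CV_norm_snd _) (H2 j x Hj).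
Qed.

Lemma qC_parts n F : qC n F <= q n (re_part F) + q n (im_part F).
Proof.
apply: le_epsilon => e He.
have [G1 [E1 B1]] := q_approx K M HM HK n (re_part F) (q n (re_part F) + e / 2) ltac:(lra).
have [G2 [E2 B2]] := q_approx K M HM HK n (im_part F) (q n (im_part F) + e / 2) ltac:(lra).
apply: (qC_le n F (of_parts G1 G2)).
- move=> x Kx; rewrite /= E1 // E2 //=; by case: (jet F 0%nat x).
- move=> j x Hj; apply: Rle_trans (CV_norm_le _) _.
  have h1 : Rabs (fst (jet (of_parts G1 G2) j x)) <= q n (re_part F) + e / 2 by exact: (B1 j x Hj).
  have h2 : Rabs (snd (jet (of_parts G1 G2) j x)) <= q n (im_part F) + e / 2 by exact: (B2 j x Hj).
  lra.
Qed.

Lemma DN_complexify : DN (CinfK_norm R_NormedModule K) <-> DN (CinfK_norm CV K).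
Proof.
split=> -[n H]; exists n => m Hm; have [k [c [Hk [Hc HH]]]] := H m Hm.
(* If a and b are the norms of the two parts, the complex norm is at most a + b, and (a + b)^2 <=
   2(a^2 + b^2), where a^2 and b^2 each obey (DN) with c. *)
- exists k, (4 * c); split=> //; split; first lra. move=> f.
  have [F ->] := CinfK_restr _ K f.
  have H1 := HH (restr K (re_part F)). have H2 := HH (restr K (im_part F)).
  rewrite !(q_finite K M HM HK) /= in H1 H2.
  rewrite !qC_finite /=.
  have := qC_parts m F. have := q_re k F. have := q_im k F. have := q_re n F. have := q_im n F.
  have := qC_ge0 m F.
  have := q_ge0 K M HM HK n (re_part F). have := q_ge0 K M HM HK n (im_part F).
  have := q_ge0 K M HM HK k (re_part F). have := q_ge0 K M HM HK k (im_part F).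
  have := q_ge0 K M HM HK m (re_part F). have := q_ge0 K M HM HK m (im_part F).
  move: H1 H2.
  set a := q m (re_part F); set b := q m (im_part F); set A := qC m F.
  set ak := q k (re_part F); set bk := q k (im_part F); set Ak := qC k F.
  set an := q n (re_part F); set bn := q n (im_part F); set An := qC n F.
  move=> H1 H2 h1 h2 h3 h4 h5 h6 h7 h8 h9 h10 h11 h12.
  have X1 : ak * an <= Ak * An by apply: Rmult_le_compat.
  have X2 : bk * bn <= Ak * An by apply: Rmult_le_compat.
  have Y1 := Rmult_le_compat_l c _ _ (Rlt_le _ _ Hc) X1.
  have Y2 := Rmult_le_compat_l c _ _ (Rlt_le _ _ Hc) X2.
  have Z : A * A <= (a + b) * (a + b) by apply: Rmult_le_compat.
  have := pow2_ge_0 (a - b); rewrite /=; nra.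
- exists k, c; split=> //; split=> // f.
  have [F ->] := CinfK_restr _ K f.
  have := HH (restr K (of_parts F CR_zero)).
  have E p : qC p (of_parts F CR_zero) = q p F.
    apply: Rle_antisym.
    - have := qC_parts p (of_parts F CR_zero).
      have -> : re_part (of_parts F CR_zero) = F by apply: CR_ext.
      have -> : im_part (of_parts F CR_zero) = CR_zero by apply: CR_ext.
      rewrite (q_zero K M HM HK p CR_zero) //; lra.
    - have := q_re p (of_parts F CR_zero).
      by have -> : re_part (of_parts F CR_zero) = F by apply: CR_ext.
  by rewrite !(q_finite K M HM HK) !qC_finite !E.
Qed.

End Complexification.

Lemma compact_bounded_sym (L : R -> Prop) : compact L -> exists A, forall x, L x -> - A <= x <= A.
Proof.
move=> /compact_P1 [a [b H]]; exists (Rabs a + Rabs b) => x /H Hx.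
have := Rle_abs b; have := Rle_abs (- a); rewrite Rabs_Ropp.
have := Rabs_pos a; have := Rabs_pos b; lra.
Qed.

Lemma CV_minus (z w : CV) : fst (minus z w) = fst z - fst w /\ snd (minus z w) = snd z - snd w.
Proof. by case: z w => z1 z2 [w1 w2]. Qed.

Section Scalars.

Variable K : R -> Prop.

Lemma sep_real : smooth_extension_property CV Cmult K ->
  smooth_extension_property R_NormedModule Rmult K.
Proof.
move=> [E [Elin [Econt Eext]]].
pose lift (f : CinfK R_NormedModule K) : CinfK CV K := restr K (of_parts (representative K f) CR_zero).
exists (fun f => re_part (E (lift f))); split; [|split].
- move=> a b f g h Hh t.
  have := Elin (RtoC a) (RtoC b) (lift f) (lift g) (lift h) _ t.
  rewrite /eval /= => ->.
    by rewrite /plus /= /prod_plus /= /plus /=; ring.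
  move=> [x Kx]; have := Hh (exist _ x Kx).
  rewrite !(representative_val K) /evalK /= /eval /= => ->.
  by rewrite /plus /= /prod_plus /= /plus /= /Cmult /=; congr pair; ring.
- move=> U HU F UF.
  pose U' (G : CC) := U (re_part G).
  have HU' : Cinf_open U'.
    move=> G UG; have [L [p [eps [HL [He HH]]]]] := HU _ UG.
    exists L, p, eps; split=> //; split=> // G' HG'; apply: HH => j x Hj Lx.
    apply: Rle_lt_trans (HG' j x Hj Lx).
    have := CV_norm_fst (minus (jet G' j x) (jet G j x)).
    by rewrite (proj1 (CV_minus _ _)).
  have lift_restr G : lift (restr K G) = restr K (of_parts G CR_zero).
    apply/restr_eq => x Kx /=; by rewrite (representative_restr K G x Kx).
  rewrite lift_restr in UF.
  have [L [p [eps [HL [He HH]]]]] := Econt U' HU' (of_parts F CR_zero) UF.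
  exists L, p, eps; split=> //; split=> // G HG.
  rewrite lift_restr; apply: HH => j x Hj Lx.
  apply: Rle_lt_trans (CV_norm_le _) _; rewrite (proj1 (CV_minus _ _)) (proj2 (CV_minus _ _)) /=.
  rewrite Rminus_0_r Rabs_R0 Rplus_0_r; exact: (HG j x Hj Lx).
- move=> f; rewrite {2}(representativeE K f); apply/restr_eq => x Kx /=.
  have := proj2 (restr_eq CV K (E (lift f)) (of_parts (representative K f) CR_zero)) (Eext _) x Kx.
  by move=> ->.
Qed.

Definition Crepresentative (f : CinfK CV K) : CC :=
  proj1_sig (constructive_indefinite_description _ (CinfK_restr CV K f)).

Lemma CrepresentativeE f : f = restr K (Crepresentative f).
Proof. by rewrite /Crepresentative; case: constructive_indefinite_description. Qed.

Lemma Crepresentative_val f x (Kx : K x) : evalK f (exist _ x Kx) = jet (Crepresentative f) 0%nat x.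
Proof. by rewrite {1}(CrepresentativeE f). Qed.

Lemma Crepresentative_restr F x : K x -> jet (Crepresentative (restr K F)) 0%nat x = jet F 0%nat x.
Proof. by move: x; apply/restr_eq; rewrite -CrepresentativeE. Qed.

(** Continuity by open sets unfolded at one point, on symmetric intervals, so that the conditions
    for real and imaginary parts can be combined by maxima and minima. *)
Lemma continuous_operator_near (E : CinfK R_NormedModule K -> CR) (F : CR) (L : R -> Prop) p eps :
  continuous_operator E -> compact L -> 0 < eps ->
  exists A n e, 0 < e /\ forall G, (forall j x, (j <= n)%nat -> - A <= x <= A ->
     Rabs (rjet G j x - rjet F j x) < e) ->
   forall j x, (j <= p)%nat -> L x -> Rabs (rjet (E (restr K G)) j x - rjet (E (restr K F)) j x) < eps.
Proof.
move=> Econt HL He.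
pose U (G : CR) := exists d, d < eps /\ forall j x, (j <= p)%nat -> L x ->
  Rabs (rjet G j x - rjet (E (restr K F)) j x) <= d.
have HU : Cinf_open U.
  move=> G [d [Hd HG]]; exists L, p, ((eps - d) / 2); split=> //; split; first lra.
  move=> G' HG'; exists ((eps + d) / 2); split; first lra.
  move=> j x Hj Lx; have := HG j x Hj Lx; have := HG' j x Hj Lx.
  rewrite -[norm _]/(Rabs (rjet G' j x - rjet G j x)) => h1 h2.
  have -> : rjet G' j x - rjet (E (restr K F)) j x =
    (rjet G' j x - rjet G j x) + (rjet G j x - rjet (E (restr K F)) j x) by ring.
  apply: Rle_trans (Rabs_triang _ _) _; lra.
have UF : U (E (restr K F)).
  exists 0; split=> // j x _ _; rewrite Rminus_eq_0 Rabs_R0; exact: Rle_refl.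
have [L' [n [e [HL' [He' HH]]]]] := Econt U HU F UF.
have [A HA] := compact_bounded_sym L' HL'.
exists A, n, e; split=> // G HG j x Hj Lx.
have [|d [Hd Hdd]] := HH G; last by apply: Rle_lt_trans (Hdd j x Hj Lx) Hd.
by move=> i y Hi Ly; apply: HG => //; apply: HA.
Qed.

Lemma sep_complex : smooth_extension_property R_NormedModule Rmult K ->
  smooth_extension_property CV Cmult K.
Proof.
move=> [E [Elin [Econt Eext]]].
pose Er (F : CC) := E (restr K (re_part F)).
pose Ei (F : CC) := E (restr K (im_part F)).
have Eparts (F G : CC) : (forall x, K x -> jet F 0%nat x = jet G 0%nat x) -> Er F = Er G /\ Ei F = Ei G.
  move=> H; split; congr E; apply/restr_eq => x Kx /=; by rewrite H.
exists (fun f => of_parts (Er (Crepresentative f)) (Ei (Crepresentative f))); split; [|split].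
- move=> a b f g h Hh t.
  (* Complex scalars mix real and imaginary parts, so each part of a f + b g is a real combination
     of four functions. *)
  have Hl F1 F2 G1 G2 H s1 s2 r1 r2 : (forall x, K x -> rjet H 0%nat x =
      s1 * rjet F1 0%nat x + s2 * rjet F2 0%nat x + (r1 * rjet G1 0%nat x + r2 * rjet G2 0%nat x)) ->
    rjet (E (restr K H)) 0%nat t =
      s1 * rjet (E (restr K F1)) 0%nat t + s2 * rjet (E (restr K F2)) 0%nat t +
      (r1 * rjet (E (restr K G1)) 0%nat t + r2 * rjet (E (restr K G2)) 0%nat t).
    move=> HE.
    have L := ext_jet_klinear K E Elin 0%nat t.
    rewrite (L 1 1 (CR_comb s1 s2 F1 F2) (CR_comb r1 r2 G1 G2) H) => [|x Kx]; last first.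
      by rewrite !CR_combE HE //; ring.
    rewrite (L s1 s2 F1 F2 (CR_comb s1 s2 F1 F2)) => [|x _]; last exact: CR_combE.
    rewrite (L r1 r2 G1 G2 (CR_comb r1 r2 G1 G2)) => [|x _]; last exact: CR_combE.
    ring.
  set hf := Crepresentative f; set hg := Crepresentative g; set hh := Crepresentative h.
  have Hval x : K x -> jet hh 0%nat x = plus (Cmult a (jet hf 0%nat x)) (Cmult b (jet hg 0%nat x)).
    by move=> Kx; have := Hh (exist _ x Kx); rewrite !Crepresentative_val.
  have X1 := Hl (re_part hf) (im_part hf) (re_part hg) (im_part hg) (re_part hh)
    (fst a) (- snd a) (fst b) (- snd b).
  have X2 := Hl (im_part hf) (re_part hf) (im_part hg) (re_part hg) (im_part hh)
    (fst a) (snd a) (fst b) (snd b).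
  have {}X1 := X1 ltac:(move=> x Kx; rewrite /= Hval //= /plus /=; ring).
  have {}X2 := X2 ltac:(move=> x Kx; rewrite /= Hval //= /plus /=; ring).
  rewrite /eval [jet _ _ _]/= /Er /Ei X1 X2 /plus /= /prod_plus /= /plus /= /Cmult /=.
  by congr pair; ring.
- move=> U HU F UF.
  have [E1 E2] := Eparts (Crepresentative (restr K F)) F (fun x Kx => Crepresentative_restr F x Kx).
  rewrite E1 E2 in UF.
  have [L [p [eps [HL [He HH]]]]] := HU _ UF.
  have [A1 [n1 [e1 [He1 H1]]]] := continuous_operator_near E (re_part F) L p (eps / 2) Econt HL ltac:(lra).
  have [A2 [n2 [e2 [He2 H2]]]] := continuous_operator_near E (im_part F) L p (eps / 2) Econt HL ltac:(lra).
  exists (fun x => - Rmax A1 A2 <= x <= Rmax A1 A2), (Nat.max n1 n2), (Rmin e1 e2).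
  split; [exact: compact_P3|split; first exact: Rmin_pos].
  move=> G HG.
  have [F1 F2] := Eparts (Crepresentative (restr K G)) G (fun x Kx => Crepresentative_restr G x Kx).
  rewrite F1 F2; apply: HH => j x Hj Lx.
  apply: Rle_lt_trans (CV_norm_le _) _; rewrite (proj1 (CV_minus _ _)) (proj2 (CV_minus _ _)) /=.
  have X1 := H1 (re_part G) (fun i y Hi Hy => ltac:(
    apply: Rle_lt_trans (Rlt_le_trans _ _ _ (HG i y ltac:(lia)
      ltac:(have := Rmax_l A1 A2; lra)) (Rmin_l _ _));
    apply: Rle_trans (CV_norm_fst _); rewrite (proj1 (CV_minus _ _)); exact: Rle_refl)) j x Hj Lx.
  have X2 := H2 (im_part G) (fun i y Hi Hy => ltac:(
    apply: Rle_lt_trans (Rlt_le_trans _ _ _ (HG i y ltac:(lia)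
      ltac:(have := Rmax_r A1 A2; lra)) (Rmin_r _ _));
    apply: Rle_trans (CV_norm_snd _); rewrite (proj2 (CV_minus _ _)); exact: Rle_refl)) j x Hj Lx.
  rewrite /Er /Ei; lra.
- move=> f; rewrite {3}(CrepresentativeE f); apply/restr_eq => x Kx /=.
  have X1 := proj2 (restr_eq R_NormedModule K _ _) (Eext (restr K (re_part (Crepresentative f)))) x Kx.
  have X2 := proj2 (restr_eq R_NormedModule K _ _) (Eext (restr K (im_part (Crepresentative f)))) x Kx.
  rewrite /Er /Ei /rjet X1 X2 /=; by case: (jet _ _ _).
Qed.

End Scalars.

Theorem mainTheorem2 (K : R -> Prop) (hK : compact K) :
  (smooth_extension_property R_NormedModule Rmult K <->
     DN (CinfK_norm R_NormedModule K)) /\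
  (smooth_extension_property C_R_NormedModule Cmult K <->
     DN (CinfK_norm C_R_NormedModule K)).
Proof.
have [A HA] := compact_bounded_sym K hK.
have [M [HM HMK]] : exists M, (2 <= M)%nat /\ forall x, K x -> - INR M + 2 <= x <= INR M - 2.
  (* The margin 2 around K holds a ramp of the cut-off function and the strip where it vanishes. *)
  exists (2 + Z.to_nat (up (Rabs A)))%nat; split; first lia.
  have [H _] := archimed (Rabs A); have H0 := Rabs_pos A.
  have Hz : (0 <= up (Rabs A))%Z by apply: le_IZR; lra.
  move=> x /HA Hx.
  rewrite plus_INR [INR (Z.to_nat _)]INR_IZR_INZ Z2Nat.id //=.
  have := Rle_abs A; lra.
have HR := real_characterization K M HM HMK.
split=> //; split.
- move=> H; exact: (proj1 (DN_complexify K M HM HMK) (proj1 HR (sep_real K H))).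
- move=> H; exact: (sep_complex K (proj2 HR (proj2 (DN_complexify K M HM HMK) H))).
Qed.
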